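(* Let $\alpha,\beta\in\bar{\mathbb{Q}}\setminus\{0,1\}$. If $R(\alpha)\cap R(\beta)=\emptyset$, then \[ T(\alpha,\beta) \subseteq \bigl(S(\alpha)\cap S(\beta)\bigr)\cup\bigl(S(\alpha)\cap R(\beta)\bigr)\cup\bigl(R(\alpha)\cap S(\beta)\bigr) \subseteq S(\alpha)\cup S(\beta). \] In particular, $T(\alpha,\beta)$ is then finite and effectively computable. The condition $R(\alpha)\cap R(\beta)=\emptyset$ holds in each of the following situations: \begin{enumerate} \item[(1)] $\rho(\alpha)\neq\rho(\beta)$; \item[(2)] $\rho(\alpha)=\rho(\beta)\notin\{0,1,\infty\}$ and $v(\alpha-\beta)\le 1/2$; \item[(3)] $\rho(\alpha)=\rho(\beta)=1$, $0<v(\alpha-1)\le 1$ and $v(\alpha-\beta)=v(\alpha-1)$; \item[(4)] $\rho(\alpha)=\rho(\beta)=0$, $v(\alpha)\le 1$ and $v(\alpha-\beta)=v(\alpha)$; \item[(5)] $\rho(\alpha)=\rho(\beta)=\infty$, $v(\alpha)\ge -1$ and $v(\alpha-\beta)=v(\beta)$. \end{enumerate}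
   Context: For $\lambda \in \mathbb{C}\setminus\{0,1\}$ let $E_\lambda \colon y^2 = x(x-1)(x-\lambda)$. For $\alpha \in \mathbb{C}\setminus\{0,1\}$ let $P_\alpha(\lambda)$ be a point on $E_\lambda$ with $x$-coordinate $\alpha$ (well defined up to sign), and set $T(\alpha) = \{\lambda \in \mathbb{C}\setminus\{0,1\} : P_\alpha(\lambda) \text{ is a torsion point of } E_\lambda\}$ and $T(\alpha,\beta) = T(\alpha)\cap T(\beta)$. Let $\bar{\mathbb{Q}}\subseteq\mathbb{C}$ be the algebraic closure of $\mathbb{Q}$. Fix an embedding $i \colon \bar{\mathbb{Q}} \hookrightarrow \bar{\mathbb{Q}}_2$ and let $Z = \{\alpha\in\bar{\mathbb{Q}} : i(\alpha) \text{ is integral}\}$. Let $\rho\colon \bar{\mathbb{Q}} \hookrightarrow \mathbb{P}^1(\bar{\mathbb{Q}}_2) \to \mathbb{P}^1(\bar{\mathbb{F}}_2)$ be the natural reduction map (so $\rho(\alpha)=\infty$ iff $\alpha\notin Z$). Let $v\colon\bar{\mathbb{Q}}\to\mathbb{Q}\cup\{\infty\}$ be the valuation associated to $i$, normalized by $v(2)=1$. For $\alpha\in\bar{\mathbb{Q}}\setminus\{0,1\}$ define \[ R(\alpha)=\begin{cases}\{\alpha^2+2u\alpha(1-\alpha) : u\in Z,\ \rho(u^2)=\rho(\alpha)\} & \text{if } \alpha\in Z,\\ \bigl\{\frac{\alpha^2}{1+2(\alpha-1)u} : u\in Z,\ \rho(u)=0\bigr\} & \text{otherwise,}\end{cases}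 \] \[ S(\alpha)=\Bigl\{\alpha,\ \alpha^2,\ \alpha(2-\alpha),\ \frac{\alpha^2}{2\alpha-1}\Bigr\}. \] Expressions with vanishing denominator are omitted from these sets. ''Effectively computable'' means that there is an algorithm determining the set. *)

(* Defs.v *)
From HB Require Import structures.
From mathcomp Require Import all_boot all_order all_algebra.
From mathcomp Require Import boolp classical_sets cardinality reals.
From mathcomp Require Import constructive_ereal.
From mathcomp.real_closed Require Import complex.

Set Implicit Arguments.
Unset Strict Implicit.
Unset Printing Implicit Defensive.

Import Order.TTheory GRing.Theory Num.Theory.
Local Open Scope classical_set_scope.
Local Open Scope ring_scope.

Definition is_algebraic (R : realType) : {pred R[i]} :=
  fun z => `[< algebraicOver (ratr : rat -> R[i]) z >].

Fact is_algebraic_divring_closed (R : realType) :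
  divring_closed (@is_algebraic R).
Proof.
split=> [|x y /asboolP ax /asboolP ay|x y /asboolP ax /asboolP ay].
- by apply/asboolP; exact: algebraic1.
- by apply/asboolP; exact: algebraic_sub.
- by apply/asboolP; exact: algebraic_div.
Qed.

HB.instance Definition _ (R : realType) :=
  GRing.isDivringClosed.Build _ (@is_algebraic R)
    (is_algebraic_divring_closed R).

Record Qbar (R : realType) :=
  MkQbar { Qbar_val :> R[i]; _ : Qbar_val \in @is_algebraic R }.

HB.instance Definition _ (R : realType) := [isSub for @Qbar_val R].
HB.instance Definition _ (R : realType) := [Choice of Qbar R by <:].
HB.instance Definition _ (R : realType) :=
  [SubChoice_isSubIntegralDomain of Qbar R by <:].
HB.instance Definition _ (R : realType) :=
  [SubIntegralDomain_isSubField of Qbar R by <:].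

Record is_valuation (K : fieldType) (v : K -> \bar rat) : Prop := {
  val_ninfty : forall x, v x != -oo%E;
  val_pinfty : forall x, (v x == +oo%E) = (x == 0);
  val_mul : forall x y, v (x * y) = (v x + v y)%E;
  val_add : forall x y, (Order.min (v x) (v y) <= v (x + y)%R)%E }.

Definition v_cauchy (K : fieldType) (v : K -> \bar rat) (u : nat -> K) :=
  forall N : nat, exists m0 : nat, forall m n : nat,
    (m0 <= m)%N -> (m0 <= n)%N -> ((N%:R : rat)%:E <= v (u m - u n)%R)%E.

Definition v_cvg (K : fieldType) (v : K -> \bar rat) (u : nat -> K) (l : K) :=
  forall N : nat, exists m0 : nat, forall n : nat,
    (m0 <= n)%N -> ((N%:R : rat)%:E <= v (u n - l)%R)%E.

(** [K] with [v] is the completion of Q for the 2-adic valuation: the value at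
    2 determines the restriction of [v] to Q. *)
Record is_Q2 (K : fieldType) (v : K -> \bar rat) : Prop := {
  Q2_valuation : is_valuation v;
  Q2_val2 : v 2 = 1%E;
  Q2_complete : forall u, v_cauchy v u -> exists l, v_cvg v u l;
  Q2_dense : forall (x : K) (N : nat),
    exists q : rat, ((N%:R : rat)%:E <= v (x - ratr q)%R)%E }.

(** [red] is the residue map of the valuation ring [0 <= v]; its values outside
    that ring are irrelevant. *)
Record is_residue_map (K F : fieldType) (v : K -> \bar rat) (red : K -> F) :
    Prop := {
  red1 : red 1 = 1;
  redD : forall x y, (0 <= v x)%E -> (0 <= v y)%E ->
    red (x + y) = red x + red y;
  redM : forall x y, (0 <= v x)%E -> (0 <= v y)%E ->
    red (x * y) = red x * red y;
  red_eq0 : forall x, (0 <= v x)%E -> (red x == 0) = (0 < v x)%E;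
  red_surj : forall y, exists2 x, (0 <= v x)%E & red x = y }.

(** Everything below is determined up to isomorphism: [Q2bar] is an algebraic
    closure of Q_2, [vbar] the unique extension of the valuation of Q_2,
    and [F2bar] an algebraic closure of F_2 identified by [red] with the
    residue field of [Q2bar]. *)
Record Q2closure := {
  Q2 : fieldType;
  Q2bar : closedFieldType;
  Q2_in : {rmorphism Q2 -> Q2bar};
  vbar : Q2bar -> \bar rat;
  F2bar : closedFieldType;
  F2_in : {rmorphism 'F_2 -> F2bar};
  red : Q2bar -> F2bar;
  Q2P : is_Q2 (fun x : Q2 => vbar (Q2_in x));
  Q2bar_algebraic : forall x : Q2bar, algebraicOver Q2_in x;
  vbarP : is_valuation vbar;
  F2bar_algebraic : forall x : F2bar, algebraicOver F2_in x;
  redP : is_residue_map vbar red }.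

(** The projective line over [F]; [None] is the point at infinity. *)
Definition P1 (F : Type) := option F.

Section TwoAdic.
Variables (R : realType) (L : Q2closure) (i : {rmorphism Qbar R -> Q2bar L}).
Implicit Types a u l : Qbar R.

Definition v2 a : \bar rat := vbar (i a).

(** The set Z: "integral" means in the valuation ring of [Q2bar]. *)
Definition integral2 : set (Qbar R) := [set a | (0 <= v2 a)%E].

Definition rho a : P1 (F2bar L) :=
  if (0 <= v2 a)%E then Some (red (i a)) else None.

Definition Rset a : set (Qbar R) :=
  [set l | if (0 <= v2 a)%E then
             exists u, [/\ integral2 u, rho (u ^+ 2) = rho a &
                           l = a ^+ 2 + 2 * u * a * (1 - a)]
           else
             exists u, [/\ integral2 u, rho u = Some 0,
                           1 + 2 * (a - 1) * u != 0 &
                           l = a ^+ 2 / (1 + 2 * (a - 1) * u)]].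

End TwoAdic.

Definition Sset (R : realType) (a : Qbar R) : set (Qbar R) :=
  [set l | [\/ l = a, l = a ^+ 2, l = a * (2 - a) |
               2 * a - 1 != 0 /\ l = a ^+ 2 / (2 * a - 1)]].

Section Legendre.
Variables (F : fieldType) (l : F).

Inductive point := Infinity | Affine (x y : F).

Definition on_curve (P : point) : bool :=
  if P is Affine x y then y ^+ 2 == x * (x - 1) * (x - l) else true.

(** Chord-tangent law on [y^2 = x^3 - (1 + l) x^2 + l x]; meaningful on points
    satisfying [on_curve]. *)
Definition add_point (P Q : point) : point :=
  match P, Q with
  | Infinity, _ => Q
  | _, Infinity => P
  | Affine x1 y1, Affine x2 y2 =>
    if (x1 == x2) && (y1 == - y2) then Infinity else
    let s := if x1 == x2
             then (3 * x1 ^+ 2 - 2 * (1 + l) * x1 + l) / (2 * y1)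
             else (y2 - y1) / (x2 - x1) in
    let x3 := s ^+ 2 + (1 + l) - x1 - x2 in
    Affine x3 (s * (x1 - x3) - y1)
  end.

Definition torsion (P : point) : Prop :=
  exists n : nat, (0 < n)%N /\ iter n (add_point P) Infinity = Infinity.

End Legendre.

(** The choice of [y] does not matter: the two choices are opposite points. *)
Definition Tset (R : realType) (a : R[i]) : set R[i] :=
  [set l | [/\ l != 0, l != 1 &
               exists y : R[i], on_curve l (Affine a y) /\
                                torsion l (Affine a y)]].

Definition Tset2 (R : realType) (a b : R[i]) : set R[i] :=
  Tset a `&` Tset b.

(** Partial recursive functions. Arities are not tracked: a missing argument
    reads as 0. *)
Inductive recfun :=
  | Zero
  | Succ
  | Proj of nat
  | Comp of recfun & seq recfun
  | PrimRec of recfun & recfun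
  | Mu of recfun.

(** [eval f xs y]: the computation of [f] on [xs] halts with value [y]. *)
Inductive eval : recfun -> seq nat -> nat -> Prop :=
  | eval_zero xs : eval Zero xs 0%N
  | eval_succ xs : eval Succ xs (nth 0%N xs 0).+1
  | eval_proj k xs : eval (Proj k) xs (nth 0%N xs k)
  | eval_comp f gs xs ys y :
      evals gs xs ys -> eval f ys y -> eval (Comp f gs) xs y
  | eval_rec0 f g xs y :
      eval f xs y -> eval (PrimRec f g) (0%N :: xs) y
  | eval_recS f g n xs r y :
      eval (PrimRec f g) (n :: xs) r -> eval g [:: n, r & xs] y ->
      eval (PrimRec f g) (n.+1 :: xs) y
  | eval_mu f xs n :
      eval f (n :: xs) 0%N ->
      (forall m, (m < n)%N -> exists k, eval f (m :: xs) k.+1) ->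
      eval (Mu f) xs n
with evals : seq recfun -> seq nat -> seq nat -> Prop :=
  | evals_nil xs : evals [::] xs [::]
  | evals_cons g gs xs y ys :
      eval g xs y -> evals gs xs ys -> evals (g :: gs) xs (y :: ys).

(** An algebraic number is given to an algorithm as the only root of an integer
    polynomial in the open disc of centre [(re + im i) / (prec + 1)] and radius
    [1 / (prec + 1)]. *)
Record algnum := AlgNum {
  an_poly : seq int;
  an_re : int;
  an_im : int;
  an_prec : nat }.

Definition in_disc (R : realType) (c : algnum) (z : R[i]) : bool :=
  `| z - Complex (an_re c)%:~R (an_im c)%:~R / (an_prec c).+1%:R |
    < (an_prec c).+1%:R^-1.

Definition presents (R : realType) (c : algnum) (z : R[i]) : Prop :=
  let p : {poly R[i]} := map_poly intr (Poly (an_poly c)) in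
  [/\ p != 0, root p z, in_disc c z &
      forall w, root p w -> in_disc c w -> w = z].

Definition code_int (m : int) : nat :=
  match m with Posz n => n.*2 | Negz n => n.*2.+1 end.

Definition code_algnum (c : algnum) : nat :=
  CodeSeq.code [:: an_prec c, code_int (an_re c), code_int (an_im c)
                 & map code_int (an_poly c)].

(** One algorithm which, from any presentations of [a] and [b] satisfying [D],
    outputs a finite list presenting exactly the elements of [T a b]; nothing is
    required of it outside [D]. *)
Definition effectively_computable (R : realType)
    (D : Qbar R -> Qbar R -> Prop) (T : Qbar R -> Qbar R -> set R[i]) : Prop :=
  exists f : recfun, forall (a b : Qbar R) (ca cb : algnum),
    D a b -> presents ca (Qbar_val a) -> presents cb (Qbar_val b) ->
    exists s : seq (algnum * R[i]),
      [/\ eval f [:: code_algnum ca; code_algnum cb]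
               (CodeSeq.code [seq code_algnum p.1 | p <- s]),
          forall k c z, onth s k = Some (c, z) -> presents c z &
          forall z, z \in [seq p.2 | p <- s] <-> T a b z].

(* Main.v *)
(** The point with abscissa [x] on [E_l] is torsion if and only if its orbit
    under the doubling map on abscissas is finite. At a place above 2, once
    [v x < min 0 (v l)] each doubling lowers the valuation of the abscissa by 2,
    so the orbit is infinite; hence a torsion point and its halves never reach
    that region. Writing [l = a^2 + 2 u a (1 - a)], the abscissa of the double of
    the point over [a] is [u^2 / (2 u - 1)], and looking at one or two doublings
    forces [u] to be integral with [u^2 = a] in the residue field, unless [l] is
    one of the four elements of [Sset a], for which the orbit may hit 2-torsion;
    non-integral parameters are reduced to this case by [(x, l) -> (x / l, 1 / l)].

    For the algorithm, [T a b] is contained in the eight elements of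
    [Sset a] and [Sset b], and one has to decide which of these quotients [l] make
    both orbits finite. Distinct multiples of a torsion point have abscissas that
    are 2-adically separated, by a bound depending on [v l] and [v (1 - l)] only,
    because [x (P + Q) x (P - Q) (x P - x Q)^2 = (x P x Q - l)^2] and all these
    abscissas are bounded. Since they lie in a number field of dimension [n], a
    pigeonhole modulo a power of 2 bounds the number of doublings to be examined.
    Equality tests in [Q(a, b)] are decided from rational approximations, because
    a nonzero element has a Liouville type lower bound. The program searches for
    a certificate consisting of approximations of [a] and [b] and of
    presentations of the elements of [T a b], and every test in the verification
    of a certificate is rigorous. *)

Require Import Defs.
From HB Require Import structures.
From mathcomp Require Import all_boot all_order all_algebra.
From mathcomp Require Import boolp classical_sets cardinality reals.
From mathcomp Require Import constructive_ereal.
From mathcomp.real_closed Require Import complex.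
From mathcomp Require Import perm ring lra zify.

Set Implicit Arguments.
Unset Strict Implicit.
Unset Printing Implicit Defensive.

Import Order.TTheory GRing.Theory Num.Theory.
Local Open Scope classical_set_scope.
Local Open Scope ring_scope.

(** * The doubling orbit and the group law *)

(** Torsion is stated in [R[i]], valuations live on [Q2bar], and no map between these fields is
    given. The condition that travels is [finite_orbit]: free of division, it is preserved and
    reflected by every embedding of [Qbar]. Turning it back into torsion needs the whole group law,
    associativity included, because [torsion] iterates the chord-tangent formula; and a
    transcendental [l] must be excluded before any valuation can be used. For the algorithm each
    test must be right in both directions: a repetition in an orbit has to be recognised and its
    absence refuted. Hence every expression carries a size, an exponent [s] such that [Y^s] bounds a
    denominator and the resulting matrix; sums and products of sizes [s] and [t] have size
    [s + t + 1], and moduli, distances from 0 and valuations are bounded by powers of [Z] with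
    exponent proportional to [s]. The constants of the program come from adding up such sizes.
    Integer matrices on the span of the monomials replace minimal polynomials and number field
    arithmetic. *)

Section Doubling.
Variables (A : comNzRingType) (l : A).

(* In projective x-coordinates: [x (2 P) = (x^2 - l)^2 / (4 x (x - 1) (x - l))]. *)
Definition dbl (p : A * A) : A * A :=
  ((p.1 ^+ 2 - l * p.2 ^+ 2) ^+ 2, 4 * p.1 * p.2 * (p.1 - p.2) * (p.1 - l * p.2)).

Definition orbx x j := iter j dbl (x, 1).

Definition cross (p q : A * A) := p.1 * q.2 - q.1 * p.2.

(** Stated without division over any commutative ring: morphisms transport it, and [Tset_algebraic]
    uses the same formulas over a polynomial ring. *)
Definition finite_orbit x := exists j k, (j < k)%N /\ cross (orbx x j) (orbx x k) = 0.

End Doubling.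

Lemma map_dbl (A B : comNzRingType) (f : {rmorphism A -> B}) l p :
  (f (dbl l p).1, f (dbl l p).2) = dbl (f l) (f p.1, f p.2).
Proof. by rewrite /dbl /= !(rmorphM, rmorphXn, rmorphB, rmorph_nat). Qed.

Lemma map_orb (A B : comNzRingType) (f : {rmorphism A -> B}) l x j :
  (f (orbx l x j).1, f (orbx l x j).2) = orbx (f l) (f x) j.
Proof.
elim: j => [|j IH]; first by rewrite /= rmorph1.
by rewrite [orbx (f l) _ _]/= -/(orbx _ _ _) -IH -map_dbl.
Qed.

Lemma map_cross (A B : comNzRingType) (f : {rmorphism A -> B}) l x j k :
  f (cross (orbx l x j) (orbx l x k)) =
  cross (orbx (f l) (f x) j) (orbx (f l) (f x) k).
Proof. by rewrite -!map_orb /cross rmorphB !rmorphM. Qed.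

(** The bridge between the complex and the 2-adic side, both of which receive an embedding of
    [Qbar]. *)
Lemma finite_orbit_map (A B : comNzRingType) (f : {rmorphism A -> B}) l x :
  injective f -> finite_orbit (f l) (f x) <-> finite_orbit l x.
Proof.
move=> fI; split=> -[j [k [jk c]]]; exists j, k; split => //.
  by apply: fI; rewrite map_cross c rmorph0.
by rewrite -map_cross c rmorph0.
Qed.

(** * The group law on the Legendre curve *)

Section Curve.
Variables (F : fieldType) (l : F).
Hypotheses (two_neq0 : 2 != 0 :> F) (l_neq0 : l != 0) (l_neq1 : l != 1).

Definition neg_point (P : Defs.point F) : Defs.point F :=
  if P is Affine x y then Affine x (- y) else @Infinity F.

Local Notation on := (on_curve l).
Local Notation add := (add_point l).
Local Notation O := (@Infinity F).

(** [lt1], [lt2] and [lt3] are Vieta's formulas for [x (x - 1) (x - l) - (s x + t)^2]. Counting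
    intersections with multiplicity treats chords and tangents alike and makes the relation
    symmetric in the three points. *)
Record line_through (s t : F) (P Q S : F * F) : Prop := LineThrough {
  line_atP : P.2 = s * P.1 + t;
  line_atQ : Q.2 = s * Q.1 + t;
  line_atS : S.2 = s * S.1 + t;
  lt1 : P.1 + Q.1 + S.1 = s ^+ 2 + (1 + l);
  lt2 : P.1 * Q.1 + P.1 * S.1 + Q.1 * S.1 = l - 2 * s * t;
  lt3 : P.1 * Q.1 * S.1 = t ^+ 2 }.

Lemma line_rot s t P Q S : line_through s t P Q S -> line_through s t Q S P.
Proof.
by case=> *; split=> //; [rewrite [LHS](_ : _ = P.1 + Q.1 + S.1)
  |rewrite [LHS](_ : _ = P.1 * Q.1 + P.1 * S.1 + Q.1 * S.1)
  |rewrite [LHS](_ : _ = P.1 * Q.1 * S.1)]=> //; ring.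
Qed.

Lemma line_swap s t P Q S : line_through s t P Q S -> line_through s t Q P S.
Proof.
by case=> *; split=> //; [rewrite [LHS](_ : _ = P.1 + Q.1 + S.1)
  |rewrite [LHS](_ : _ = P.1 * Q.1 + P.1 * S.1 + Q.1 * S.1)
  |rewrite [LHS](_ : _ = P.1 * Q.1 * S.1)]=> //; ring.
Qed.

Definition negp (P : F * F) := (P.1, - P.2).

Lemma line_neg s t P Q S : line_through s t P Q S ->
  line_through (- s) (- t) (negp P) (negp Q) (negp S).
Proof.
case=> *; split; rewrite /= ?sqrrN ?mulNr ?mulrN ?opprK ?mulNr -?opprD;
  by [congr (- _)|].
Qed.

Definition aff (P : F * F) := Affine P.1 P.2.

Lemma on_aff P : on (aff P) = (P.2 ^+ 2 == P.1 * (P.1 - 1) * (P.1 - l)).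
Proof. by []. Qed.

Lemma line_on s t P Q S : line_through s t P Q S -> on (aff P).
Proof.
case: P Q S => [x1 y1] [x2 y2] [x3 y3] [/= -> _ _ e1 e2 e3]; apply/eqP.
have -> : l = x1 + x2 + x3 - s ^+ 2 - 1 by rewrite e1; ring.
have e2' : x1 * x2 + x1 * x3 + x2 * x3 - l + 2 * s * t = 0 by rewrite e2; ring.
have E : l = x1 + x2 + x3 - s ^+ 2 - 1 by rewrite e1; ring.
rewrite E in e2'.
apply/eqP; rewrite -subr_eq0; apply/eqP.
transitivity ((x1 * x2 + x1 * x3 + x2 * x3 - (x1 + x2 + x3 - s ^+ 2 - 1)
   + 2 * s * t) * x1 + (t ^+ 2 - x1 * x2 * x3)); first by ring.
by rewrite e2' e3; ring.
Qed.

(* A line meeting the curve twice at the same 2-torsion point would force a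
   double root of [x (x - 1) (x - l)]. *)
Lemma line_neq_neg s t P Q S :
  line_through s t P Q S -> ~~ ((P.1 == Q.1) && (P.2 == - Q.2)).
Proof.
case: P Q S => [x1 y1] [x2 y2] [x3 y3] [/= e e' _ e1 e2 e3].
apply/negP=> /andP[/eqP ? /eqP y12]; subst x2.
have y10 : y1 = 0.
  apply/eqP; have : y1 * 2 == 0 by rewrite mulr_natr mulr2n {1}y12 e' -e addNr.
  by rewrite mulf_eq0 (negPf two_neq0) orbF.
have tE : t = - (s * x1) by apply/eqP; rewrite -addr_eq0 addrC -e y10.
have lE : l = 2 * x1 + x3 - s ^+ 2 - 1.
  by rewrite [RHS](_ : _ = x1 + x1 + x3 - s ^+ 2 - 1); [rewrite e1|]; ring.
have h1 : x1 * (x1 + 2 * x3 - 2 * s ^+ 2) = l.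
  transitivity (x1 * x1 + x1 * x3 + x1 * x3 + 2 * s * t); last by rewrite e2; ring.
  by rewrite tE; ring.
have h2 : x1 ^+ 2 * (x3 - s ^+ 2) = 0.
  transitivity (x1 * x1 * x3 - t ^+ 2); first by rewrite tE; ring.
  by rewrite e3 subrr.
have x1n0 : x1 != 0.
  by apply: contraNneq l_neq0 => x10; rewrite -h1 x10 mul0r.
move/eqP: h2; rewrite mulf_eq0 expf_eq0 /= (negPf x1n0) subr_eq0 => /eqP x3E.
have lx : l = x1 ^+ 2 by rewrite -h1 x3E; ring.
have : (x1 - 1) ^+ 2 == 0.
  rewrite [X in X == _](_ : _ = l - (2 * x1 + x3 - s ^+ 2 - 1)).
    by rewrite -lE subrr.
  by rewrite lx x3E; ring.
rewrite expf_eq0 /= subr_eq0 => /eqP x11.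
by move/negP: l_neq1; rewrite lx x11 expr1n.
Qed.

(** For distinct abscissas the slope is forced; for a tangent, Vieta's formulas give
    [2 y s = 3 x^2 - 2 (1 + l) x + l], where [y != 0] by [line_neq_neg]. *)
Lemma add_line s t P Q S :
  line_through s t P Q S -> add (aff P) (aff Q) = aff (negp S).
Proof.
move=> L; have nPQ := line_neq_neg L.
move: L nPQ; case: P Q S => [x1 y1] [x2 y2] [x3 y3] [/= e e' e'' e1 e2 e3].
rewrite /add_point /= => /negPf nPQ; rewrite nPQ.
set s' := (if _ then _ else _); suff -> : s' = s.
  have -> : s ^+ 2 + (1 + l) - x1 - x2 = x3.
    by rewrite -e1; ring.
  by rewrite /aff /negp /= e'' e; congr Affine; ring.
rewrite /s'; case: eqVneq nPQ => [x12 /=|x12 _]; last first.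
  have d : x2 - x1 != 0 by rewrite subr_eq0 eq_sym.
  by rewrite e e'; field.
subst x2; have y12 : y1 = y2 by rewrite e e'.
rewrite -y12 -addr_eq0 (_ : y1 + y1 = 2 * y1); last by ring.
rewrite mulf_eq0 (negPf two_neq0).
move=> /negbT y0.
have lE : 1 + l = 2 * x1 + x3 - s ^+ 2.
  transitivity (s ^+ 2 + (1 + l) - s ^+ 2); first by ring.
  by rewrite -e1; ring.
apply: (mulIf (mulf_neq0 two_neq0 y0)).
rewrite divfK ?mulf_neq0 // lE.
have -> : 3 * x1 ^+ 2 - 2 * (2 * x1 + x3 - s ^+ 2) * x1 + l =
   (l - 2 * s * t) - (x1 * x1 + x1 * x3 + x1 * x3) + 2 * s * (s * x1 + t).
  by ring.
by rewrite -e2 -e; ring.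
Qed.

Lemma line_exists P Q : on (aff P) -> on (aff Q) ->
  ~~ ((P.1 == Q.1) && (P.2 == - Q.2)) -> exists s t S, line_through s t P Q S.
Proof.
case: P Q => [x1 y1] [x2 y2]; rewrite !on_aff /= => /eqP c1 /eqP c2.
have [x12 /=|x12 _] := eqVneq x1 x2; last first.
  have d : x2 - x1 != 0 by rewrite subr_eq0 eq_sym.
  pose s := (y2 - y1) / (x2 - x1).
  pose t := y1 - s * x1; pose x3 := s ^+ 2 + (1 + l) - x1 - x2.
  exists s, t, (x3, s * x3 + t).
  have sd : s * (x2 - x1) = y2 - y1 by rewrite /s divfK.
  have y2E : y2 = y1 + s * (x2 - x1) by rewrite sd; ring.
  have E1 : y1 * 2 * s = (x1 ^+ 2 + x1 * x2 + x2 ^+ 2) - (1 + l) * (x1 + x2) + l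
                         - s ^+ 2 * (x2 - x1).
    apply: (mulIf d).
    transitivity (y2 ^+ 2 - y1 ^+ 2 - s ^+ 2 * (x2 - x1) ^+ 2).
      by rewrite y2E; ring.
    by rewrite c1 c2; ring.
  split=> /=.
  - by rewrite /t; ring.
  - by rewrite y2E /t; ring.
  - by [].
  - by rewrite /x3; ring.
  - rewrite /x3 /t; apply/eqP; rewrite -subr_eq0; apply/eqP.
    transitivity (y1 * 2 * s - ((x1 ^+ 2 + x1 * x2 + x2 ^+ 2) - (1 + l) * (x1 + x2) + l
                         - s ^+ 2 * (x2 - x1))); first by ring.
    by rewrite E1 subrr.
  rewrite /x3 /t; apply/eqP; rewrite -subr_eq0; apply/eqP.
  transitivity (x1 * (y1 * 2 * s - ((x1 ^+ 2 + x1 * x2 + x2 ^+ 2) - (1 + l) * (x1 + x2) + l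
                         - s ^+ 2 * (x2 - x1))) - (y1 ^+ 2 - x1 * (x1 - 1) * (x1 - l))).
    by ring.
  by rewrite E1 c1 !subrr; ring.
subst x2 => y12.
have y21 : y2 = y1.
  have : (y1 - y2) * (y1 + y2) == 0.
    rewrite [X in X == _](_ : _ = y1 ^+ 2 - y2 ^+ 2); last by ring.
    by rewrite c1 c2 subrr.
  by rewrite mulf_eq0 subr_eq0 addr_eq0 (negPf y12) orbF => /eqP.
have y0 : y1 != 0.
  by apply: contraNneq y12 => z; rewrite y21 z oppr0.
pose s := (3 * x1 ^+ 2 - 2 * (1 + l) * x1 + l) / (2 * y1).
pose t := y1 - s * x1; pose x3 := s ^+ 2 + (1 + l) - x1 - x1.
exists s, t, (x3, s * x3 + t).
have E1 : y1 * 2 * s = 3 * x1 ^+ 2 - 2 * (1 + l) * x1 + l.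
  by rewrite /s [y1 * 2]mulrC [LHS]mulrC divfK ?mulf_neq0.
split=> /=.
- by rewrite /t; ring.
- by rewrite y21 /t; ring.
- by [].
- by rewrite /x3; ring.
- rewrite /x3 /t; apply/eqP; rewrite -subr_eq0; apply/eqP.
  transitivity (y1 * 2 * s - (3 * x1 ^+ 2 - 2 * (1 + l) * x1 + l)); first by ring.
  by rewrite E1 subrr.
rewrite /x3 /t; apply/eqP; rewrite -subr_eq0; apply/eqP.
transitivity (x1 * (y1 * 2 * s - (3 * x1 ^+ 2 - 2 * (1 + l) * x1 + l))
  - (y1 ^+ 2 - x1 * (x1 - 1) * (x1 - l))); first by ring.
by rewrite E1 c1 !subrr; ring.
Qed.

(* The fourth line has slope [m + r - n]: this is the comparison of the leading
   coefficients of two functions with the same divisor. *)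
Lemma fourth_line (a b y u p t q w m n r c : F) :
  u + p = m ^+ 2 - a -> u * p = b - 2 * m * y ->
  t + q = n ^+ 2 - a -> t * q = b - 2 * n * y ->
  (m + r) * p = - (y + c) -> (n - r) * t = c - y ->
  p + t + w = r ^+ 2 - a -> p * t + p * w + t * w = b - 2 * r * c ->
  (t == p -> y + n * t != 0) ->
  let s := m + r - n in let e := y + (n - r) * u in
  [/\ - (y + n * q) = s * q + e, r * w + c = s * w + e,
      u + q + w = s ^+ 2 - a, u * q + u * w + q * w = b - 2 * s * e &
      u * q * w = e ^+ 2 - y ^+ 2].
Proof.
move=> R1 R2 R3 R4 R5 R6 R7 R8 tp.
have aE : a = m ^+ 2 - u - p by rewrite -[u](addrK p) R1; ring.
have bE : b = u * p + 2 * m * y by rewrite R2; ring.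
have qE : q = n ^+ 2 - a - t by rewrite -R3; ring.
have wE : w = r ^+ 2 - a - p - t by rewrite -R7; ring.
have cE : c = y + (n - r) * t by rewrite R6; ring.
have yE : y = - ((m + r) * p + (n - r) * t) / 2.
  by rewrite R5 R6; field => //.
(* After elimination [R4] gives this relation times [t - p]. When [t = p] the third line is a
   tangent, and [(n - m) / 2] times [R8] gives it times [y + n t], which [tp] makes nonzero. *)
have d0 : (m + r) * (n - m) - (t - u) = 0.
  have h : ((m + r) * (n - m) - (t - u)) * (t - p) = 0.
    have : t * q - b + 2 * n * y = 0 by rewrite R4; ring.
    rewrite qE bE aE yE => <-; field => //.
  have [tp'|tp'] := eqVneq t p; last first.
    by move/eqP: h; rewrite mulf_eq0 [t - p == 0]subr_eq0 (negPf tp') orbF => /eqP.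
  have := tp; rewrite tp' eqxx => /(_ isT) => y0.
  apply: (mulIf y0); rewrite mul0r.
  have : p * t + p * w + t * w - (b - 2 * r * c) = 0 by rewrite R8; ring.
  rewrite wE cE bE aE yE tp' => R8'.
  transitivity ((n - m) / 2 * 0 : F); last by rewrite mulr0.
  by rewrite -R8'; field => //.
have tE : t = u + (m + r) * (n - m) by rewrite -[LHS]addr0 -d0; ring.
move=> s e; rewrite /s /e wE cE qE bE aE yE tE.
split; field => //.
Qed.

Variant add_spec (P Q : Defs.point F) : Defs.point F -> Prop :=
  | AddOl of P = O : add_spec P Q Q
  | AddOr of Q = O : add_spec P Q P
  | AddOpp x y of P = Affine x y & Q = Affine x (- y) : add_spec P Q O
  | AddLine s t p q r of P = aff p & Q = aff q & line_through s t p q r :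
      add_spec P Q (aff (negp r)).

Lemma addP P Q : on P -> on Q -> add_spec P Q (add P Q).
Proof.
case: P Q => [|x1 y1] [|x2 y2] cP cQ; do ?by [apply: AddOl|apply: AddOr].
case e: ((x1 == x2) && (y1 == - y2)).
  rewrite /add_point e; case/andP: e => /eqP-> /eqP->.
  by apply: (@AddOpp _ _ x2 (- y2)); rewrite ?opprK.
have [s [t [r L]]] := @line_exists (x1, y1) (x2, y2) cP cQ (negbT e).
rewrite -[Affine x1 y1]/(aff (x1, y1)) -[Affine x2 y2]/(aff (x2, y2)).
by rewrite (add_line L); exact: AddLine L.
Qed.

Lemma on_neg P : on (neg_point P) = on P.
Proof. by case: P => //= x y; rewrite sqrrN. Qed.

Lemma on_add P Q : on P -> on Q -> on (add P Q).
Proof.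
move=> cP cQ; case: (addP cP cQ) => // s t p q r _ _ /line_rot/line_rot L.
by rewrite -[aff _]/(neg_point (aff r)) on_neg; exact: line_on L.
Qed.

Lemma neg_pointK P : neg_point (neg_point P) = P.
Proof. by case: P => //= x y; rewrite opprK. Qed.

Lemma add0 P : add P O = P. Proof. by case: P. Qed.

Lemma addN P : add P (neg_point P) = O.
Proof. by case: P => //= x y; rewrite !opprK !eqxx. Qed.

Lemma addC P Q : on P -> on Q -> add P Q = add Q P.
Proof.
move=> cP cQ; case: (addP cP cQ) => [->|->|x y -> ->|s t p q r -> -> L].
- by rewrite add0.
- by [].
- by rewrite /= !eqxx.
- by rewrite (add_line (line_swap L)).
Qed.

Lemma addNK P Q : on P -> on Q -> add (neg_point P) (add P Q) = Q.
Proof.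
move=> cP cQ; case: (addP cP cQ) => [->|->|x y -> ->|s t p q r -> -> L] //.
- by case: (P) => //= x y; rewrite !eqxx.
- rewrite -[neg_point _]/(aff (negp p)).
  rewrite (add_line (line_neg (line_rot (line_swap L)))).
  by rewrite /aff /= opprK.
Qed.

Lemma neg_add P Q : on P -> on Q ->
  neg_point (add P Q) = add (neg_point P) (neg_point Q).
Proof.
move=> cP cQ; case: (addP cP cQ) => [->|->|x y -> ->|s t p q r -> -> L] //.
- by rewrite /= add0.
- by rewrite /= opprK !eqxx.
- by rewrite -[neg_point (aff p)]/(aff (negp p)) -[neg_point (aff q)]/(aff (negp q))
    (add_line (line_neg L)).
Qed.

Lemma addKN P Q : on P -> on Q -> add P (add (neg_point P) Q) = Q.
Proof. by move=> cP cQ; rewrite -{1}[P]neg_pointK addNK // on_neg. Qed.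

(** The generic case of associativity. With [A + B = - U], [B + T = - V] and [(A + B) + T = - W],
    the point is that [A], [- V] and [W] are collinear. Abscissas are taken relative to [B] before
    [fourth_line] is applied. *)
Lemma add_lines s1 t1 s2 t2 s3 t3 A B T U V W :
  line_through s1 t1 A B U -> line_through s2 t2 B T V ->
  line_through s3 t3 (negp U) T W ->
  exists s t, line_through s t A (negp V) W.
Proof.
move=> L1 L2 L3; have nUT := line_neq_neg L3.
have onT : on (aff T) := line_on (line_swap L3).
have onU : on (aff U) := line_on (line_rot (line_rot L1)).
have onB : on (aff B) := line_on (line_swap L1).
case: A B T U V W L1 L2 L3 nUT onT onU onB => [xA yA] [xB yB] [xT yT] [xU yU] [xV yV] [xW yW].
case=> /= A1 A2 A3 A4 A5 _ [/= B1 B2 B3 B4 B5 _] [/= C1 C2 C3 C4 C5 _] nUT /eqP/= onT /eqP/= onU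
  /eqP/= onB.
have t1E : t1 = yB - s1 * xB by rewrite A2; ring.
have t2E : t2 = yB - s2 * xB by rewrite B1; ring.
have lE : l = xA + xB + xU - s1 ^+ 2 - 1 by rewrite A4; ring.
pose a := 3 * xB - (1 + l); pose b := 3 * xB ^+ 2 - 2 * (1 + l) * xB + l.
pose c := s3 * xB + t3.
have := @fourth_line a b yB (xA - xB) (xU - xB) (xT - xB) (xV - xB) (xW - xB) s1 s2 s3 c.
case.
- by rewrite /a lE; ring.
- apply/eqP; rewrite -subr_eq0; apply/eqP.
  transitivity (xA * xB + xA * xU + xB * xU - (l - 2 * s1 * t1) -
    2 * xB * (xA + xB + xU - (s1 ^+ 2 + (1 + l)))); first by rewrite /b t1E; ring.
  by rewrite A4 A5 !subrr; ring.
- rewrite [LHS](_ : _ = xB + xT + xV - 3 * xB); last by ring.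
  by rewrite B4 /a; ring.
- apply/eqP; rewrite -subr_eq0; apply/eqP.
  transitivity (xB * xT + xB * xV + xT * xV - (l - 2 * s2 * t2) -
    2 * xB * (xB + xT + xV - (s2 ^+ 2 + (1 + l)))); first by rewrite /b t2E; ring.
  by rewrite B4 B5 !subrr; ring.
- rewrite [LHS](_ : _ = (s1 * xU + t1) + s3 * xU - (yB + s3 * xB)); last by rewrite t1E; ring.
  rewrite -A3 [yU](_ : _ = - (s3 * xU + t3)); last by rewrite -C1 opprK.
  by rewrite /c; ring.
- rewrite [LHS](_ : _ = (s2 * xT + t2) - s3 * xT + s3 * xB - yB); last by rewrite t2E; ring.
  by rewrite -B2 C2 /c; ring.
- rewrite [LHS](_ : _ = xU + xT + xW - 3 * xB); last by ring.
  by rewrite C4 /a; ring.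
- apply/eqP; rewrite -subr_eq0; apply/eqP.
  transitivity (xU * xT + xU * xW + xT * xW - (l - 2 * s3 * t3) -
    2 * xB * (xU + xT + xW - (s3 ^+ 2 + (1 + l)))); first by rewrite /b /c; ring.
  by rewrite C4 C5 !subrr; ring.
- rewrite (can_eq (subrK _)) => /eqP xTU.
  rewrite (_ : yB + _ = s2 * xT + t2); last by rewrite t2E; ring.
  rewrite -B2; apply: contra nUT => /eqP yT0.
  rewrite xTU eqxx yT0 oppr0 oppr_eq0 /= -sqrf_eq0.
  by rewrite onU -xTU -onT yT0 expr0n.
move=> h1 h2 h3 h4 h5.
pose s := s1 + s3 - s2; pose e := yB + (s2 - s3) * (xA - xB).
exists s, (e - s * xB); split => /=.
- by rewrite A1 t1E /s /e; ring.
- transitivity (- (yB + s2 * (xV - xB))); first by rewrite B3 t2E; ring.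
  by rewrite h1 /s /e; ring.
- transitivity (s3 * (xW - xB) + c); first by rewrite C3 /c; ring.
  by rewrite h2 /s /e; ring.
- transitivity (xA - xB + (xV - xB) + (xW - xB) + 3 * xB); first by ring.
  by rewrite h3 /s /a; ring.
- transitivity ((xA - xB) * (xV - xB) + (xA - xB) * (xW - xB) + (xV - xB) * (xW - xB)
    + 2 * xB * (xA - xB + (xV - xB) + (xW - xB)) + 3 * xB ^+ 2); first by ring.
  by rewrite h3 h4 /s /e /b /a; ring.
- transitivity ((xA - xB) * (xV - xB) * (xW - xB)
    + xB * ((xA - xB) * (xV - xB) + (xA - xB) * (xW - xB) + (xV - xB) * (xW - xB))
    + xB ^+ 2 * (xA - xB + (xV - xB) + (xW - xB)) + xB ^+ 3); first by ring.
  by rewrite h3 h4 h5 onB -/s -/e /b /a; ring.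
Qed.

Lemma add_eq0 P Q : on P -> on Q -> add P Q = O -> Q = neg_point P.
Proof. by move=> cP cQ PQ; rewrite -(addNK cP cQ) PQ add0. Qed.

Lemma add_lineP P Q : on P -> on Q -> P <> O -> Q <> O -> add P Q <> O ->
  exists s t p q r,
    [/\ P = aff p, Q = aff q, add P Q = aff (negp r) & line_through s t p q r].
Proof.
move=> cP cQ nP nQ.
case: (addP cP cQ) => [|//|//|s t p q r PE QE L _]; first by [].
by exists s, t, p, q, r.
Qed.

Lemma aff_inj p q : aff p = aff q -> p = q.
Proof. by case: p q => [? ?] [? ?] [-> ->]. Qed.

(** If a partial sum is [O], the identity reduces to cancellation; otherwise all sums come from
    lines and [add_lines] supplies the missing one. *)
Lemma addA A B T : on A -> on B -> on T -> add A (add B T) = add (add A B) T.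
Proof.
move=> cA cB cT; have cAB := on_add cA cB; have cBT := on_add cB cT.
have [->//|A0] := pselect (A = O).
have [->|B0] := pselect (B = O); first by rewrite add0.
have [->|T0] := pselect (T = O); first by rewrite !add0.
have [AB|AB] := pselect (add A B = O).
  by rewrite AB (add_eq0 cA cB AB) addKN.
have [BT|BT] := pselect (add B T = O).
  rewrite BT add0 (add_eq0 cB cT BT) addC ?on_neg // [add A B]addC //.
  by rewrite addNK.
have [ABT|ABT] := pselect (add (add A B) T = O).
  rewrite ABT (add_eq0 cAB cT ABT) neg_add // [add (neg_point A) _]addC ?on_neg //.
  by rewrite addKN ?on_neg // addN.
have [s1 [t1 [p [b [u [AE BE ABE L1]]]]]] := add_lineP cA cB A0 B0 AB.
have [s2 [t2 [b' [q [v [BE' TE BTE L2]]]]]] := add_lineP cB cT B0 T0 BT.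
have [s3 [t3 [u' [q' [w [ABE' TE' ABTE L3]]]]]] := add_lineP cAB cT AB T0 ABT.
have bb' : b' = b by apply: aff_inj; rewrite -BE.
have qq' : q' = q by apply: aff_inj; rewrite -TE.
have uu' : u' = negp u by apply: aff_inj; rewrite -ABE.
subst b' q' u'; have [s [t L]] := add_lines L1 L2 L3.
by rewrite ABTE BTE AE; exact: add_line L.
Qed.

Definition mul n P := iter n (add P) O.

Lemma mulS n P : mul n.+1 P = add P (mul n P). Proof. by []. Qed.

Lemma on_mul n P : on P -> on (mul n P).
Proof. by move=> cP; elim: n => //= n; apply: on_add. Qed.

Lemma mulD m n P : on P -> mul (m + n) P = add (mul m P) (mul n P).
Proof.
move=> cP; elim: m => [//|m IH].
by rewrite addSn !mulS IH addA // on_mul.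
Qed.

Lemma mul_mod n P m : mul n P = O -> mul m P = mul (m %% n)%N P.
Proof.
move=> nO; rewrite {1}(divn_eq m n) addnC /mul iterD; congr iter.
by elim: (m %/ n)%N => //= q IH; rewrite mulSn iterD IH.
Qed.

Lemma mul_cancel m n P : on P -> (m <= n)%N -> mul m P = mul n P -> mul (n - m) P = O.
Proof.
move=> cP mn E; have := mulD m (n - m) cP; rewrite subnKC // -E => E'.
have cm := on_mul m cP; have cn := on_mul (n - m) cP.
by rewrite -(addNK cm cn) -E' addC ?on_neg // addN.
Qed.

(* [1 : 0] and all [x : 0] with [x != 0] stand for the point at infinity. *)
Definition rep (p : F * F) (P : Defs.point F) :=
  if P is Affine x y then p.2 != 0 /\ p.1 = x * p.2 else p.2 = 0 /\ p.1 != 0.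

Lemma four_neq0 : 4 != 0 :> F.
Proof. by rewrite -[4]/(2 * 2)%:R natrM mulf_neq0. Qed.

(** At a 2-torsion point the denominator vanishes, while [x^2 - l] takes the values [- l], [1 - l]
    and [l (l - 1)] at [0], [1] and [l]. These are nonzero, so the pair never degenerates to
    [(0, 0)]. *)
Lemma rep_dbl p P : on P -> rep p P -> rep (dbl l p) (add P P).
Proof.
move=> cP; case: (addP cP cP) => [PO|PO|x y PE|s t q q' r PE PE' L].
1,2: by rewrite PO => -[e p0]; rewrite /rep /dbl /= e expr0n /= !(mulr0, mul0r) subr0;
  split; rewrite ?expf_neq0.
- move=> PE'; have yN : y = - y by move: PE'; rewrite PE => -[].
  rewrite PE /rep /dbl /= => -[p0 ->].
  have y0 : y = 0.
    apply/eqP; rewrite -(mulrI_eq0 _ (mulfI two_neq0)) mulr_natl mulr2n {1}yN addNr.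
    by [].
  move: cP; rewrite PE y0 /= expr0n /= eq_sym => /eqP c.
  split.
    rewrite (_ : 4 * _ * _ * _ * _ = 4 * p.2 ^+ 4 * (x * (x - 1) * (x - l))); last by ring.
    by rewrite c mulr0.
  rewrite (_ : _ - _ = p.2 ^+ 2 * (x ^+ 2 - l)); last by ring.
  rewrite expf_neq0 // mulf_neq0 ?expf_neq0 //.
  move/eqP: c; rewrite !mulf_eq0 !subr_eq0 -orbA => /or3P[] /eqP ->.
  - by rewrite expr0n eq_sym.
  - by rewrite expr1n eq_sym.
  - by rewrite -subr_eq0 (_ : _ - _ = l * (l - 1)) ?mulf_neq0 ?subr_eq0 //; ring.
have qq' : q' = q by apply: aff_inj; rewrite -PE.
subst q'; have y0 : q.2 != 0.
  apply: contraNneq (line_neq_neg L) => ->; by rewrite oppr0 !eqxx.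
move: cP y0; rewrite PE; case: q L {PE PE'} => [x y] [/= e _ _ e1 e2 e3] /eqP cP y0 [p0 ->].
have rE : r.1 * (4 * (x * (x - 1) * (x - l))) = (x ^+ 2 - l) ^+ 2.
  have -> : r.1 = s ^+ 2 + (1 + l) - x - x by rewrite -e1; ring.
  have lE : l = x + x + r.1 - s ^+ 2 - 1 by rewrite e1; ring.
  have h : 2 * y * s = 3 * x ^+ 2 - 2 * (1 + l) * x + l.
    transitivity (2 * s * (s * x + t)); first by rewrite -e; ring.
    transitivity (2 * s ^+ 2 * x + l - (x * x + x * r.1 + x * r.1)); first by rewrite e2; ring.
    rewrite (_ : 1 + l = x + x + r.1 - s ^+ 2); last by rewrite {1}lE; ring.
    by ring.
  transitivity ((2 * y * s) ^+ 2 + (1 + l - x - x) * 4 * y ^+ 2).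
    by rewrite -cP; ring.
  by rewrite h cP; ring.
have d0 : x * (x - 1) * (x - l) != 0 by rewrite -cP expf_neq0.
split.
  rewrite (_ : 4 * _ * _ * _ * _ = 4 * p.2 ^+ 4 * (x * (x - 1) * (x - l))); last by ring.
  by rewrite mulf_neq0 // mulf_neq0 ?expf_neq0 ?four_neq0.
transitivity (p.2 ^+ 4 * (x ^+ 2 - l) ^+ 2); first by ring.
by rewrite -rE; ring.
Qed.

Lemma rep_orb x y j : on (Affine x y) -> rep (orbx l x j) (mul (2 ^ j) (Affine x y)).
Proof.
move=> cP; elim: j => [|j IH]; first by rewrite /= oner_eq0 mulr1.
by rewrite expnS mul2n -addnn mulD //; apply: rep_dbl => //; apply: on_mul.
Qed.

Lemma rep_cross p q P Q : on P -> on Q -> rep p P -> rep q Q ->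
  cross p q = 0 -> [\/ P = Q, P = neg_point Q | P = O].
Proof.
case: p q P Q => [X Z] [X' Z'] [|x y] [|x' y'] //=; rewrite /cross /=; do ?by constructor.
- by move=> _ _ [z0 xz] [-> x0']; rewrite mulr0 sub0r => /eqP; rewrite oppr_eq0 mulf_eq0
    (negPf x0') (negPf z0).
move=> /eqP c /eqP c' [z0 ->] [z0' ->] /eqP; rewrite subr_eq0 => /eqP e.
have xx' : x = x'.
  by apply: (mulIf (mulf_neq0 z0 z0')); rewrite !mulrA e mulrAC.
subst x'; have : (y - y') * (y + y') == 0.
  by rewrite (_ : _ * _ = y ^+ 2 - y' ^+ 2); [rewrite c c' subrr|ring].
rewrite mulf_eq0 subr_eq0 addr_eq0 => /orP[] /eqP ->; [exact: Or31|exact: Or32].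
Qed.

Lemma rep_eq p q P : rep p P -> rep q P -> cross p q = 0.
Proof.
case: P => [|x y] /= [a b] [c d]; rewrite /cross.
  by rewrite a c !mulr0 subrr.
by rewrite b d; ring.
Qed.

(** Among the [n + 1] powers [2^0, ..., 2^n] two agree modulo [n], and then so do the corresponding
    multiples of the point. *)
Lemma torsion_finite_orbit x y : on (Affine x y) -> torsion l (Affine x y) ->
  finite_orbit l x.
Proof.
move=> cP [n [n0 nO]].
pose f (j : 'I_n.+1) : 'I_n := Ordinal (ltn_pmod (2 ^ j) n0).
have [j [k [jk E]]] : exists j k : 'I_n.+1, j != k /\ f j = f k.
  apply/not_existsP => h; have /card_in_image : {in predT &, injective f}.
    move=> j k _ _ E; apply/eqP; apply: contra_notT (h j) => jk.
    by exists k.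
  rewrite card_ord => E; have := max_card (mem [seq f x | x in 'I_n.+1]).
  by rewrite E card_ord ltnn.
wlog lt : j k jk E / (j < k)%N => [wl|].
  case: (ltngtP j k) => [|h|/val_inj e]; first exact: wl.
    by apply: (wl k j) => //; rewrite eq_sym.
  by rewrite e eqxx in jk.
exists j, k; split=> //.
have rj := rep_orb j cP; have rk := rep_orb k cP.
have e : mul (2 ^ j) (Affine x y) = mul (2 ^ k) (Affine x y).
  by rewrite (mul_mod (2 ^ j) nO) (mul_mod (2 ^ k) nO); have [->] := E.
by apply: rep_eq rj _; rewrite e.
Qed.

Lemma mul_neg_eq0 m n P : on P -> mul m P = neg_point (mul n P) -> mul (m + n) P = O.
Proof.
by move=> cP E; rewrite mulD // E addC ?on_neg ?on_mul // addN.
Qed.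

(** Equal abscissas of [2^j P] and [2^k P] mean that [2^k - 2^j] or [2^j + 2^k] kills [P], or that
    [2^j P] is already [O]. *)
Lemma finite_orbit_torsion x y : on (Affine x y) -> finite_orbit l x ->
  torsion l (Affine x y).
Proof.
move=> cP [j [k [jk c]]].
have cj := on_mul (2 ^ j) cP; have ck := on_mul (2 ^ k) cP.
case: (rep_cross cj ck (rep_orb j cP) (rep_orb k cP) c) => E.
- exists (2 ^ k - 2 ^ j)%N; split; first by rewrite subn_gt0 ltn_exp2l.
  by apply: mul_cancel => //; rewrite leq_exp2l // ltnW.
- exists (2 ^ j + 2 ^ k)%N; split; first by rewrite addn_gt0 expn_gt0.
  exact: mul_neg_eq0.
- by exists (2 ^ j)%N; split; rewrite ?expn_gt0.
Qed.

End Curve.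

(** * Propagation of repetitions, and the symmetry exchanging 1 and l *)

Section Orbits.
Variables (F : fieldType) (l : F).

(** The abscissas of [2 P] and [2 Q] agree when [P] is [Q + t] or [- Q + t] with [t] of order
    dividing 2; the last four factors of the identity correspond to the four choices of [t]. *)
Lemma cross_dbl p q : cross p q = 0 -> cross (dbl l p) (dbl l q) = 0.
Proof.
case: p q => [X Z] [X' Z']; rewrite /cross /dbl /= => c.
transitivity (4 * (X * Z' - X' * Z) * (X * X' - l * Z * Z')
   * (X * X' - X * Z' - X' * Z + l * Z * Z')
   * (X * X' - l * X * Z' - l * X' * Z + l * Z * Z')); last by rewrite c; ring.
by ring.
Qed.

Lemma cross_orb x j k n :
  cross (orbx l x j) (orbx l x k) = 0 -> cross (orbx l x (n + j)%N) (orbx l x (n + k)%N) = 0.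
Proof. by move=> c; elim: n => [//|n IH]; exact: cross_dbl. Qed.

Lemma dblZ (c : F) p : dbl l (c * p.1, c * p.2) = (c ^+ 4 * (dbl l p).1, c ^+ 4 * (dbl l p).2).
Proof. by rewrite /dbl /=; congr pair; ring. Qed.

End Orbits.

Lemma dbl_swap (F : fieldType) (l : F) p : l != 0 ->
  dbl l^-1 (p.1, l * p.2) = ((dbl l p).1, l * (dbl l p).2).
Proof. by move=> l0; rewrite /dbl /=; congr pair; field. Qed.

(* [(x, l) -> (x / l, 1 / l)] exchanges 1 and l, hence identifies the curves. *)
Lemma finite_orbit_swap (F : fieldType) (l x : F) : l != 0 ->
  finite_orbit l x -> finite_orbit l^-1 (x / l).
Proof.
move=> l0 [j [k [jk c]]]; exists j, k; split => //.
have H n : exists2 e : F, e != 0 &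
    orbx l^-1 (x / l) n = (e * (orbx l x n).1, e * (l * (orbx l x n).2)).
  elim: n => [|n [e e0 IH]].
    by exists l^-1; rewrite ?invr_eq0 //=; congr pair; field.
  exists (e ^+ 4); first by rewrite expf_neq0.
  rewrite /orbx iterS -/(orbx _ _ n) IH.
  by rewrite -[_ * _]/(e * ((orbx l x n).1, l * (orbx l x n).2).1)
     -[e * (l * _)]/(e * ((orbx l x n).1, l * (orbx l x n).2).2) dblZ dbl_swap.
have [e e0 ->] := H j; have [e' e'0 ->] := H k.
rewrite /cross /= in c *.
transitivity (e * e' * l * ((orbx l x j).1 * (orbx l x k).2 - (orbx l x k).1 * (orbx l x j).2)).
  by ring.
by rewrite c mulr0.
Qed.

(** * Orbits at a place above 2 *)

Section Valuation.
Variables (K : fieldType) (v : K -> \bar rat).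
Hypothesis vP : is_valuation v.

(** Finite thresholds turn bounds on valuations into rational inequalities; 0 satisfies all the
    lower bounds. *)
Definition vge (x : K) (r : rat) := (r%:E <= v x)%E.
Definition vgt (x : K) (r : rat) := (r%:E < v x)%E.
Definition veq (x : K) (r : rat) := v x = r%:E.

Lemma v_fin x : x != 0 -> exists r, veq x r.
Proof.
move=> x0; case e : (v x) => [r||]; first by exists r.
  by move/eqP: e; rewrite (val_pinfty vP) (negPf x0).
by have := val_ninfty vP x; rewrite e.
Qed.

Lemma v0 : v 0 = +oo%E. Proof. by apply/eqP; rewrite (val_pinfty vP). Qed.

Lemma veq_neq0 x r : veq x r -> x != 0.
Proof. by apply: contraPneq => ->; rewrite /veq v0. Qed.

Lemma vge0 r : vge 0 r. Proof. by rewrite /vge v0 leey. Qed.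
Lemma vgt0 r : vgt 0 r. Proof. by rewrite /vgt v0 ltey. Qed.

Lemma veq_ge x r : veq x r -> vge x r. Proof. by rewrite /vge => ->. Qed.
Lemma veq_geE x r s : veq x r -> vge x s = (s <= r).
Proof. by rewrite /vge => ->; rewrite lee_fin. Qed.
Lemma veq_gtE x r s : veq x r -> vgt x s = (s < r).
Proof. by rewrite /vgt => ->; rewrite lte_fin. Qed.
Lemma veq_inj x r s : veq x r -> veq x s -> r = s.
Proof. by rewrite /veq => -> []. Qed.
Lemma vgtW x r : vgt x r -> vge x r. Proof. exact: ltW. Qed.
Lemma vge_le x r s : vge x r -> s <= r -> vge x s.
Proof. by move=> xr sr; apply: le_trans xr; rewrite lee_fin. Qed.
Lemma vge_lt x r s : vge x r -> s < r -> vgt x s.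
Proof. by move=> xr sr; apply: lt_le_trans xr; rewrite lte_fin. Qed.
Lemma vgt_le x r s : vgt x r -> s <= r -> vgt x s.
Proof. by move=> xr sr; apply: le_lt_trans xr; rewrite lee_fin. Qed.

Lemma vge_or x r : vge x r \/ exists2 s, veq x s & s < r.
Proof.
case: (leP (r%:E)%E (v x)) => h; first by left.
right; have x0 : x != 0 by apply: contraTneq h => ->; rewrite v0 -leNgt leey.
by have [s es] := v_fin x0; exists s => //; rewrite -lte_fin -es.
Qed.

Lemma veqM x y r s : veq x r -> veq y s -> veq (x * y) (r + s).
Proof. by rewrite /veq (val_mul vP) => -> ->. Qed.

Lemma vgeM x y r s : vge x r -> vge y s -> vge (x * y) (r + s).
Proof. by rewrite /vge (val_mul vP) EFinD; apply: leeD. Qed.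

Lemma vgtM x y r s : vgt x r -> vge y s -> vgt (x * y) (r + s).
Proof.
move=> xr ys; have [->|x0] := eqVneq x 0; first by rewrite mul0r vgt0.
have [->|y0] := eqVneq y 0; first by rewrite mulr0 vgt0.
have [a ea] := v_fin x0; have [b eb] := v_fin y0.
move: xr ys; rewrite (veq_gtE _ ea) (veq_geE _ eb) (veq_gtE _ (veqM ea eb)).
by move=> *; rewrite ltr_leD.
Qed.

Lemma vgeMr x y r : vge x 0 -> vge y r -> vge (x * y) r.
Proof. by move=> a b; rewrite -[r]add0r; exact: vgeM. Qed.

Lemma veq1 : veq 1 0.
Proof.
have [r e] := v_fin (oner_neq0 K); have := veqM e e.
by rewrite mulr1 => /(veq_inj e)/eqP; rewrite eq_sym addrC -subr_eq0 addrK => /eqP <-.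
Qed.

Lemma veqX x r n : veq x r -> veq (x ^+ n) (r *+ n).
Proof.
by move=> e; elim: n => [|n IH]; [exact: veq1|rewrite exprS mulrS; exact: veqM].
Qed.

Lemma vgeX x n : vge x 0 -> vge (x ^+ n) 0.
Proof.
move=> e; elim: n => [|n IH]; first exact: veq_ge veq1.
by rewrite exprS; apply: vgeMr.
Qed.

Lemma veqV x r : veq x r -> veq x^-1 (- r).
Proof.
move=> e; have x0 := veq_neq0 e; have [s e'] := v_fin (invr_neq0 x0).
have := veqM e e'; rewrite mulfV // => /(veq_inj veq1) /eqP.
by rewrite eq_sym addr_eq0 => /eqP rs; rewrite rs opprK.
Qed.

Lemma veqN1 : veq (- 1) 0.
Proof.
have n0 : - 1 != 0 :> K by rewrite oppr_eq0 oner_eq0.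
have [r e] := v_fin n0; have := veqM e e; rewrite mulrNN mulr1 => /(veq_inj veq1) h.
by have -> : 0 = r by lra.
Qed.

Lemma v_opp x : v (- x) = v x.
Proof. by rewrite -mulN1r (val_mul vP) veqN1 add0e. Qed.

Lemma veqN x r : veq x r -> veq (- x) r. Proof. by rewrite /veq v_opp. Qed.
Lemma vgeN x r : vge (- x) r = vge x r. Proof. by rewrite /vge v_opp. Qed.
Lemma vgtN x r : vgt (- x) r = vgt x r. Proof. by rewrite /vgt v_opp. Qed.

Lemma vgeD x y r : vge x r -> vge y r -> vge (x + y) r.
Proof. by move=> a b; apply: le_trans (val_add vP x y); rewrite le_min; apply/andP. Qed.
Lemma vgtD x y r : vgt x r -> vgt y r -> vgt (x + y) r.
Proof. by move=> a b; apply: lt_le_trans (val_add vP x y); rewrite lt_min; apply/andP. Qed.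
Lemma vgeB x y r : vge x r -> vge y r -> vge (x - y) r.
Proof. by move=> a b; apply: vgeD; rewrite ?vgeN. Qed.
Lemma vgtB x y r : vgt x r -> vgt y r -> vgt (x - y) r.
Proof. by move=> a b; apply: vgtD; rewrite ?vgtN. Qed.

Lemma veqD x y r : veq x r -> vgt y r -> veq (x + y) r.
Proof.
move=> ex gy; apply/eqP; rewrite eq_le; apply/andP; split; last first.
  exact: vgeD (veq_ge ex) (vgtW gy).
rewrite leNgt; apply/negP => h.
have : vgt x r by rewrite -[x](addrK y); apply: vgtB.
by rewrite (veq_gtE _ ex) ltxx.
Qed.
Lemma veqB x y r : veq x r -> vgt y r -> veq (x - y) r.
Proof. by move=> a b; apply: veqD; rewrite ?vgtN. Qed.

Lemma vge_nat n : vge n%:R 0.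
Proof. by elim: n => [|n IH]; [exact: vge0|rewrite mulrS; apply: vgeD;
  rewrite // (veq_ge veq1)]. Qed.

Lemma vge_int (z : int) : vge z%:~R 0.
Proof. by case: z => n; rewrite ?NegzE ?mulrNz ?vgeN; exact: vge_nat. Qed.

Hypothesis v2E : veq 2 1.

Lemma v2_neq0 : 2 != 0 :> K. Proof. exact: veq_neq0 v2E. Qed.

Lemma veq_odd n : odd n -> veq n%:R 0.
Proof.
move=> on; rewrite -(odd_double_half n) on natrD -mul2n natrM.
apply: veqD veq1 _; apply: vge_lt (vgeM (veq_ge v2E) (vge_nat _)) _; lra.
Qed.

Lemma vgt_sq x r : vgt (x ^+ 2) (r * 2) -> vgt x r.
Proof.
move=> h; case: (ltP (r%:E)%E (v x)) => // xr.
have x0 : x != 0 by apply: contraTneq xr => ->; rewrite v0 -ltNge ltey.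
have [s es] := v_fin x0; move: h; rewrite (veq_gtE _ (veqX 2 es)).
by move: xr; rewrite es lee_fin mulr2n; lra.
Qed.

(** Squaring is injective on the residue field, which has characteristic 2. *)
Lemma vgt_sqB x y : vge x 0 -> vge y 0 -> vgt (x ^+ 2 - y ^+ 2) 0 -> vgt (x - y) 0.
Proof.
move=> ix iy h; apply: vgt_sq; rewrite mul0r.
have -> : (x - y) ^+ 2 = (x ^+ 2 - y ^+ 2) - 2 * (y * (x - y)) by ring.
apply: vgtB h _; apply: (@vge_lt _ (1 + 0)) => //.
by apply: vgeM (veq_ge v2E) _; apply: vgeMr => //; apply: vgeB.
Qed.

(* [p] represents the abscissa [p.1 / p.2], of valuation [r]. *)
Definition deep l p r := [/\ r < 0, vgt l r &
  exists a d, [/\ veq p.1 a, veq p.2 d & a - d = r]].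

(** Both [x^2 - l] and [x (x - 1) (x - l)] are dominated by their leading terms, so the double has
    the valuation of [x^4 / (4 x^3) = x / 4]. *)
Lemma deep_dbl l p r : deep l p r -> deep l (dbl l p) (r - 2).
Proof.
case=> r0 lr [a [d [ea ed ad]]]; split; first lra.
  by apply: vgt_le lr _; lra.
have e4 : veq (4 : K) 2.
  rewrite (_ : 4 = 2 * 2); last by ring.
  exact: veqM v2E v2E.
have ld : vgt (l * p.2) a.
  by have h := vgtM lr (veq_ge ed); apply: vgt_le h _; lra.
exists (a *+ 2 *+ 2), (2 + a + d + a + a); split.
- apply: veqX; apply: veqB; first exact: veqX.
  have h := vgtM lr (veq_ge (veqX 2 ed)); apply: vgt_le h _; rewrite !mulr2n; lra.
- apply: veqM; last exact: veqB.
  apply: veqM; first exact: veqM (veqM e4 ea) ed.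
  by apply: veqB => //; rewrite (veq_gtE _ ed); lra.
by rewrite !mulr2n; lra.
Qed.

Lemma deep_not_finite l x m r : deep l (orbx l x m) r -> ~ finite_orbit l x.
Proof.
move=> dp [j [k [jk /(cross_orb m)]]].
have H n : deep l (orbx l x (n + m)%N) (r - 2 * n%:R).
  elim: n => [|n IH]; first by rewrite mulr0 subr0.
  rewrite addSn (_ : r - _ = r - 2 * n%:R - 2); first exact: deep_dbl.
  by rewrite -addn1 natrD; lra.
have [_ _ [a [d [ea ed ad]]]] := H j; have [_ _ [a' [d' [ea' ed' ad']]]] := H k.
rewrite /cross addnC [(m + k)%N]addnC => /eqP; rewrite subr_eq0 => /eqP e.
have := veqM ea' ed; rewrite -e => /(veq_inj (veqM ea ed')) E.
have : (j%:R < k%:R :> rat) by rewrite ltr_nat.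
lra.
Qed.

(* [u] is the parameter of the point [x]: it satisfies
   [l = x^2 + 2 u x (1 - x)] and the double of [x] is [u^2 / (2 u - 1)]. *)
Lemma halving_param l x x1 : vge x1 0 -> x != 0 -> x != 1 ->
  (x ^+ 2 - l) ^+ 2 = x1 * (4 * x * (x - 1) * (x - l)) ->
  exists u, [/\ vge u 0, l = x ^+ 2 + 2 * u * x * (1 - x) & x1 * (2 * u - 1) = u ^+ 2].
Proof.
move=> i1 x0 xn1 E; have x1' : 1 - x != 0 by rewrite subr_eq0 eq_sym.
have n2 := v2_neq0.
pose u := (l - x ^+ 2) / (2 * x * (1 - x)).
have lE : l = x ^+ 2 + 2 * u * x * (1 - x) by rewrite /u; field; rewrite ?x0 ?x1' ?n2.
have uE : x1 * (2 * u - 1) = u ^+ 2.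
  have d : 4 * x ^+ 2 * (1 - x) ^+ 2 != 0.
    by rewrite !mulf_neq0 ?expf_neq0 // (_ : 4 = 2 * 2) ?mulf_neq0 //; ring.
  apply: (mulIf d).
  have E' : (x ^+ 2 - l) ^+ 2 = 4 * x ^+ 2 * (1 - x) ^+ 2 * u ^+ 2 by rewrite {1}lE; ring.
  have xl : x - l = x * (1 - x) * (1 - 2 * u) by rewrite lE; ring.
  by rewrite [RHS]mulrC -E' E xl; ring.
exists u; split => //.
(* If [v u = s < 0], then [2 s = v (u^2) >= min (s + 1) 0] because [x1] is integral, which is
   impossible. *)
have [//|[s es s0]] := vge_or u 0.
have e2 := veqX 2 es; rewrite -uE in e2.
have h : vge (2 * u - 1) (Num.min (s + 1) 0).
  apply: vgeB; last by rewrite (veq_geE _ veq1) ge_min lexx orbT.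
  by rewrite (veq_geE _ (veqM v2E es)) ge_min addrC lexx.
have := vgeMr i1 h; rewrite (veq_geE _ e2) mulr2n minEle.
by case: ifP => _; lra.
Qed.

(** The four values of [l] for which the point over [a], or its double, has abscissa [l], [0], [1],
    [l] in this order: the first makes the point itself 2-torsion, the others its double. The last
    three are single values because [x (2 P) - e] has a perfect square as numerator for [e] in [0],
    [1], [l]. *)
Definition exceptional (l a : K) := [\/ l = a, l = a ^+ 2, l = a * (2 - a) |
  2 * a - 1 != 0 /\ l = a ^+ 2 / (2 * a - 1)].

Lemma exceptionalP l a : a != 0 ->
  [|| l == a, l == a ^+ 2, l == a * (2 - a) | l * (2 * a - 1) == a ^+ 2] ->
  exceptional l a.
Proof.
move=> a0 /or4P[] /eqP e; [exact: Or41|exact: Or42|exact: Or43|apply: Or44].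
have d0 : 2 * a - 1 != 0.
  by apply: contraNneq a0 => d0; rewrite -sqrf_eq0 -e d0 mulr0.
by split=> //; rewrite -e mulfK.
Qed.

(** Outside the exceptional values, [a], its double [x1] and the next double are all integral. The
    parameters of both doublings give [a^2 = l = x1^2] in the residue field, hence [a = x1] there,
    and [x1 (2 u - 1) = u^2] then reads [u^2 = a]. *)
Lemma finite_orbit_integral l a : l != 0 -> l != 1 -> a != 0 -> a != 1 ->
  finite_orbit l a -> vge l 0 -> vge a 0 ->
  exceptional l a \/
  exists u, [/\ vge u 0, vgt (u ^+ 2 - a) 0 & l = a ^+ 2 + 2 * u * a * (1 - a)].
Proof.
move=> l0 l1 a0 a1 fin il ia; have n2 := v2_neq0.
case S : [|| l == a, l == a ^+ 2, l == a * (2 - a) | l * (2 * a - 1) == a ^+ 2].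
  by left; apply: exceptionalP.
right; move/negbT: S; rewrite !negb_or => /and4P[la la2 la3 la4].
have n4 : 4 != 0 :> K by rewrite (_ : 4 = 2 * 2) ?mulf_neq0 //; ring.
(* A point of the orbit that is not 2-torsion has an affine double, and this double is integral
   since otherwise it would be [deep]. *)
have step x m c : orbx l a m = (c * x, c) -> c != 0 -> x != 0 -> x != 1 -> x != l ->
  exists2 x1, (x ^+ 2 - l) ^+ 2 = x1 * (4 * x * (x - 1) * (x - l)) &
  vge x1 0 /\ exists2 c', c' != 0 & orbx l a m.+1 = (c' * x1, c').
  move=> E c0 x0 x1 xl.
  have d0 : 4 * x * (x - 1) * (x - l) != 0 by rewrite !mulf_neq0 // subr_eq0.
  pose y := (x ^+ 2 - l) ^+ 2 / (4 * x * (x - 1) * (x - l)).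
  have yE : (x ^+ 2 - l) ^+ 2 = y * (4 * x * (x - 1) * (x - l)) by rewrite divfK.
  exists y => //.
  have E' : orbx l a m.+1 = (c ^+ 4 * (4 * x * (x - 1) * (x - l)) * y,
      c ^+ 4 * (4 * x * (x - 1) * (x - l))).
    rewrite /orbx iterS -/(orbx l a m) E /dbl /=; congr pair; last by ring.
    by rewrite -mulrA [_ * y]mulrC -yE; ring.
  have c'0 : c ^+ 4 * (4 * x * (x - 1) * (x - l)) != 0 by rewrite mulf_neq0 ?expf_neq0.
  split; last by eexists; [exact: c'0|exact: E'].
  have [//|[r er r0]] := vge_or y 0.
  have [s es] := v_fin c'0.
  case: (@deep_not_finite l a m.+1 r) => //; split => //.
    exact: vge_lt il r0.
  by exists (s + r), s; rewrite E' /=; split => //; [exact: veqM|ring].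
have [] := step a 0%N 1; rewrite ?mul1r ?oner_eq0 // 1?eq_sym //.
move=> x1 E1 [i1 [c1 c10 orb1]].
have [u [iu lE uE]] := halving_param i1 a0 a1 E1.
have al : a - l != 0 by rewrite subr_eq0 eq_sym.
have a1' : a - 1 != 0 by rewrite subr_eq0.
have d0 : 4 * a * (a - 1) * (a - l) != 0 by rewrite !mulf_neq0.
have x10 : x1 != 0.
  apply: contraNneq la2 => z; move/eqP: E1; rewrite z mul0r sqrf_eq0 subr_eq0.
  by rewrite eq_sym.
have x11 : x1 != 1.
  apply: contraNneq la3 => z; rewrite -subr_eq0 -sqrf_eq0; apply/eqP.
  transitivity ((a ^+ 2 - l) ^+ 2 - 1 * (4 * a * (a - 1) * (a - l))); first by ring.
  by rewrite E1 z subrr.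
have x1l : x1 != l.
  apply: contraNneq la4 => z; rewrite -subr_eq0 -sqrf_eq0; apply/eqP.
  transitivity ((a ^+ 2 - l) ^+ 2 - l * (4 * a * (a - 1) * (a - l))); first by ring.
  by rewrite E1 z subrr.
have [x2 E2 [i2 _]] := step x1 1%N c1 orb1 c10 x10 x11 x1l.
have [u1 [iu1 lE1 _]] := halving_param i2 x10 x11 E2.
exists u; split => //.
have i1' y : vge y 0 -> vge (1 - y) 0.
  by move=> iy; apply: vgeB iy; apply: veq_ge veq1.
have par x w : vge x 0 -> vge w 0 -> vgt (2 * w * x * (1 - x)) 0.
  move=> ix iw; apply: (@vge_lt _ (1 + 0)) => //; rewrite -!mulrA.
  apply: vgeM (veq_ge v2E) _; apply: vgeMr => //; apply: vgeMr => //; exact: i1'.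
have x1a : vgt (x1 - a) 0.
  apply: vgt_sqB => //; rewrite (_ : _ - _ = 2 * u * a * (1 - a) - 2 * u1 * x1 * (1 - x1)).
    by apply: vgtB; apply: par.
  transitivity ((x1 ^+ 2 - l) - (a ^+ 2 - l)); first by ring.
  by rewrite {1}lE1 lE; ring.
rewrite (_ : u ^+ 2 - a = x1 - a + 2 * (u ^+ 2 - x1 + x1 * u - u ^+ 2)); last first.
  by rewrite -uE; ring.
apply: vgtD x1a _; apply: (@vge_lt _ (1 + 0)) => //.
apply: vgeM (veq_ge v2E) _; apply: vgeB; last exact: vgeX.
apply: vgeD; last exact: vgeMr.
by apply: vgeB => //; apply: vgeX.
Qed.

(** For integral [a] and [v l < 0], one doubling is already [deep], of valuation
    [v l - 2 - v a - v (a - 1)]. For [v a < 0] the point itself is [deep] if [v l > v a]; otherwise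
    [1 / l] and [a / l] are integral and the swapped curve is used. *)
Lemma finite_orbit_cases l a : l != 0 -> l != 1 -> a != 0 -> a != 1 ->
  finite_orbit l a -> exceptional l a \/
  if (0 <= v a)%E then
    exists u, [/\ vge u 0, vgt (u ^+ 2 - a) 0 & l = a ^+ 2 + 2 * u * a * (1 - a)]
  else exists u, [/\ vgt u 0, 1 + 2 * (a - 1) * u != 0 & l = a ^+ 2 / (1 + 2 * (a - 1) * u)].
Proof.
move=> l0 l1 a0 a1 fin.
have [la|la] := eqVneq l a; first by left; apply: Or41.
have a1' : a - 1 != 0 by rewrite subr_eq0.
have al' : a - l != 0 by rewrite subr_eq0 eq_sym.
have n2 := v2_neq0.
have [b eb] := v_fin l0; have [c ec] := v_fin a0; have [d ed] := v_fin a1'.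
case: ifPn => ia.
  have [il|[b' eb' b0]] := vge_or l 0; first exact: finite_orbit_integral.
  have c0 : 0 <= c by rewrite -(veq_geE _ ec).
  have ia1 : vge (a - 1) 0 by apply: vgeB ia (veq_ge veq1).
  have d0 : 0 <= d by rewrite -(veq_geE _ ed).
  case: (@deep_not_finite l a 1%N (b' - 2 - c - d)) => //; split; first lra.
    by rewrite (veq_gtE _ eb'); lra.
  exists (b' *+ 2), (2 + c + d + b'); rewrite /orbx /=; split; last by rewrite mulr2n; ring.
    apply: veqX; rewrite expr1n mulr1 -opprB; apply: veqN; apply: veqB => //.
    by apply: vge_lt (vgeX 2 ia) _.
  have -> : 4 * a * 1 * (a - 1) * (a - l * 1) = 2 * 2 * a * (a - 1) * (a - l) by ring.
  apply: veqM; last by rewrite -opprB; apply: veqN; apply: veqB eb' (vge_lt ia _).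
  apply: veqM => //; apply: veqM => //; have -> : 2 = 1 + 1 :> rat by ring.
  exact: veqM v2E v2E.
have c0 : c < 0 by rewrite ltNge -(veq_geE _ ec).
have [bc|bc] := ltP c b.
  case: (@deep_not_finite l a 0%N c) => //; split=> //; first by rewrite (veq_gtE _ eb).
  by exists c, 0; split; [|exact: veq1|rewrite subr0].
have il' : vge l^-1 0 by rewrite (veq_geE _ (veqV eb)); lra.
have ea' := veqM ec (veqV eb).
have ia' : vge (a / l) 0 by rewrite (veq_geE _ ea'); lra.
have al0 : a / l != 0 by rewrite mulf_neq0 ?invr_eq0.
have al1 : a / l != 1 by rewrite -subr_eq0 -[1](divff l0) -mulrBl mulf_neq0 ?invr_eq0.
have l'1 : l^-1 != 1 by rewrite invr_eq1.
have l'0 : l^-1 != 0 by rewrite invr_eq0.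
have fin' := finite_orbit_swap l0 fin.
have [E|[u [iu ua lE]]] := finite_orbit_integral l'0 l'1 al0 al1 fin' il' ia'.
  (* The swap turns the first exceptional value into [a = 1], which is excluded, fixes the second,
     and exchanges the third and the fourth. *)
  left; apply: exceptionalP => //.
  have : l^-1 = a / l \/ [\/ l^-1 = (a / l) ^+ 2, l^-1 = (a / l) * (2 - a / l) |
     l^-1 * (2 * (a / l) - 1) = (a / l) ^+ 2].
    case: E => [E|E|E|[d0 E]]; [by left|right; exact: Or31|right; exact: Or32|].
    by right; apply: Or33; rewrite {1}E divfK.
  have ll : l ^+ 2 != 0 by rewrite expf_neq0.
  case=> [E'|[E'|E'|E']]; apply/or4P.
  - case/negP: a1; apply/eqP; apply: (mulIf l'0); by rewrite mul1r -E'.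
  - apply: Or42; apply/eqP; transitivity (l ^+ 2 * l^-1); first by field.
    by rewrite E'; field.
  - apply: Or44; apply/eqP; transitivity (l ^+ 2 * (a / l * (2 - a / l)) - l + a ^+ 2).
      by field.
    by rewrite -E'; field.
  - apply: Or43; apply/eqP.
    transitivity (l - l ^+ 2 * (l^-1 * (2 * (a / l) - 1)) + (2 * a - l)); first by field.
    by rewrite E'; field.
have b0 : b < 0 by lra.
have par : vgt (2 * u * (a / l) * (1 - a / l)) 0.
  move: (a / l) ia' => x ix; apply: (@vge_lt _ (1 + 0)) => //; rewrite -!mulrA.
  apply: vgeM (veq_ge v2E) _; apply: vgeMr => //; apply: vgeMr => //.
  by apply: vgeB ix; apply: veq_ge veq1.
(* [1 / l] lies in the maximal ideal, hence so do [a / l] and, as [u^2 = a / l] in the residue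
   field, also [u]. *)
have a'0 : vgt (a / l) 0.
  apply: vgt_sq; rewrite mul0r (_ : _ ^+ 2 = l^-1 - 2 * u * (a / l) * (1 - a / l)).
    by apply: vgtB par; rewrite (veq_gtE _ (veqV eb)); lra.
  by move: (a / l) lE => x ->; ring.
have u0 : vgt u 0.
  by apply: vgt_sq; rewrite mul0r -[u ^+ 2](subrK (a / l)); apply: vgtD.
have e2u : veq (1 - 2 * u) 0.
  by apply: veqB veq1 _; have := vgtM u0 (veq_ge v2E); rewrite mulrC => h; apply: vgt_le h _.
have n2u := veq_neq0 e2u.
have E : l * (1 - 2 * u * a) = a ^+ 2 * (1 - 2 * u).
  transitivity (l ^+ 2 * (l^-1 - 2 * u * (a / l))); first by field.
  by rewrite {1}lE; field.
have n2ua : 1 - 2 * u * a != 0.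
  have : a ^+ 2 * (1 - 2 * u) != 0 by rewrite mulf_neq0 ?expf_neq0.
  by rewrite -E; apply: contraNneq => ->; rewrite mulr0.
(* Solving the relation for [l] gives [l = a^2 (1 - 2 u) / (1 - 2 u a)], which has the required form
   with this parameter. *)
right; exists (- u / (1 - 2 * u)).
have dE : 1 + 2 * (a - 1) * (- u / (1 - 2 * u)) = (1 - 2 * u * a) / (1 - 2 * u) by field.
split.
- by have := vgtM u0 (veq_ge (veqV e2u)); rewrite oppr0 addr0 mulNr vgtN.
- by rewrite dE mulf_neq0 ?invr_eq0.
- rewrite dE; apply: (mulIf n2ua); rewrite E; by field; rewrite n2u n2ua.
Qed.

End Valuation.

(** * Torsion in the complex numbers as finiteness of orbits *)

Section Torsion.
Variable R : realType.
Implicit Types a l : Qbar R.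

Definition qval : {rmorphism Qbar R -> R[i]} := \val.

Lemma qval_inj : injective qval. Proof. exact: val_inj. Qed.

Lemma complex2_neq0 : 2 != 0 :> R[i]. Proof. by rewrite pnatr_eq0. Qed.

Lemma TsetP (x l : R[i]) :
  Tset x l <-> [/\ l != 0, l != 1 & finite_orbit l x].
Proof.
split=> [[l0 l1 [y [cP tP]]]|[l0 l1 fin]]; split=> //.
  exact: torsion_finite_orbit complex2_neq0 l0 l1 _ _ cP tP.
have cP : on_curve l (Affine x (sqrtC (x * (x - 1) * (x - l)))).
  by rewrite /on_curve sqrtCK.
exists (sqrtC (x * (x - 1) * (x - l))); split => //.
exact: finite_orbit_torsion complex2_neq0 l0 l1 _ _ cP fin.
Qed.

Lemma Tset_qval a l : Tset (qval a) (qval l) <->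
  [/\ l != 0, l != 1 & finite_orbit l a].
Proof.
rewrite TsetP fmorph_eq0 -(rmorph1 qval) (inj_eq qval_inj).
by split=> -[? ? /(finite_orbit_map l a qval_inj)].
Qed.

Lemma algebraic_root (p : {poly Qbar R}) z :
  p != 0 -> root (map_poly qval p) z -> exists l, z = qval l.
Proof.
move=> p0 pz.
have alg : algebraicOver (ratr : rat -> R[i]) z.
  apply/integral_algebraic; apply: integral_root pz _.
    by rewrite map_poly_eq0.
  apply/integral_poly => j; rewrite coef_map; apply/integral_algebraic.
  by case: (p`_j) => c /= /asboolP.
by exists (MkQbar (introT (asboolP _) alg)).
Qed.

End Torsion.
Arguments qval {R}.
Arguments qval_inj {R}.

(** * The sets [Rset] and [Sset] at the given place, and the disjointness criteria *)

Section TwoAdicQbar.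
Variables (R : realType) (L : Q2closure) (i : {rmorphism Qbar R -> Q2bar L}).
Local Notation v := (v2 i).
Local Notation vge := (vge v).
Local Notation vgt := (vgt v).
Local Notation veq := (veq v).
Implicit Types a b l u : Qbar R.

Lemma v2P : is_valuation v.
Proof.
have [h1 h2 h3 h4] := vbarP L; split=> *; rewrite /v2 ?h1 ?h2 ?fmorph_eq0 ?rmorphM ?h3 //.
by rewrite rmorphD.
Qed.

Lemma v2_two : veq 2 1.
Proof.
have := Q2_val2 (Q2P L).
by rewrite /veq /v2 !rmorph_nat.
Qed.

Lemma red_sub a b : vge a 0 -> vge b 0 -> red (i (a - b)) = red (i a) - red (i b).
Proof.
move=> ia ib; have [r1 rD rM _ _] := redP L.
have vN1 := veqN1 v2P.
rewrite rmorphB rD //; last by rewrite -rmorphN; rewrite -(vgeN v2P) in ib.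
congr (_ + _).
have := rD (i b) (- i b); rewrite subrr => /(_ ib).
rewrite -rmorphN => /(_ _) /esym h.
have r0 : red 0 = 0 :> F2bar L by apply/eqP; rewrite (red_eq0 (redP L)) ?(val_pinfty (vbarP L)) //;
  have := v0 v2P; rewrite /v2 rmorph0 => ->.
apply/eqP; rewrite -addr_eq0 addrC h ?r0 //.
by rewrite -(vgeN v2P) in ib.
Qed.

Lemma red_eq a b : vge a 0 -> vge b 0 -> (red (i a) = red (i b)) <-> vgt (a - b) 0.
Proof.
move=> ia ib; rewrite /vgt /v2 -(red_eq0 (redP L)); last exact: (vgeB v2P).
by rewrite red_sub // subr_eq0; split=> /eqP.
Qed.

Lemma rho_int a : vge a 0 -> rho i a = Some (red (i a)).
Proof. by rewrite /rho /vge /v2 => ->. Qed.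

Lemma rho_eq a b : vge a 0 -> vge b 0 -> (rho i a = rho i b) <-> vgt (a - b) 0.
Proof.
by move=> ia ib; rewrite !rho_int // -red_eq //; split=> [[]|->].
Qed.

Lemma rho_None a : rho i a = None <-> ~~ (0 <= v a)%E.
Proof. by rewrite /rho; case: (0 <= v a)%E. Qed.

Lemma rho0 : rho i 0 = Some 0.
Proof.
have i0 : vge 0 0 by apply: (vge0 v2P).
rewrite rho_int //; congr Some; apply/eqP; rewrite (red_eq0 (redP L)) //.
exact: (vgt0 v2P).
Qed.

Lemma rho1 : rho i 1 = Some 1.
Proof.
rewrite rho_int ?rmorph1 ?(red1 (redP L)) //; exact: (veq_ge (veq1 v2P)).
Qed.

Lemma rho_eq0 u : vge u 0 -> (rho i u = Some 0) <-> vgt u 0.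
Proof.
move=> iu; rewrite -rho0 rho_eq ?subr0 //; exact: (vge0 v2P).
Qed.

Lemma RsetP_int a l : vge a 0 -> Rset i a l <->
  exists u, [/\ vge u 0, vgt (u ^+ 2 - a) 0 & l = a ^+ 2 + 2 * u * a * (1 - a)].
Proof.
move=> ia; rewrite /Rset /= (ia : (0 <= v a)%E).
split=> -[u [iu h ->]]; exists u; split=> //.
  by apply/rho_eq => //; apply: (vgeX v2P).
by apply/rho_eq => //; apply: (vgeX v2P).
Qed.

Lemma RsetP_ninf a l : ~~ (0 <= v a)%E -> Rset i a l <->
  exists u, [/\ vgt u 0, 1 + 2 * (a - 1) * u != 0 & l = a ^+ 2 / (1 + 2 * (a - 1) * u)].
Proof.
move=> /negPf ia; rewrite /Rset /= ia.
split=> [[u [iu h n ->]]|[u [iu n ->]]]; exists u; split=> //.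
- exact/rho_eq0.
- exact: vgtW.
- by apply/rho_eq0 => //; apply: vgtW.
Qed.

Lemma finite_orbit_SR l a : l != 0 -> l != 1 -> a != 0 -> a != 1 ->
  finite_orbit l a -> Sset a l \/ Rset i a l.
Proof.
move=> l0 l1 a0 a1 /(finite_orbit_cases v2P v2_two l0 l1 a0 a1)[h|]; first by left.
by case: ifPn => ia h; right; [apply/RsetP_int|apply/RsetP_ninf].
Qed.

Lemma nonint_veq a : ~~ (0 <= v a)%E -> exists2 r, veq a r & r < 0.
Proof. by case: (vge_or v2P a 0) => [ia /negP|//]; case. Qed.

(** Keeps the polynomial of [Tset_algebraic] from vanishing identically. For non-integral [a] and
    [l = 2] the point is [deep] at once. For integral [a], every value allowed by
    [finite_orbit_cases] is integral, which [1 / 2] is not. *)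
Lemma not_all_finite a : a != 0 -> a != 1 ->
  exists l, [/\ l != 0, l != 1 & ~ finite_orbit l a].
Proof.
move=> a0 a1; have t0 := v2_neq0 v2P v2_two.
case: (vge_or v2P a 0) => [ia|[r ea r0]]; last first.
  exists 2; split=> //.
    by rewrite -subr_eq0 (_ : 2 - 1 = 1) ?oner_eq0 //; ring.
  apply: (@deep_not_finite _ _ v2P v2_two _ _ 0%N r); split=> //.
    by rewrite (veq_gtE _ v2_two); lra.
  by exists r, 0; split; [|exact: (veq1 v2P)|rewrite subr0].
have h := veqV v2P v2_two.
have h1 : 2^-1 != 1 :> Qbar R.
  by apply/eqP=> e; have := veq1 v2P; rewrite -e => /(veq_inj h).
have h0 : 2^-1 != 0 :> Qbar R by rewrite invr_eq0.
exists 2^-1; split => // fin.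
case: (finite_orbit_cases v2P v2_two h0 h1 a0 a1 fin) => [|]; last first.
  have -> : (0 <= v a)%E by [].
  move=> -[u [iu _ E]].
  have : vge 2^-1 0.
    rewrite E; apply: (vgeD v2P); first exact: (vgeX v2P).
    apply: (vgeMr v2P); last by apply: (vgeB v2P) => //; apply: veq_ge (veq1 v2P).
    apply: (vgeMr v2P) => //; apply: (vgeMr v2P) => //.
    exact: vge_le (veq_ge v2_two) _.
  by rewrite (veq_geE _ h).
have ni x : vge x 0 -> 2^-1 <> x by move=> ix e; move: ix; rewrite -e (veq_geE _ h).
have i2 : vge 2 0 by apply: vge_le (veq_ge v2_two) _.
case=> [/(ni _ ia)//|/(ni _ (vgeX v2P 2 ia))//|e|[d0 e]].
  by apply: (ni (a * (2 - a))) e; apply: (vgeMr v2P) => //; apply: (vgeB v2P).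
have d : veq (2 * a - 1) 0.
  rewrite -opprB; apply: (veqN v2P); apply: (veqB v2P); first exact: (veq1 v2P).
  by apply: (@vge_lt _ _ _ (1 + 0)) => //; apply: (vgeM v2P) => //; apply: veq_ge v2_two.
apply: (ni (a ^+ 2 / (2 * a - 1))) e; apply: (vgeMr v2P); first exact: (vgeX v2P).
by have := veq_ge (veqV v2P d); rewrite oppr0.
Qed.

(** A repetition at indices [j < k] makes [z] a root of a polynomial over [Qbar], the cross product
    computed with [l] as indeterminate; by [not_all_finite] it is nonzero. *)
Lemma Tset_algebraic a z : a != 0 -> a != 1 -> Tset (qval a) z -> exists l, z = qval l.
Proof.
move=> a0 a1 /TsetP[z0 z1 [j [k [jk c]]]].
pose p := cross (orbx 'X a%:P j) (orbx 'X a%:P k) : {poly Qbar R}.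
have ev (B : comNzRingType) (f : {rmorphism Qbar R -> B}) (x : B) :
    (map_poly f p).[x] = cross (orbx x (f a) j) (orbx x (f a) k).
  have /= -> := map_cross (map_poly f) 'X a%:P j k; rewrite map_polyX map_polyC /=.
  have /= := map_cross (horner_eval x) 'X (f a)%:P j k.
  by rewrite /horner_eval hornerX hornerC.
have [p0|p0] := eqVneq p 0; last first.
  by apply: algebraic_root p0 _; rewrite /root ev c.
have [l [_ _ []]] := not_all_finite a0 a1.
exists j, k; split=> //; have := ev _ idfun l.
by rewrite p0 rmorph0 horner0.
Qed.

Lemma Tset_SR a z : a != 0 -> a != 1 -> Tset (qval a) z ->
  exists l, z = qval l /\ (Sset a l \/ Rset i a l).
Proof.
move=> a0 a1 Tz; have [l zE] := Tset_algebraic a0 a1 Tz; exists l; split=> //.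
move: Tz; rewrite zE => /Tset_qval[l0 l1 fin].
exact: finite_orbit_SR.
Qed.

Lemma finite_Sset a : finite_set (Sset a).
Proof.
apply: (@sub_finite_set _ _ [set` [:: a; a ^+ 2; a * (2 - a); a ^+ 2 / (2 * a - 1)]]).
  by move=> l /= [->|->|->|[_ ->]]; rewrite !inE eqxx ?orbT.
exact: finite_seq.
Qed.

Lemma first_part a b : a != 0 -> a != 1 -> b != 0 -> b != 1 ->
  Rset i a `&` Rset i b = set0 ->
  let M := (Sset a `&` Sset b) `|` (Sset a `&` Rset i b) `|` (Rset i a `&` Sset b) in
  [/\ Tset2 (Qbar_val a) (Qbar_val b) `<=` @Qbar_val R @` M,
      M `<=` Sset a `|` Sset b &
      finite_set (Tset2 (Qbar_val a) (Qbar_val b))].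
Proof.
move=> a0 a1 b0 b1 Rab M.
have TM : Tset2 (Qbar_val a) (Qbar_val b) `<=` @Qbar_val R @` M.
  move=> z [/(Tset_SR a0 a1)[l [-> Ha]] /(Tset_SR b0 b1)[l' [/qval_inj<- Hb]]].
  exists l => //; case: Ha Hb => Ha [] Hb.
  - by left; left.
  - by left; right.
  - by right.
  - by have : (Rset i a `&` Rset i b) l by []; rewrite Rab.
have MS : M `<=` Sset a `|` Sset b.
  by move=> l [[[]|[]]|[]]; [left|left|right].
split=> //; apply: sub_finite_set TM _; apply: finite_image.
by apply: sub_finite_set MS _; rewrite finite_setU; split; apply: finite_Sset.
Qed.

Local Notation vgeD := (vgeD v2P).
Local Notation vgeB := (vgeB v2P).
Local Notation vgtD := (vgtD v2P).
Local Notation vgtB := (vgtB v2P).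
Local Notation vgeM := (vgeM v2P).
Local Notation vgtM := (vgtM v2P).
Local Notation veqM := (veqM v2P).
Local Notation vgeMr := (vgeMr v2P).

Let int1 : vge 1 0. Proof. exact: veq_ge (veq1 v2P). Qed.
Let ge2 : vge 2 1. Proof. exact: veq_ge v2_two. Qed.

Lemma vge_onesub a : vge a 0 -> vge (1 - a) 0.
Proof. exact: vgeB int1. Qed.

Lemma Rset_int a l : vge a 0 -> Rset i a l -> vge l 0 /\ vgt (l - a ^+ 2) 0.
Proof.
move=> ia /(RsetP_int _ ia)[u [iu _ ->]].
have h : vge (2 * u * a * (1 - a)) 1.
  rewrite -!mulrA -[X in vge _ X]addr0; apply: vgeM => //; apply: vgeMr => //.
  by apply: vgeMr => //; apply: vge_onesub.
split; last by rewrite addrC addKr; apply: vge_lt h _.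
by apply: vgeD; [exact: (vgeX v2P)|apply: vge_le h _].
Qed.

(** The denominator has valuation greater than [v a], so [v l < v a]. *)
Lemma Rset_nonint a l : a != 0 -> ~~ (0 <= v a)%E -> Rset i a l -> ~~ (0 <= v l)%E.
Proof.
move=> a0 ia /(RsetP_ninf _ ia)[u [u0 d0 lE]].
have [r er r0] := nonint_veq ia.
have [s es] := v_fin v2P d0.
have rs : r < s.
  rewrite -(veq_gtE _ es); apply: vgtD; first by rewrite (veq_gtE _ (veq1 v2P)).
  have h : vge (a - 1) r by apply: vgeB (veq_ge er) (vge_le int1 _); lra.
  have := vgtM u0 (vgeM ge2 h); rewrite mulrC => h'; apply: vgt_le h' _; lra.
have := veqM (veqX v2P 2 er) (veqV v2P es); rewrite -lE => el.
have := veq_geE 0 el; rewrite /vge => ->; rewrite mulr2n -ltNge; lra.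
Qed.

(** For integral [a], elements of [Rset i a] reduce to the square of the residue of [a], which
    determines that residue; integrality of [a] is also seen on them. *)
Lemma Rset_disjoint_rho a b : a != 0 -> b != 0 -> rho i a <> rho i b ->
  Rset i a `&` Rset i b = set0.
Proof.
move=> a0 b0 nab; rewrite -subset0 => l [Ra Rb]; apply: nab.
have [ia|ia] := boolP (0 <= v a)%E; have [ib|ib] := boolP (0 <= v b)%E.
- apply/rho_eq => //; apply: (vgt_sqB v2P v2_two) => //.
  have [_ ha] := Rset_int ia Ra; have [_ hb] := Rset_int ib Rb.
  by rewrite (_ : _ - _ = (l - b ^+ 2) - (l - a ^+ 2)); [exact: vgtB|ring].
- by have [il _] := Rset_int ia Ra; have /negP[] := Rset_nonint b0 ib Rb.
- by have [il _] := Rset_int ib Rb; have /negP[] := Rset_nonint a0 ia Ra.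
- by rewrite !(iffRL (rho_None _)).
Qed.

(** A common element gives [(a - b) (a + b) = 2 (w b (1 - b) - u a (1 - a))]. Since [u] and [w] have
    equal residues, as do [a] and [b], the right side has valuation greater than 1. With
    [s = v (a - b) <= 1 / 2], also [v (a + b) = s] because [a + b = (a - b) + 2 b], so the left side
    has valuation at most 1. *)
Lemma Rset_disjoint_generic a b : rho i a = rho i b -> rho i a <> None ->
  (v (a - b)%R <= (1 / 2)%R%:E)%E -> Rset i a `&` Rset i b = set0.
Proof.
move=> rab nN vab; rewrite -subset0 => l [Ra Rb].
have ia : vge a 0 by have [//|/rho_None /nN] := boolP (0 <= v a)%E.
have ib : vge b 0.
  by have [//|/rho_None e] := boolP (0 <= v b)%E; case: nN; rewrite rab.
have ab : vgt (a - b) 0 by apply/rho_eq.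
move/(RsetP_int _ ia): Ra => [u [iu ua lE]].
move/(RsetP_int _ ib): Rb => [w [iw wb lE']].
have uw : vgt (u - w) 0.
  apply: (vgt_sqB v2P v2_two) => //.
  rewrite (_ : _ - _ = (u ^+ 2 - a) - (w ^+ 2 - b) + (a - b)); last by ring.
  by apply: vgtD => //; apply: vgtB.
have d0 : a - b != 0.
  by apply: contraTneq vab => ->; rewrite (v0 v2P).
have [s es] := v_fin v2P d0.
have s2 : s <= 1 / 2 by rewrite -lee_fin -es.
have e2s : veq ((a - b) * (a - b + 2 * b)) (s + s).
  apply: (veqM es _); apply: ((veqD v2P) _ _ _ es _).
  by apply: vge_lt (vgeM ge2 ib) _; lra.
have : vgt ((a - b) * (a - b + 2 * b)) (0 + 1).
  rewrite (_ : _ * _ = (w * b * (1 - b) - u * a * (1 - a)) * 2); last first.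
    transitivity (a ^+ 2 - b ^+ 2); first by ring.
    transitivity (a ^+ 2 + 2 * u * a * (1 - a) - b ^+ 2 - 2 * u * a * (1 - a)); first by ring.
    by rewrite -lE lE'; ring.
  apply: vgtM => //.
  rewrite (_ : _ - _ = - ((u - w) * (b * (1 - b)) + (a - b) * (u * (1 - a - b)))); last by ring.
  rewrite (vgtN v2P) -[X in vgt _ X]addr0; apply: vgtD; apply: vgtM => //.
    by apply: vgeMr => //; apply: vge_onesub.
  by apply: vgeMr => //; apply: vgeB => //; apply: vge_onesub.
by rewrite (veq_gtE _ e2s); lra.
Qed.

(** Serves residue 0 directly and residue 1 after [x -> 1 - x]. The difference of squares has
    valuation [2 r], because [v (2 b) >= 1 + r > r], while the remaining terms have valuation
    greater than [1 + r >= 2 r]. *)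
Lemma residue_zero_disjoint a b t t' r : veq a r -> r <= 1 -> veq (a - b) r ->
  vge a 0 -> vge b 0 -> vgt t 0 -> vgt t' 0 ->
  a ^+ 2 + 2 * t * a * (1 - a) <> b ^+ 2 + 2 * t' * b * (1 - b).
Proof.
move=> ea r1 eab ia ib t0 t'0 E.
have br : vge b r by rewrite -[b](subKr a); apply: vgeB (veq_ge ea) (veq_ge eab).
have e : veq ((a - b) * (a - b + 2 * b)) (r + r).
  apply: (veqM eab _); apply: ((veqD v2P) _ _ _ eab _).
  by apply: vge_lt (vgeM ge2 br) _; lra.
have h w c : vgt w 0 -> vge c r -> vge c 0 -> vgt (w * (2 * (c * (1 - c)))) (0 + (1 + r)).
  move=> w0 cr ic; apply: vgtM => //; apply: vgeM => //.
  by rewrite mulrC; apply: vgeMr => //; apply: vge_onesub.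
have : vgt ((a - b) * (a - b + 2 * b)) (0 + (1 + r)).
  rewrite (_ : _ * _ = t' * (2 * (b * (1 - b))) - t * (2 * (a * (1 - a)))).
    by apply: vgtB; apply: h => //; apply: veq_ge ea.
  transitivity (a ^+ 2 + 2 * t * a * (1 - a) - b ^+ 2 - 2 * t * a * (1 - a)); first by ring.
  by rewrite E; ring.
by rewrite (veq_gtE _ e); lra.
Qed.

(** The substitution [x -> 1 - x] in [a], [u] and [l] preserves the relation
    [l = a^2 + 2 u a (1 - a)] and moves residue 1 to residue 0. *)
Lemma Rset_disjoint_one a b : a != 1 -> rho i a = rho i b -> rho i b = Some 1 ->
  (v (a - 1)%R <= 1)%E -> v (a - b) = v (a - 1) -> Rset i a `&` Rset i b = set0.
Proof.
move=> a1 rab rb a1v vab; rewrite -subset0 => l [Ra Rb].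
have ib : vge b 0 by have [//|/rho_None] := boolP (0 <= v b)%E; rewrite rb.
have ia : vge a 0 by have [//|/rho_None] := boolP (0 <= v a)%E; rewrite rab rb.
have b1 : vgt (b - 1) 0 by apply/rho_eq; rewrite ?rb ?rho1.
have a1' : vgt (a - 1) 0 by apply/rho_eq; rewrite ?rab ?rb ?rho1.
move/(RsetP_int _ ia): Ra => [u [iu ua lE]].
move/(RsetP_int _ ib): Rb => [w [iw wb lE']].
have d0 : a - 1 != 0 by rewrite subr_eq0.
have [r er] := v_fin v2P d0.
have onesub x c : vge x 0 -> vgt (x ^+ 2 - c) 0 -> vgt (c - 1) 0 -> vgt (1 - x) 0.
  move=> ix h h'; rewrite -(vgtN v2P) opprB; apply: (vgt_sqB v2P v2_two) => //.
  by rewrite expr1n (_ : _ - 1 = x ^+ 2 - c + (c - 1)); [exact: vgtD|ring].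
apply: (@residue_zero_disjoint (1 - a) (1 - b) (1 - u) (1 - w) r).
- by rewrite -opprB; apply: (veqN v2P).
- by rewrite -lee_fin -er.
- rewrite (_ : _ - _ = - (a - b)); last by ring.
  by apply: (veqN v2P); rewrite /veq vab.
- exact: vge_onesub.
- exact: vge_onesub.
- exact: onesub ua a1'.
- exact: onesub wb b1.
transitivity (1 - l); first by rewrite lE; ring.
by rewrite lE'; ring.
Qed.

Lemma Rset_disjoint_zero a b : a != 0 -> rho i a = rho i b -> rho i b = Some 0 ->
  (v a <= 1)%E -> v (a - b) = v a -> Rset i a `&` Rset i b = set0.
Proof.
move=> a0 rab rb av vab; rewrite -subset0 => l [Ra Rb].
have ib : vge b 0 by have [//|/rho_None] := boolP (0 <= v b)%E; rewrite rb.
have ia : vge a 0 by have [//|/rho_None] := boolP (0 <= v a)%E; rewrite rab rb.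
have b1 : vgt b 0 by apply/rho_eq0.
have a1' : vgt a 0 by apply/rho_eq0; rewrite ?rab ?rb.
move/(RsetP_int _ ia): Ra => [u [iu ua lE]].
move/(RsetP_int _ ib): Rb => [w [iw wb lE']].
have [r er] := v_fin v2P a0.
have small x c : vgt (x ^+ 2 - c) 0 -> vgt c 0 -> vgt x 0.
  by move=> h h'; apply: (vgt_sq v2P); rewrite mul0r -[x ^+ 2](subrK c); apply: vgtD.
apply: (@residue_zero_disjoint a b u w r) => //.
- by rewrite -lee_fin -er.
- by rewrite /veq vab.
- exact: small ua a1'.
- exact: small wb b1.
by rewrite -lE.
Qed.

(** Clearing denominators gives [a^2 - b^2 = 2 u b^2 (a - 1) - 2 w a^2 (b - 1)]. With
    [v b = s <= r = v a], the left side has valuation [2 s]; the terms on the right exceed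
    [1 + 2 s + r] and [1 + 2 r + s], both at least [2 s] because [r >= - 1]. *)
Lemma Rset_disjoint_infty a b : a != 0 -> b != 0 -> rho i a = rho i b -> rho i b = None ->
  (- 1 <= v a)%E -> v (a - b) = v b -> Rset i a `&` Rset i b = set0.
Proof.
move=> a0 b0 rab rb av vab; rewrite -subset0 => l [Ra Rb].
have nb : ~~ (0 <= v b)%E by apply/rho_None.
have na : ~~ (0 <= v a)%E by apply/rho_None; rewrite rab.
have [r er r0] := nonint_veq na; have [s es s0] := nonint_veq nb.
have r1 : -1 <= r by rewrite -lee_fin -er.
have eab : veq (a - b) s by rewrite /veq vab.
have sr : s <= r.
  rewrite -(veq_geE _ er) -[a](subrK b); apply: vgeD; exact: veq_ge.
move/(RsetP_ninf _ na): Ra => [u [u0 du lE]].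
move/(RsetP_ninf _ nb): Rb => [w [w0 dw lE']].
have e : veq ((a - b) * (a - b + 2 * b)) (s + s).
  apply: (veqM eab _); apply: ((veqD v2P) _ _ _ eab _).
  by apply: vge_lt (vgeM ge2 (veq_ge es)) _; lra.
have h c d w' p q : veq c p -> veq d q -> p < 0 -> vgt w' 0 ->
    vgt (w' * (2 * (d ^+ 2 * (c - 1)))) (0 + (1 + (q *+ 2 + p))).
  move=> ec ed p0 w'0; apply: vgtM => //; apply: vgeM => //; apply: vgeM.
    exact: veq_ge (veqX v2P 2 ed).
  by apply: vgeB (veq_ge ec) _; apply: vge_le int1 _; lra.
have : vgt ((a - b) * (a - b + 2 * b)) (s + s).
  rewrite (_ : _ * _ = u * (2 * (b ^+ 2 * (a - 1))) - w * (2 * (a ^+ 2 * (b - 1)))).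
    apply: vgtB; [apply: vgt_le (h _ _ _ _ _ er es r0 u0) _|
      apply: vgt_le (h _ _ _ _ _ es er s0 w0) _]; rewrite mulr2n; lra.
  have : a ^+ 2 * (1 + 2 * (b - 1) * w) - b ^+ 2 * (1 + 2 * (a - 1) * u) = 0.
    move/eqP: lE'; rewrite lE -subr_eq0 => /eqP E.
    transitivity ((a ^+ 2 / (1 + 2 * (a - 1) * u) - b ^+ 2 / (1 + 2 * (b - 1) * w)) *
      ((1 + 2 * (b - 1) * w) * (1 + 2 * (a - 1) * u))); last by rewrite E mul0r.
    by field; rewrite du dw.
  move=> E; apply/eqP; rewrite -subr_eq0 -E; apply/eqP; ring.
by rewrite (veq_gtE _ e); lra.
Qed.

Lemma Rset_disjoint a b : a != 0 -> a != 1 -> b != 0 -> b != 1 ->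
  [\/ rho i a <> rho i b,
      [/\ rho i a = rho i b,
          rho i a <> Some 0, rho i a <> Some 1, rho i a <> None &
          (v2 i (a - b)%R <= (1 / 2)%R%:E)%E],
      [/\ rho i a = rho i b, rho i b = Some 1,
          (0 < v2 i (a - 1)%R)%E, (v2 i (a - 1)%R <= 1)%E &
          v2 i (a - b) = v2 i (a - 1)] |
      [/\ rho i a = rho i b, rho i b = Some 0,
          (v2 i a <= 1)%E & v2 i (a - b) = v2 i a] \/
      [/\ rho i a = rho i b, rho i b = None,
          (- 1 <= v2 i a)%E & v2 i (a - b) = v2 i b]] ->
  Rset i a `&` Rset i b = set0.
Proof.
move=> a0 a1 b0 b1 [|[e _ _ n h]|[e e1 _ h h']|[[e e0 h h']|[e e0 h h']]].
- exact: Rset_disjoint_rho.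
- exact: Rset_disjoint_generic.
- exact: Rset_disjoint_one.
- exact: Rset_disjoint_zero.
- exact: Rset_disjoint_infty.
Qed.

End TwoAdicQbar.

(** * Multiples of a torsion point, and abscissas of sums and differences *)

Section Multiples.
Variables (F : fieldType) (l : F).
Hypotheses (two_neq0 : 2 != 0 :> F) (l_neq0 : l != 0) (l_neq1 : l != 1).
Local Notation on := (on_curve l).

Lemma mul_mul m n (P : Defs.point F) : on P -> mul l m (mul l n P) = mul l (m * n) P.
Proof.
move=> cP; elim: m => [//|m IH].
by rewrite mulS IH mulSn (mulD two_neq0 l_neq0 l_neq1).
Qed.

Lemma mul_torsion n (P : Defs.point F) : on P -> torsion l P -> torsion l (mul l n P).
Proof.
move=> cP [m [m0 mO]]; exists m; split=> //.
rewrite -/(mul l m (mul l n P)) mul_mul // (mul_mod _ mO) modnMr; exact: erefl.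
Qed.

Lemma mul_neg n (P : Defs.point F) : on P -> torsion l P ->
  exists m, neg_point (mul l n P) = mul l m P.
Proof.
move=> cP [m [m0 mO]]; exists (m * n - n)%N; symmetry.
apply: (add_eq0 two_neq0 l_neq0 l_neq1); rewrite ?on_mul //.
rewrite -(mulD two_neq0 l_neq0 l_neq1) // subnKC ?leq_pmull //.
by rewrite (mul_mod _ mO) modnMr.
Qed.

(** The second product formula is the first one after [x -> 1 - x], [l -> 1 - l], which is a
    quadratic twist and so keeps the formulas for abscissas. *)
Lemma add_sub_x x1 y1 x2 y2 : on (Affine x1 y1) -> on (Affine x2 y2) -> x1 != x2 ->
  exists x3 y3 x4 y4,
  [/\ add_point l (Affine x1 y1) (Affine x2 y2) = Affine x3 y3,
      add_point l (Affine x1 y1) (neg_point (Affine x2 y2)) = Affine x4 y4,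
      x3 * x4 * (x1 - x2) ^+ 2 = (x1 * x2 - l) ^+ 2 &
      (x3 - 1) * (x4 - 1) * (x1 - x2) ^+ 2 = (x1 * x2 - x1 - x2 + l) ^+ 2].
Proof.
move=> /eqP c1 /eqP c2 x12; rewrite /= (negPf x12) /=.
have d : x2 - x1 != 0 by rewrite subr_eq0 eq_sym.
set s := (y2 - y1) / (x2 - x1); set s' := (- y2 - y1) / (x2 - x1).
do 4!eexists; split; first by [].
- by [].
- have e1 : s * (x2 - x1) = y2 - y1 by rewrite divfK.
  have e2 : s' * (x2 - x1) = - y2 - y1 by rewrite divfK.
  have S : (s ^+ 2 + s' ^+ 2) * (x1 - x2) ^+ 2 = 2 * (y1 ^+ 2 + y2 ^+ 2).
    transitivity ((s * (x2 - x1)) ^+ 2 + (s' * (x2 - x1)) ^+ 2); first by ring.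
    by rewrite e1 e2; ring.
  have M : s * s' * (x1 - x2) ^+ 2 = y1 ^+ 2 - y2 ^+ 2.
    transitivity ((s * (x2 - x1)) * (s' * (x2 - x1))); first by ring.
    by rewrite e1 e2; ring.
  apply: (mulIf (expf_neq0 2 d)).
  transitivity ((s * s' * (x1 - x2) ^+ 2) ^+ 2 + (1 + l - x1 - x2) *
    ((s ^+ 2 + s' ^+ 2) * (x1 - x2) ^+ 2) * (x1 - x2) ^+ 2 +
    (1 + l - x1 - x2) ^+ 2 * (x1 - x2) ^+ 4); first by ring.
  by rewrite S M c1 c2; ring.
- have e1 : s * (x2 - x1) = y2 - y1 by rewrite divfK.
  have e2 : s' * (x2 - x1) = - y2 - y1 by rewrite divfK.
  have S : (s ^+ 2 + s' ^+ 2) * (x1 - x2) ^+ 2 = 2 * (y1 ^+ 2 + y2 ^+ 2).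
    transitivity ((s * (x2 - x1)) ^+ 2 + (s' * (x2 - x1)) ^+ 2); first by ring.
    by rewrite e1 e2; ring.
  have M : s * s' * (x1 - x2) ^+ 2 = y1 ^+ 2 - y2 ^+ 2.
    transitivity ((s * (x2 - x1)) * (s' * (x2 - x1))); first by ring.
    by rewrite e1 e2; ring.
  apply: (mulIf (expf_neq0 2 d)).
  transitivity ((s * s' * (x1 - x2) ^+ 2) ^+ 2 + (l - x1 - x2) *
    ((s ^+ 2 + s' ^+ 2) * (x1 - x2) ^+ 2) * (x1 - x2) ^+ 2 +
    (l - x1 - x2) ^+ 2 * (x1 - x2) ^+ 4); first by ring.
  by rewrite S M c1 c2; ring.
Qed.

End Multiples.

(** * 2-adic separation of the multiples of a torsion point *)

Section Separation.
Variables (K : closedFieldType) (v : K -> \bar rat) (l : K).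
Hypotheses (vP : is_valuation v) (v2E : veq v 2 1) (l_neq0 : l != 0) (l_neq1 : l != 1).
Local Notation on := (on_curve l).
Local Notation vge := (vge v).
Local Notation vgt := (vgt v).
Local Notation veq := (veq v).
Let two_neq0 : 2 != 0 :> K. Proof. exact: v2_neq0 vP v2E. Qed.

Lemma torsion_shallow x y (s : rat) : on (Affine x y) -> torsion l (Affine x y) ->
  0 <= s -> vge l (- s) -> vge x (- s).
Proof.
move=> cP tP s0 ls.
have [//|[r er rs]] := vge_or vP x (- s).
have fin := torsion_finite_orbit two_neq0 l_neq0 l_neq1 cP tP.
case: (@deep_not_finite _ _ vP v2E l x 0%N r _ fin); split; first lra.
  exact: vge_lt ls rs.
by exists r, 0; split; [|exact: (veq1 vP)|rewrite subr0].
Qed.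

Lemma half_vge x r : vge (x ^+ 2) (r *+ 2) -> vge x r.
Proof.
have [//|[s es sr]] := vge_or vP x r.
by rewrite (veq_geE _ (veqX vP 2 es)) lerMn2r /= => rs; rewrite (veq_geE _ es).
Qed.

(** If [xm] and [xn] were that close, boundedness of the abscissas of sum and difference would force
    [xm^2] near [l] and [(xm - 1)^2] near [1 - l]. Adding these, [2 xm (xm - 1)] is small;
    multiplying them, so is [l (1 - l)], against [e + e' <= E]. *)
Lemma torsion_separated x y m n xm ym xn yn (s e e' E : rat) :
  on (Affine x y) -> torsion l (Affine x y) ->
  mul l m (Affine x y) = Affine xm ym -> mul l n (Affine x y) = Affine xn yn ->
  xm != xn -> 0 <= s -> vge l (- s) -> veq l e -> veq (1 - l) e' ->
  0 <= E -> e + e' <= E -> ~ vge (xm - xn) (3 * s + E + 3).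
Proof.
move=> cP tP Em En xmn s0 ls el el' E0 eE h.
(* One [s] is lost when taking square roots in [G1] and [G2], and two more when multiplying by
   [(xm - 1)^2]; the rest leaves slack for the division by 2 and for strictness. *)
set N := 3 * s + E + 3 in h.
have tors k z w : mul l k (Affine x y) = Affine z w -> vge z (- s).
  move=> Ek; have := mul_torsion two_neq0 l_neq0 l_neq1 k cP tP.
  have := on_mul two_neq0 l_neq0 l_neq1 k cP; rewrite Ek => c t.
  exact: torsion_shallow c t s0 ls.
have cm := on_mul two_neq0 l_neq0 l_neq1 m cP; rewrite Em in cm.
have cn := on_mul two_neq0 l_neq0 l_neq1 n cP; rewrite En in cn.
have [x3 [y3 [x4 [y4 [E3 E4 F1 F2]]]]] := add_sub_x cm cn xmn.
have h3 : vge x3 (- s).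
  by apply: (tors (m + n)%N x3 y3); rewrite (mulD two_neq0 l_neq0 l_neq1) // Em En.
have h4 : vge x4 (- s).
  have [k Ek] := mul_neg two_neq0 l_neq0 l_neq1 n cP tP.
  apply: (tors (m + k)%N x4 y4); rewrite (mulD two_neq0 l_neq0 l_neq1) // -Ek Em En.
  exact: E4.
have hm := tors _ _ _ Em; have hn := tors _ _ _ En.
have i1 : vge 1 (- s) by rewrite (veq_geE _ (veq1 vP)); lra.
have G1 : vge (xm * xn - l) (N - s).
  apply: half_vge; rewrite -F1.
  apply: vge_le (vgeM vP (vgeM vP h3 h4) (vgeM vP h h)) _; rewrite mulr2n; lra.
have G2 : vge (xm * xn - xm - xn + l) (N - s).
  apply: half_vge; rewrite -F2.
  apply: vge_le (vgeM vP (vgeM vP (vgeB vP h3 i1) (vgeB vP h4 i1)) (vgeM vP h h)) _.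
  rewrite mulr2n; lra.
have hd : vge (xn - xm) N by rewrite -opprB (vgeN vP).
have H1 : vge (xm ^+ 2 - l) (N - s).
  rewrite (_ : _ - _ = xm * xn - l + (xm - xn) * xm); last by ring.
  by apply: vgeD => //; apply: vgeM.
have H2 : vge ((xm - 1) ^+ 2 - (1 - l)) (N - s).
  rewrite (_ : _ - _ = (xm * xn - xm - xn + l) + (xm - xn) * (xm - 1)); last by ring.
  by apply: vgeD => //; apply: vgeM => //; apply: vgeB.
have H3 : vge (xm * (xm - 1)) (N - s - 1).
  have h12 : vge (2 * (xm * (xm - 1))) (N - s).
    rewrite (_ : _ * _ = (xm ^+ 2 - l) + ((xm - 1) ^+ 2 - (1 - l))); last by ring.
    exact: vgeD.
  have [//|[r er rN]] := vge_or vP (xm * (xm - 1)) (N - s - 1).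
  by move: h12; rewrite (veq_geE _ (veqM vP v2E er)); lra.
have : vgt (l * (1 - l)) E.
  rewrite (_ : _ * _ = (xm * (xm - 1)) ^+ 2 - (xm ^+ 2 - l) * (xm - 1) ^+ 2 -
    ((xm - 1) ^+ 2 - (1 - l)) * l); last by ring.
  apply: vgtB => //; first apply: vgtB => //.
  - by apply: vge_lt (vgeM vP H3 H3) _; rewrite /N; lra.
  - apply: vge_lt (vgeM vP H1 (vgeM vP (vgeB vP hm i1) (vgeB vP hm i1))) _.
    by rewrite /N; lra.
  - by apply: vge_lt (vgeM vP H2 ls) _; rewrite /N; lra.
by rewrite (veq_gtE _ (veqM vP el el')); lra.
Qed.

End Separation.

(** * Liouville bounds and the pigeonhole *)

Lemma fact_leq_exp m : (m`! <= m ^ m)%N.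
Proof.
have h k : (m ^_ k <= m ^ k)%N.
  by elim: k => // k IH; rewrite ffactnSr expnSr leq_mul ?leq_subr.
by rewrite -ffactnn.
Qed.

(** * Algebraic numbers acting by bounded integer matrices *)

Section Eigen.
Variables (K : fieldType) (T : finType) (w : T -> K) (t0 : T).
Hypothesis w0 : w t0 = 1.
Local Notation n := #|T|.

(* [x] acts on the span of [w] through an integer matrix with entries bounded
   by [E]. *)
Definition eig (E : nat) (x : K) := exists f : T -> T -> int,
  (forall p q, `|f p q| <= E%:Z) /\
  (forall q, \sum_p w p * (f p q)%:~R = x * w q).

Lemma n_gt0 : (0 < n)%N. Proof. by apply/card_gt0P; exists t0. Qed.

Lemma eig_le E E' x : (E <= E')%N -> eig E x -> eig E' x.
Proof.
by move=> EE [f [fE fw]]; exists f; split=> // p q; apply: le_trans (fE p q) _; rewrite lez_nat.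
Qed.

Lemma eig_int (z : int) E : `|z| <= E%:Z -> eig E z%:~R.
Proof.
move=> zE; exists (fun p q => if p == q then z else 0); split=> [p q|q].
  by case: ifP => // _; rewrite normr0.
rewrite (bigD1 q) //= eqxx big1 ?addr0 1?mulrC // => p /negPf->.
by rewrite mulr0.
Qed.

Lemma eigD E E' x y : eig E x -> eig E' y -> eig (E + E') (x + y).
Proof.
move=> [f [fE fw]] [g [gE gw]]; exists (fun p q => f p q + g p q); split=> [p q|q].
  by rewrite PoszD; apply: le_trans (ler_normD _ _) _; apply: lerD.
by rewrite mulrDl -fw -gw -big_split; apply: eq_bigr => p _; rewrite rmorphD mulrDr.
Qed.

Lemma eigM E E' x y : eig E x -> eig E' y -> eig (n * (E * E')) (x * y).
Proof.
move=> [f [fE fw]] [g [gE gw]]; exists (fun p q => \sum_r f p r * g r q); split=> [p q|q].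
  apply: le_trans (ler_norm_sum _ _ _) _.
  rewrite PoszM -[X in X * _]natz mulr_natl -sumr_const.
  by apply: ler_sum => r _; rewrite normrM PoszM; apply: ler_pM.
rewrite -mulrA -gw mulr_sumr; under [RHS]eq_bigr do rewrite mulrA -fw mulr_suml.
rewrite exchange_big /=; apply: eq_bigr => p _.
rewrite rmorph_sum mulr_sumr; apply: eq_bigr => r _.
by rewrite rmorphM mulrA.
Qed.

(** The length of [p], which is submultiplicative; bounding all partial sums keeps the size of [p]
    out of the estimates. *)
Definition norm1_le (p : {poly int}) (B : nat) :=
  forall m, \sum_(i < m) `|p`_i| <= B%:Z.

Lemma norm1_leD p q B C : norm1_le p B -> norm1_le q C -> norm1_le (p + q) (B + C).
Proof.
move=> pB qC m; rewrite PoszD; apply: le_trans (lerD (pB m) (qC m)).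
by rewrite -big_split; apply: ler_sum => i _; rewrite coefD ler_normD.
Qed.

Lemma norm1_le_sum (I : Type) (r : seq I) (P : pred I) p B :
  (forall i, P i -> norm1_le (p i) (B i)) ->
  norm1_le (\sum_(i <- r | P i) p i) (\sum_(i <- r | P i) B i)%N.
Proof.
move=> h; apply: (big_ind2 norm1_le) => // [m|*]; last exact: norm1_leD.
by rewrite big1 // => i _; rewrite coef0 normr0.
Qed.

Lemma norm1_leM p q B C : norm1_le p B -> norm1_le q C -> norm1_le (p * q) (B * C).
Proof.
move=> pB qC m; rewrite PoszM.
apply: le_trans (ler_pM _ _ (pB m) (qC m)); last first.
- exact: sumr_ge0.
- exact: sumr_ge0.
rewrite mulr_suml.
under [X in _ <= X]eq_bigr do rewrite mulr_sumr.
rewrite pair_big /=.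
apply: le_trans (_ : _ <= \sum_(i < m) \sum_(j : 'I_m * 'I_m | (j.1 + j.2 == i)%N)
   `|p`_j.1| * `|q`_j.2|) _.
  apply: ler_sum => i _; rewrite coefM; apply: le_trans (ler_norm_sum _ _ _) _.
  pose h (j : 'I_i.+1) : 'I_m * 'I_m :=
    (widen_ord (ltn_ord i) j, widen_ord (ltn_ord i) (rev_ord j)).
  rewrite [X in _ <= X](reindex_onto h (fun j => inord j.1)) /=; last first.
    move=> [j k] /= /eqP ji; congr pair; apply: val_inj => /=.
      by rewrite inordK // ltnS -ji leq_addr.
    by rewrite inordK ?subSS -ji ?addKn // ltnS leq_addr.
  rewrite le_eqVlt; apply/orP; left; apply/eqP.
  apply: eq_big => [j|j _]; last by rewrite normrM /= subSS.
  rewrite /= subSS subnKC ?eqxx /=; last by rewrite -ltnS.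
  by symmetry; apply/eqP; apply: val_inj; rewrite /= inordK.
rewrite (exchange_big_dep predT) //=.
apply: ler_sum => -[j k] _ /=.
have [jk|jk] := ltnP (j + k) m.
  by rewrite (big_pred1 (Ordinal jk)).
rewrite big_pred0 ?mulr_ge0 // => i; apply/negbTE.
by apply: contraTneq (ltn_ord i) => <-; rewrite -leqNgt.
Qed.

Lemma norm1_leN p B : norm1_le p B -> norm1_le (- p) B.
Proof.
by move=> h m; apply: le_trans (h m); apply: ler_sum => i _; rewrite coefN normrN.
Qed.

Lemma norm1_le_C (z : int) (B : nat) : `|z| <= B%:Z -> norm1_le z%:P B.
Proof.
move=> zB m; case: m => [|m]; first by rewrite big_ord0.
rewrite big_ord_recl coefC eqxx big1 ?addr0 // => i _.
by rewrite coefC /= normr0.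
Qed.

Lemma norm1_leX : norm1_le 'X 1.
Proof.
move=> m; case: m => [|[|m]]; rewrite ?big_ord0 //.
  by rewrite big_ord1 coefX normr0.
rewrite !big_ord_recl /= !coefX /= normr0 add0r normr1 big1 ?addr0 // => i _.
by rewrite coefX /= normr0.
Qed.

Lemma norm1_le_prod (I : finType) p B :
  (forall i : I, norm1_le (p i) B) -> norm1_le (\prod_i p i) (B ^ #|I|).
Proof.
move=> h; rewrite -prod_nat_const.
apply: (big_ind2 norm1_le) => //; last by move=> *; apply: norm1_leM.
by apply: norm1_le_C.
Qed.

(** Leibniz expansion: [n!] products of [n] entries [X - f] or [- f], each of length at most
    [E + 1]. *)
Definition charbound (E : nat) : nat := n`! * E.+1 ^ n.

(** [w] is a left eigenvector of the matrix for the eigenvalue [x], nonzero because [w t0 = 1]. *)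
Lemma eig_char E x : eig E x -> exists p : {poly int},
  [/\ p \is monic, root (map_poly intr p) x & norm1_le p (charbound E)].
Proof.
move=> [f [fE fw]].
pose F := \matrix_(i < n, j < n) f (enum_val i) (enum_val j).
exists (char_poly F); split; first exact: char_poly_monic.
- rewrite map_char_poly -eigenvalue_root_char; apply/eigenvalueP.
  exists (\row_i w (enum_val i)).
    apply/rowP => j; rewrite !mxE -fw (reindex _ (onW_bij _ (@enum_val_bij T))) /=.
    by apply: eq_bigr => k _; rewrite !mxE.
  apply/eqP => /rowP /(_ (enum_rank t0)); rewrite !mxE enum_rankK w0 => /eqP.
  by rewrite oner_eq0.
rewrite /char_poly /determinant.
have -> : charbound E = (\sum_(s : 'S_n) E.+1 ^ n)%N.
  by rewrite sum_nat_const card_Sn.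
apply: norm1_le_sum => s _.
rewrite -signr_odd; set P := \prod_i _.
have h : norm1_le P (E.+1 ^ n).
  rewrite -[n in X in norm1_le _ X]card_ord; apply: norm1_le_prod => i; rewrite !mxE.
  rewrite -add1n; apply: norm1_leD.
    case: eqP => _; [exact: norm1_leX|move=> m].
    by rewrite mulr0n big1 // => k _; rewrite coef0 normr0.
  by apply: norm1_leN; apply: norm1_le_C.
by case: (odd _); rewrite ?expr1 ?expr0 ?mul1r // mulN1r; apply: norm1_leN.
Qed.

(** The power of [X] dividing the characteristic polynomial can be removed when [x != 0]. The
    constant coefficient is then a nonzero integer, on which the lower bounds rest. *)
Lemma eig_char0 E x : eig E x -> x != 0 -> exists p : {poly int},
  [/\ p \is monic, p`_0 != 0, root (map_poly intr p) x & norm1_le p (charbound E)].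
Proof.
move=> /eig_char[p [pm px pB]] x0.
have p0 : p != 0 by apply: monic_neq0.
have ex : exists k, p`_k != 0 by exists (size p).-1; rewrite -lead_coefE (monicP pm).
case: (ex_minnP ex) => k pk kmin.
have take0 : take_poly k p = 0.
  apply/polyP => j; rewrite coef_take_poly coef0; case: ltnP => // jk.
  by apply/eqP; apply: contraTT jk => /kmin; rewrite -leqNgt.
have pE : p = drop_poly k p * 'X^k.
  by rewrite -{1}[p](poly_take_drop k) take0 add0r.
exists (drop_poly k p); split.
- by move: pm; rewrite {1}pE monicMr ?monicXn.
- by rewrite coef_drop_poly.
- move: px; rewrite {1}pE rmorphM /= map_polyXn rootM => /orP[//|].
  by rewrite rootE hornerXn expf_eq0 (negPf x0) andbF.
move=> m; apply: le_trans (pB (k + m)%N).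
rewrite big_split_ord /=.
under eq_bigr do rewrite coef_drop_poly addnC.
by rewrite lerDr sumr_ge0.
Qed.

Lemma eigZ E x (d : nat) : eig E x -> eig (d * E) (d%:R * x).
Proof.
move=> [f [fE fw]]; exists (fun p q => f p q *+ d); split=> [p q|q].
  by rewrite normrMn PoszM -[X in _ <= X * _]natz mulr_natl lerMn2r fE orbT.
rewrite -mulrA -fw mulr_sumr; apply: eq_bigr => p _.
by rewrite rmorphMn /= mulr_natl mulrnAr.
Qed.

(* [Y ^ s] bounds both a denominator of [x] and the matrix of the integral
   multiple of [x] that it defines. *)
Definition cx (Y s : nat) (x : K) :=
  exists2 d, (0 < d <= Y ^ s)%N & eig (Y ^ s) (d%:R * x).

Variable Y : nat.
Hypothesis YP : (2 * n <= Y)%N.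

Lemma Y_gt1 : (1 < Y)%N.
Proof. by apply: leq_trans YP; rewrite -[X in (X < _)%N]/(1%N) -{1}[2%N]muln1 leq_mul2l n_gt0. Qed.

Lemma expY_gt0 s : (0 < Y ^ s)%N. Proof. by rewrite expn_gt0 (ltnW Y_gt1). Qed.

Lemma cx_le s t x : (s <= t)%N -> cx Y s x -> cx Y t x.
Proof.
move=> st [d /andP[d0 dB] dx]; have le : (Y ^ s <= Y ^ t)%N by rewrite leq_pexp2l // (ltnW Y_gt1).
by exists d; [rewrite d0 (leq_trans dB)|apply: eig_le dx].
Qed.

Lemma cx_int (z : int) : `|z| <= Y%:Z -> cx Y 1 z%:~R.
Proof.
move=> zY; exists 1%N; first by rewrite expn1 (ltnW Y_gt1).
by rewrite mul1r expn1; apply: eig_int.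
Qed.

Lemma leq_expYD s t k : (k <= Y)%N -> (k * (Y ^ s * Y ^ t) <= Y ^ (s + t).+1)%N.
Proof. by move=> kY; rewrite expnS expnD leq_mul2r kY orbT. Qed.

(** The extra power of [Y] absorbs the factor [n] of [eigM]; in [cxD] it absorbs the factor 2 of a
    sum of two matrices. *)
Lemma cxM s t x y : cx Y s x -> cx Y t y -> cx Y (s + t).+1 (x * y).
Proof.
move=> [d /andP[d0 dB] dx] [e /andP[e0 eB] ey]; exists (d * e)%N.
  rewrite muln_gt0 d0 e0 /=; apply: leq_trans (@leq_expYD s t 1 (ltnW Y_gt1)).
  by rewrite mul1n leq_mul.
rewrite natrM mulrACA; apply: eig_le (eigM dx ey); apply: leq_expYD.
by apply: leq_trans YP; rewrite leq_pmull.
Qed.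

Lemma cxD s t x y : cx Y s x -> cx Y t y -> cx Y (s + t).+1 (x + y).
Proof.
move=> [d /andP[d0 dB] dx] [e /andP[e0 eB] ey]; exists (d * e)%N.
  rewrite muln_gt0 d0 e0 /=; apply: leq_trans (@leq_expYD s t 1 (ltnW Y_gt1)).
  by rewrite mul1n leq_mul.
rewrite (_ : _ * _ = e%:R * (d%:R * x) + d%:R * (e%:R * y)); last by rewrite natrM; ring.
apply: eig_le (eigD (eigZ e dx) (eigZ d ey)).
apply: leq_trans (@leq_expYD s t 2 Y_gt1).
rewrite mul2n -addnn; apply: leq_add; first by rewrite mulnC leq_mul.
by rewrite leq_mul.
Qed.

Lemma cxN s x : cx Y s x -> cx Y s (- x).
Proof.
move=> [d dB [f [fE fw]]]; exists d => //; exists (fun p q => - f p q); split=> [p q|q].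
  by rewrite normrN.
rewrite mulrN mulNr -fw -sumrN; apply: eq_bigr => p _.
by rewrite rmorphN mulrN.
Qed.

Variable Z : nat.
Hypothesis ZP : (Y ^ (3 * n) <= Z)%N.

(** [n! <= Y^n], [(Y^s + 1)^n <= Y^((s + 1) n)] and [n + (s + 1) n <= 3 n s] for [s > 0]: hence the
    exponent [3 * n] in the choice of [Z]. *)
Lemma charbound_Z s : (0 < s)%N -> (charbound (Y ^ s) <= Z ^ s)%N.
Proof.
move=> s0; apply: leq_trans (_ : (Y ^ (3 * n)) ^ s <= _)%N; last by rewrite leq_exp2r.
rewrite -expnM /charbound.
have h1 : (n`! <= Y ^ n)%N.
  apply: leq_trans (_ : n ^ n <= _)%N.
    exact: fact_leq_exp.
  by rewrite leq_exp2r ?n_gt0 //; apply: leq_trans YP; rewrite leq_pmull.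
have h2 : ((Y ^ s).+1 <= Y ^ s.+1)%N.
  rewrite expnS; have := Y_gt1; have := expY_gt0 s; nia.
apply: leq_trans (leq_mul h1 (_ : _ <= (Y ^ s.+1) ^ n)%N) _.
  by rewrite leq_exp2r ?n_gt0.
rewrite -expnM -expnD leq_pexp2l ?(ltnW Y_gt1) //; nia.
Qed.

Lemma expY_Z s : (Y ^ s.+1 <= Z ^ s.+1)%N.
Proof.
rewrite leq_exp2r //; apply: leq_trans ZP; rewrite -{1}[Y]expn1.
by rewrite leq_pexp2l ?(ltnW Y_gt1) // muln_gt0 n_gt0.
Qed.

(** * Archimedean bounds *)

Section Norm.
Variables (R : realType) (f : {rmorphism K -> R[i]}).
Import Normc.
Local Notation nrm x := (normc (f x)).

Lemma normc_int (z : int) : normc (z%:~R : R[i]) = `|z|%:~R.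
Proof.
have h (k : nat) : normc (k%:R : R[i]) = k%:R.
  by rewrite -(rmorph_nat (real_complex R)) /= expr0n addr0 sqrtr_sqr ger0_norm.
case: z => k; rewrite ?NegzE ?mulrNz ?normcN; rewrite h //.
Qed.

Lemma normc_nat (k : nat) : normc (k%:R : R[i]) = k%:R.
Proof. exact: (normc_int k). Qed.

Lemma normc_ge0 (x : R[i]) : 0 <= normc x.
Proof. by case: x => a b; rewrite sqrtr_ge0. Qed.

Lemma normc_one : normc (1 : R[i]) = 1. Proof. exact: (normc_nat 1). Qed.
Lemma normc_zero : normc (0 : R[i]) = 0. Proof. exact: (normc_nat 0). Qed.

Lemma normc_exp (x : R[i]) k : normc (x ^+ k) = normc x ^+ k.
Proof. by elim: k => [|k IH]; rewrite ?normc_one // !exprS normcM IH. Qed.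

Lemma le_normc_sum (I : Type) (r : seq I) (P : pred I) (F : I -> R[i]) :
  normc (\sum_(j <- r | P j) F j) <= \sum_(j <- r | P j) normc (F j).
Proof.
apply: (big_ind2 (fun x y => normc x <= y)) => //; first by rewrite normc_zero.
by move=> a b c d ab cd; apply: le_trans (le_normcD _ _) (lerD ab cd).
Qed.

(** The eigenvector relation is read at the index where the modulus of [w] is largest. *)
Lemma eig_upper E x : eig E x -> nrm x <= (n * E)%:R.
Proof.
move=> [g [gE gw]].
pose q := [arg max_(q > t0) nrm (w q)]%O.
have qmax p : nrm (w p) <= nrm (w q).
  by rewrite /q; case: arg_maxP => // r _ h; apply: h.
have wq : 1 <= nrm (w q) by have := qmax t0; rewrite w0 rmorph1 normc_one.
rewrite -(ler_pM2r (lt_le_trans ltr01 wq)) -normcM -rmorphM -gw rmorph_sum.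
apply: le_trans (le_normc_sum _ _ _) _.
apply: le_trans (_ : _ <= \sum_(p : T) E%:R * nrm (w q)) _; last first.
  by rewrite sumr_const natrM -mulrA -[X in X <= _]mulr_natl.
apply: ler_sum => p _; rewrite rmorphM normcM rmorph_int normc_int mulrC.
apply: ler_pM; rewrite ?normc_ge0 ?ler0z //.
by rewrite -[E%:R]/(E%:Z%:~R) ler_int.
Qed.

(** If [|x| < 1], the nonzero integer constant coefficient is [x] times a sum bounded by the length
    of [p]. *)
Lemma eig_lower E x : eig E x -> x != 0 -> 1 <= (charbound E)%:R * nrm x.
Proof.
move=> ex x0; have [p [pm p0 px pB]] := eig_char0 ex x0.
have c1 : (1 : R) <= (charbound E)%:R.
  by rewrite ler1n /charbound muln_gt0 fact_gt0 expn_gt0.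
have [x1|x1] := leP 1 (nrm x).
  by apply: le_trans x1 _; rewrite ler_peMl ?normc_ge0.
have p1 : (1 : R) <= `|p`_0|%:~R by rewrite -[1]/(1%:~R) ler_int -gtz0_ge1 normr_gt0.
apply: le_trans p1 _.
have e : (p`_0)%:~R = - \sum_(j < (size p).-1) (p`_j.+1)%:~R * f x ^+ j.+1.
  apply/eqP; rewrite -addr_eq0; move/rootP: px => /(congr1 f).
  rewrite /map_poly horner_poly rmorph0 rmorph_sum.
  have : (0 < size p)%N by rewrite size_poly_gt0 monic_neq0.
  case: (size p) => // m _; rewrite big_ord_recl /= expr0 mulr1 rmorph_int => e; apply/eqP;
    rewrite -[RHS]e.
  by congr (_ + _); apply: eq_bigr => j _; rewrite rmorphM rmorph_int rmorphXn.
rewrite -normc_int e normcN.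
apply: le_trans (le_normc_sum _ _ _) _.
apply: le_trans (_ : _ <= \sum_(j < (size p).-1) `|p`_j.+1|%:~R * nrm x) _.
  apply: ler_sum => j _; rewrite normcM normc_int ler_wpM2l ?ler0z // normc_exp exprS.
  by rewrite ler_piMr ?normc_ge0 // exprn_ile1 ?normc_ge0 // ltW.
rewrite -mulr_suml ler_wpM2r ?normc_ge0 //.
rewrite -rmorph_sum -[_%:R]/((charbound E)%:Z%:~R) ler_int.
apply: le_trans (pB (size p).-1.+1); rewrite big_ord_recl /= lerDr //.
Qed.

End Norm.

Definition eigs x := exists E, eig E x.

Lemma eigs_int (z : int) : eigs z%:~R.
Proof. by exists `|z|%N; apply: eig_int. Qed.
Lemma eigs_nat (k : nat) : eigs k%:R. Proof. exact: (eigs_int k). Qed.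
Lemma eigsD x y : eigs x -> eigs y -> eigs (x + y).
Proof. by move=> [E ex] [E' ey]; exists (E + E')%N; apply: eigD. Qed.
Lemma eigsM x y : eigs x -> eigs y -> eigs (x * y).
Proof. by move=> [E ex] [E' ey]; exists (n * (E * E'))%N; apply: eigM. Qed.
Lemma eigsX x k : eigs x -> eigs (x ^+ k).
Proof.
by move=> ex; elim: k => [|k IH]; [exact: (eigs_nat 1)|rewrite exprS; exact: eigsM].
Qed.
Lemma eigs_sum (I : Type) (r : seq I) (F : I -> K) :
  (forall j, eigs (F j)) -> eigs (\sum_(j <- r) F j).
Proof. by move=> h; apply: big_ind => //; [exact: (eigs_nat 0)|exact: eigsD]. Qed.

(** As [w t0 = 1], such an [x] lies in the rational span of [w]. These elements are closed under the
    field operations and replace the number field. *)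
Definition rat_span x := exists2 d, (0 < d)%N & eigs (d%:R * x).

Lemma eigs_rat_span x : eigs x -> rat_span x.
Proof. by move=> ex; exists 1%N => //; rewrite mul1r. Qed.

Lemma cx_rat_span s x : cx Y s x -> rat_span x.
Proof. by move=> [d /andP[d0 _] ex]; exists d => //; exists (Y ^ s)%N. Qed.

Lemma rat_spanM x y : rat_span x -> rat_span y -> rat_span (x * y).
Proof.
move=> [d d0 ex] [e e0 ey]; exists (d * e)%N; rewrite ?muln_gt0 ?d0 //.
by rewrite natrM mulrACA; apply: eigsM.
Qed.

Lemma rat_spanD x y : rat_span x -> rat_span y -> rat_span (x + y).
Proof.
move=> [d d0 ex] [e e0 ey]; exists (d * e)%N; rewrite ?muln_gt0 ?d0 //.
rewrite (_ : _ * _ = e%:R * (d%:R * x) + d%:R * (e%:R * y)); last by rewrite natrM; ring.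
by apply: eigsD; apply: eigsM => //; apply: eigs_nat.
Qed.

Lemma rat_spanN x : rat_span x -> rat_span (- x).
Proof. by move=> h; rewrite -mulN1r; apply: rat_spanM h; apply/eigs_rat_span/(eigs_int (-1)). Qed.

Lemma rat_spanX x k : rat_span x -> rat_span (x ^+ k).
Proof.
by move=> ex; elim: k => [|k IH]; [exact/eigs_rat_span/(eigs_nat 1)|rewrite exprS;
  exact: rat_spanM].
Qed.

(** Column [t0] of the matrix of [d x] gives integer coordinates of [d x] itself; [n + 1] such
    columns are dependent over the rationals, and denominators are cleared. *)
Lemma rat_span_dep (x : 'I_n.+1 -> K) : (forall j, rat_span (x j)) ->
  exists c : 'I_n.+1 -> int, (exists j, c j != 0) /\ \sum_j (c j)%:~R * x j = 0.
Proof.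
move=> xs.
have /choice[d dP] j : exists d, (0 < d)%N /\ eigs (d%:R * x j).
  by have [d d0 h] := xs j; exists d.
have /choice[f fP] j : exists f : T -> T -> int,
    forall q, \sum_p w p * (f p q)%:~R = (d j)%:R * x j * w q.
  by have [_ [E [f [_ h]]]] := dP j; exists f.
pose A := \matrix_(j < n.+1, k < n) ((f j (enum_val k) t0)%:~R : rat).
have kA : kermx A != 0.
  by rewrite -mxrank_eq0 mxrank_ker -lt0n subn_gt0 ltnS rank_leq_col.
have [u uA u0] : exists2 u : 'rV[rat]_n.+1, u *m A = 0 & u != 0.
  by have /rowV0Pn[u /sub_kermxP uA u0] := kA; exists u.
pose D := \prod_j denq (u 0 j).
have D0 : D != 0 by apply/prodf_neq0 => j _; rewrite denq_neq0.
have cP j : exists c : int, c%:~R = D%:~R * u 0 j.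
  exists ((\prod_(k | k != j) denq (u 0 k)) * numq (u 0 j)).
  have -> : D = denq (u 0 j) * \prod_(k | k != j) denq (u 0 k) by rewrite /D (bigD1 j).
  rewrite !rmorphM /=.
  have qE : u 0 j = (numq (u 0 j))%:~R / (denq (u 0 j))%:~R by rewrite divq_num_den.
  by rewrite [X in _ = _ * X]qE; field; rewrite intr_eq0 denq_neq0.
have [c cE] := choice cP.
exists (fun j => c j * (d j)%:Z); split.
  have /rV0Pn[j uj] := u0; exists j; rewrite mulf_neq0 //.
    by rewrite -(intr_eq0 rat) cE mulf_neq0 // intr_eq0.
  by have [] := dP j; case: (d j).
have ck (k : 'I_n) : \sum_j c j * f j (enum_val k) t0 = 0.
  apply/eqP; rewrite -(intr_eq0 rat) rmorph_sum; apply/eqP.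
  move/rowP: uA => /(_ k); rewrite !mxE => E.
  transitivity (D%:~R * \sum_j u 0 j * A j k); last by rewrite E mulr0.
  by rewrite mulr_sumr; apply: eq_bigr => j _; rewrite rmorphM /= cE mxE mulrA.
transitivity (\sum_j \sum_(k < n) w (enum_val k) * (c j * f j (enum_val k) t0)%:~R).
  apply: eq_bigr => j _.
  transitivity ((c j)%:~R * \sum_p w p * (f j p t0)%:~R).
    by rewrite fP w0 mulr1 rmorphM /= -mulrA.
  rewrite (reindex _ (onW_bij _ (@enum_val_bij T))) /= mulr_sumr; apply: eq_bigr => k _.
  by rewrite rmorphM /=; ring.
rewrite exchange_big big1 // => k _ /=.
by rewrite -mulr_sumr -rmorph_sum ck mulr0.
Qed.

(** * 2-adic bounds *)

Section Val.
Variable v : K -> \bar rat.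
Hypotheses (vP : is_valuation v) (v2E : veq v 2 1).
Local Notation vge := (vge v).
Local Notation vgt := (vgt v).
Local Notation veq := (veq v).

Lemma veq_nat k : (0 < k)%N -> exists r, [/\ veq k%:R r, 0 <= r & r <= k%:R].
Proof.
elim/ltn_ind: k => k IH k0; have [ok|ek] := boolP (odd k).
  by exists 0; split=> //; apply: veq_odd.
have kE : k = (2 * k./2)%N by rewrite mul2n -{1}(odd_double_half k) (negPf ek).
have h0 : (0 < k./2)%N by move: k0; rewrite {1}kE; case: (k./2).
have hk : (k./2 < k)%N by rewrite -divn2 ltn_Pdiv.
have [r [er r0 rk]] := IH k./2 hk h0.
exists (1 + r); split; last 1 first.
- have h1 : (1 : rat) <= (k./2)%:R by rewrite ler1n.
  by rewrite kE natrM; lra.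
- by rewrite kE natrM; apply: veqM.
- lra.
Qed.

Lemma natr_neq0 k : (0 < k)%N -> k%:R != 0 :> K.
Proof. by move=> /veq_nat[r [er _ _]]; apply: veq_neq0 er. Qed.

(** The characteristic polynomial, with nonzero constant coefficient, writes [1 / (d x)] as a
    polynomial in [d x] divided by an integer. *)
Lemma rat_spanV x : rat_span x -> rat_span x^-1.
Proof.
have [->|x0] := eqVneq x 0; first by rewrite invr0.
move=> [d d0 [E eg]]; set g := d%:R * x in eg.
have dn := natr_neq0 d0; have g0 : g != 0 by rewrite mulf_neq0.
have [p [pm p0 pg _]] := eig_char0 eg g0.
pose q := \sum_(j < (size p).-1) (p`_j.+1)%:~R * g ^+ j.
have e : (p`_0)%:~R = - (g * q).
  apply/eqP; rewrite -addr_eq0; move/rootP: pg; rewrite /map_poly horner_poly.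
  have : (0 < size p)%N by rewrite size_poly_gt0 monic_neq0.
  rewrite /q; case: (size p) => // m _; rewrite big_ord_recl /= expr0 mulr1 => e.
  apply/eqP; rewrite -[RHS]e mulr_sumr; congr (_ + _); apply: eq_bigr => j _.
  by rewrite mulrCA exprS.
have egs : eigs g by exists E.
have eq : eigs (d%:R * q).
  apply: eigsM; first exact: eigs_nat.
  by apply: eigs_sum => j; apply: eigsM; [exact: eigs_int|exact: eigsX].
exists (absz p`_0); first by rewrite absz_gt0.
rewrite -[_%:R]/((absz p`_0)%:Z%:~R) abszE normrEsign rmorphM /= e -mulrA.
apply: eigsM; first by rewrite rmorph_sign /=; case: (_ < _);
  [exact: (eigs_int (-1))|exact: (eigs_int 1)].
rewrite mulNr -mulN1r; apply: eigsM; first exact: (eigs_int (-1)).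
by rewrite (_ : _ * _ = d%:R * q) // /g; field.
Qed.

Lemma eig_integral E x : eig E x -> vge x 0.
Proof.
move=> /eig_char[p [pm px _]]; have [//|[r er r0]] := vge_or vP x 0.
have p0 : (0 < size p)%N by rewrite size_poly_gt0 monic_neq0.
have pE : p`_(size p).-1 = 1 by rewrite -lead_coefE (monicP pm).
have : vgt (x ^+ (size p).-1) (r *+ (size p).-1).
  move/rootP: px; rewrite /map_poly horner_poly.
  move: p0 pE; case: (size p) => // m _ /= pE; rewrite big_ord_recr /= pE mulr1z mul1r.
  move=> /eqP; rewrite addrC addr_eq0 => /eqP->; rewrite (vgtN vP).
  apply: (big_ind (fun y => vgt y (r *+ m))); [exact: (vgt0 vP)|by move=> *; apply: (vgtD vP)|].
  move=> j _; apply: vge_lt (vgeMr vP (vge_int vP _) (veq_ge (veqX vP j er))) _.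
  by rewrite -![r *+ _]mulr_natr ltr_nM2l // ltr_nat.
by rewrite (veq_gtE _ (veqX vP _ er)) ltxx.
Qed.

(** [x] divides the nonzero constant coefficient in the valuation ring, and the crude bound
    [v k <= k] for positive integers suffices. *)
Lemma eig_vupper E x r : eig E x -> veq x r -> 0 <= r /\ r <= (charbound E)%:R.
Proof.
move=> ex er; have ix := eig_integral ex; split; first by rewrite -(veq_geE _ er).
have [p [pm p0 px pB]] := eig_char0 ex (veq_neq0 vP er).
have q0 : (0 < absz (p`_0)%R)%N by rewrite absz_gt0.
have [s [es _ sk]] := veq_nat q0.
have es' : veq (p`_0)%:~R s.
  rewrite [p`_0]intEsign rmorphM /= rmorph_sign.
  case: (_ < _); first by rewrite expr1 mulN1r; apply: (veqN vP).
  by rewrite expr0 mul1r.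
apply: le_trans (_ : s <= _).
  rewrite -(veq_geE _ es').
  move/rootP: px; rewrite /map_poly horner_poly.
  have : (0 < size p)%N by rewrite size_poly_gt0 monic_neq0.
  case: (size p) => // m _; rewrite big_ord_recl /= expr0 mulr1 => /eqP.
  rewrite addr_eq0 => /eqP->; rewrite (vgeN vP).
  apply: (big_ind (fun y => vge y r)); [exact: (vge0 vP)|by move=> *; apply: (vgeD vP)|].
  move=> j _; rewrite exprS mulrCA -[r]addr0; apply: (vgeM vP); first exact: veq_ge.
  by apply: (vgeMr vP); [exact: vge_int|exact: vgeX].
apply: le_trans sk _; rewrite ler_nat.
have := pB 1%N; rewrite big_ord1 => h.
by rewrite -lez_nat abszE.
Qed.

End Val.

Lemma cx_upper (R : realType) (f : {rmorphism K -> R[i]}) s x : (0 < s)%N -> cx Y s x ->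
  Normc.normc (f x) <= Z%:R ^+ (2 * s).
Proof.
move=> s0 [d /andP[d0 dB] ex]; apply: le_trans (_ : _ <= Normc.normc (f (d%:R * x))) _.
  rewrite rmorphM Normc.normcM rmorph_nat normc_nat ler_peMl ?normc_ge0 ?ler1n //.
apply: le_trans (eig_upper f ex) _; rewrite -natrX ler_nat.
apply: leq_trans (_ : Y ^ s.+1 <= _)%N.
  by rewrite expnS leq_mul2r orbC (leq_trans _ YP) // leq_pmull.
apply: leq_trans (expY_Z s) _; rewrite leq_pexp2l //; last by lia.
by apply: leq_trans ZP; apply: expY_gt0.
Qed.

(** One factor [Z^s] pays for the denominator of [x], the other for [charbound]. *)
Lemma cx_lower (R : realType) (f : {rmorphism K -> R[i]}) s x : (0 < s)%N -> cx Y s x ->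
  x != 0 -> 1 <= Z%:R ^+ (2 * s) * Normc.normc (f x).
Proof.
move=> s0 [d /andP[d0 dB] ex] x0.
have dx0 : d%:R * x != 0.
  by rewrite mulf_neq0 // -(fmorph_eq0 f) rmorph_nat pnatr_eq0 -lt0n.
have := eig_lower f ex dx0; rewrite rmorphM rmorph_nat Normc.normcM normc_nat mulrA => h.
apply: le_trans h _; apply: ler_wpM2r; first exact: normc_ge0.
rewrite -natrM -natrX ler_nat mul2n -addnn expnD leq_mul ?charbound_Z //.
apply: leq_trans dB _; case: s s0 {ex} => // s _; exact: expY_Z.
Qed.

Lemma cx_val v s x r : is_valuation v -> veq v 2 1 -> (0 < s)%N -> cx Y s x -> veq v x r ->
  - Z%:R ^+ s <= r /\ r <= Z%:R ^+ s.
Proof.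
move=> vP v2E s0 [d /andP[d0 dB] ex] er.
have [e [ee e0 ed]] := veq_nat vP v2E d0.
have [h1 h2] := eig_vupper vP v2E ex (veqM vP ee er).
have c : (charbound (Y ^ s))%:R <= Z%:R ^+ s :> rat by rewrite -natrX ler_nat charbound_Z.
have : (d%:R : rat) <= Z%:R ^+ s.
  rewrite -natrX ler_nat; apply: leq_trans dB _; case: s s0 {ex h2 c} => // s _; exact: expY_Z.
by move=> *; split; lra.
Qed.

End Eigen.

(** * Pigeonhole modulo powers of 2 *)

Section Pigeonhole.
Variables (K : fieldType) (v : K -> \bar rat) (vP : is_valuation v) (v2E : veq v 2 1).
Variables (T : finType) (w : T -> K) (t0 : T).
Hypothesis w0 : w t0 = 1.
Local Notation n := #|T|.
Local Notation vge := (vge v).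

Definition latt x := rat_span w x /\ vge x 0.

Lemma modz2 z : (z %% 2)%Z = 0 \/ (z %% 2)%Z = 1.
Proof. by have h : (2%Z != 0 :> int) by []; have := modz_ge0 z h;
  have := ltz_pmod z (isT : (0 < 2%Z :> int)); lia. Qed.

(** As long as all coefficients are even the relation can be halved, and the sum of their absolute
    values drops. *)
Lemma odd_relation m (x : 'I_m -> K) (c : 'I_m -> int) :
  (exists j, c j != 0) -> \sum_j (c j)%:~R * x j = 0 ->
  exists c' : 'I_m -> int, (exists j, (c' j %% 2)%Z = 1) /\ \sum_j (c' j)%:~R * x j = 0.
Proof.
have [N] := ubnP (\sum_j `|c j|)%N; elim: N c => // N IH c cN [j0 cj0] c0.
have [[j cj]|nodd] := pselect (exists j, (c j %% 2)%Z = 1); first by exists c; split=> //; exists j.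
have even j : c j = (c j %/ 2)%Z * 2.
  rewrite {1}(divz_eq (c j) 2); case: (modz2 (c j)) => [->|e]; first by rewrite addr0.
  by case: nodd; exists j.
apply: (IH (fun j => (c j %/ 2)%Z)).
- rewrite -ltnS; apply: leq_trans cN; rewrite ltnS.
  rewrite (bigD1 j0) //= [X in (_ < X)%N](bigD1 j0) //= -addSn leq_add //.
    by move: (even j0) cj0; move: (c j0) (c j0 %/ 2)%Z => z q -> /eqP; lia.
  apply: leq_sum => j _; move: (even j); move: (c j) (c j %/ 2)%Z => z q ->; lia.
- by exists j0; apply: contraNneq cj0 => h; rewrite even h mul0r.
apply: (mulIf (v2_neq0 vP v2E)); rewrite mul0r -[RHS]c0 mulr_suml.
by apply: eq_bigr => j _; rewrite [in RHS]even rmorphM /=; ring.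
Qed.

(** An odd relation among [n + 1] elements reduced modulo 2; signs and even parts only contribute
    multiples of 2. *)
Lemma latt_dep (h : nat -> K) : (forall j, latt (h j)) ->
  exists b : nat -> bool, (exists2 j, (j < n.+1)%N & b j) /\
    vge (\sum_(j < n.+1 | b j) h j) 1.
Proof.
move=> hH; have [c [cn c0]] := rat_span_dep w0 (fun j : 'I_n.+1 => (hH j).1).
have [c' [[j cj] c'0]] := odd_relation cn c0.
exists (fun k => (c' (inord k) %% 2)%Z == 1); split.
  by exists j => //; rewrite inord_val cj.
rewrite (_ : \sum_(_ < _ | _) _ = - (2 * \sum_j (c' j %/ 2)%Z%:~R * h j)).
  rewrite (vgeN vP) -[X in vge _ X]addr0; apply: (vgeM vP); first exact: veq_ge.
  apply: (big_ind (fun y => vge y 0)); first exact: (vge0 vP).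
    by move=> *; apply: (vgeD vP).
  by move=> k _; apply: (vgeMr vP); [exact: vge_int|exact: (hH k).2].
apply/eqP; rewrite -addr_eq0; apply/eqP; rewrite -[RHS]c'0 mulr_sumr big_mkcond -big_split /=.
apply: eq_bigr => k _; rewrite inord_val [in RHS](divz_eq (c' k) 2).
case: (modz2 (c' k)) => -> /=; first by rewrite addr0 rmorphM /=; ring.
by rewrite rmorphD rmorphM /=; ring.
Qed.

(** [latt] modulo 2 is a vector space over the field with two elements, of dimension at most [n];
    [h] is a maximal independent family. The lattice need not be finitely generated over the
    integers, so no integral basis is used. *)
Lemma latt_reps : exists r (h : nat -> K), [/\ (r <= n)%N, forall j, latt (h j) &
  forall x, latt x -> exists b : nat -> bool, vge (x - \sum_(j < r | b j) h j) 1].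
Proof.
have l0 : latt 0 by split; [exact/eigs_rat_span/(eigs_nat _ 0)|exact: (vge0 vP)].
(* Either fewer than [k] elements already represent everything, or there are [k] independent ones,
   which [latt_dep] excludes for [k = n + 1]. *)
suff H k : (exists r (h : nat -> K), [/\ (r < k)%N, forall j, latt (h j) &
  forall x, latt x -> exists b : nat -> bool, vge (x - \sum_(j < r | b j) h j) 1]) \/
  (exists h : nat -> K, (forall j, latt (h j)) /\
    forall b : nat -> bool, (exists2 j, (j < k)%N & b j) -> ~ vge (\sum_(j < k | b j) h j) 1).
  have [//|[h [hH hb]]] := H n.+1.
  by have [b [bj bv]] := latt_dep hH; case: (hb b bj).
elim: k => [|k [[r [h [rk hH hr]]]|[h [hH hb]]]].
- by right; exists (fun=> 0); split=> // b [].
- by left; exists r, h; split=> //; apply: ltnW.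
have [all|/existsNP[x /not_implyP[xH nx]]] :=
  pselect (forall x, latt x -> exists b : nat -> bool, vge (x - \sum_(j < k | b j) h j) 1).
  by left; exists k, h.
right; exists (fun j => if (j < k)%N then h j else x); split=> [j|b [j jk bj] bv].
  by case: ifP.
have E : \sum_(j < k.+1 | b j) (if (j < k)%N then h j else x) =
   \sum_(j < k | b j) h j + (if b k then x else 0).
  rewrite big_mkcond big_ord_recr /= ltnn -big_mkcond /=; congr (_ + _).
  by apply: eq_bigr => -[m mk] _ /=; rewrite mk.
rewrite E in bv; case bk : (b k) bv => bv; last first.
  apply: (hb b); last by rewrite addr0 in bv.
  exists j => //; move: jk; rewrite ltnS leq_eqVlt => /orP[/eqP e|//].
  by rewrite e bk in bj.
apply: nx; exists b.
rewrite (_ : _ - _ = (\sum_(j < k | b j) h j + x) - 2 * \sum_(j < k | b j) h j); last by ring.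
apply: (vgeB vP) => //; rewrite -[X in vge _ X]addr0; apply: (vgeM vP); first exact: veq_ge.
apply: (big_ind (fun y => vge y 0)); first exact: (vge0 vP).
  by move=> *; apply: (vgeD vP).
by move=> m _; exact: (hH m).2.
Qed.

Lemma latt_half x y : latt x -> latt y -> vge (x - y) 1 -> latt ((x - y) / 2).
Proof.
move=> [sx _] [sy _] h; split.
  apply: rat_spanM; first by apply: rat_spanD => //; apply: rat_spanN.
  by apply: (rat_spanV w0 vP v2E); apply/eigs_rat_span/(eigs_nat _ 2).
by have := vgeM vP h (veq_ge (veqV vP v2E)); rewrite subrr.
Qed.

(** More than [2^(n N)] of the elements share one of the at most [2^n] classes modulo 2; subtracting
    its representative and halving lowers the exponent by 1. *)
Lemma latt_pigeonhole N (J : finType) (x : J -> K) : (2 ^ (n * N) < #|J|)%N ->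
  (forall j, latt (x j)) -> exists j k, j != k /\ vge (x j - x k) N%:R.
Proof.
elim: N J x => [|N IH] J x; rewrite ?muln0 ?expn0 => Jn xH.
  have /card_gt1P[j [k [_ _ jk]]] := Jn; exists j, k; split=> //.
  by apply: (vgeB vP); have [] := (xH j, xH k) => -[? ?] [].
have [r [h [rn hH hr]]] := latt_reps.
have /choice[b bP] j := hr _ (xH j).
pose g j : {ffun 'I_r -> bool} := [ffun k : 'I_r => b j k].
have [t tP] : exists t, (2 ^ (n * N) < #|[pred j | g j == t]|)%N.
  apply/not_existsP => H; move: Jn; apply/negP; rewrite -leqNgt.
  rewrite -sum1_card (partition_big g predT) //=.
  apply: leq_trans (_ : \sum_(t : {ffun 'I_r -> bool}) 2 ^ (n * N) <= _)%N.
    by apply: leq_sum => t _; rewrite sum1_card leqNgt; apply/negP/H.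
  rewrite sum_nat_const card_ffun card_bool card_ord -expnD leq_pexp2l //.
  by rewrite mulnS leq_add2r.
pose S := \sum_(k < r | t k) h k.
have SE j : g j = t -> \sum_(k < r | b j k) h k = S.
  by move=> gt; rewrite /S -gt; apply: eq_bigl => k; rewrite ffunE.
have latS : latt S.
  apply: (big_ind latt) => //; first by split;
    [exact/eigs_rat_span/(eigs_nat _ 0)|exact: (vge0 vP)].
  by move=> ? ? [? ?] [? ?]; split; [exact: rat_spanD|exact: (vgeD vP)].
have [||j [k [jk hjk]]] := IH {j | g j == t} (fun j => (x (val j) - S) / 2).
- by rewrite card_sig.
- move=> [j /= /eqP gj]; apply: latt_half => //; by rewrite -(SE j gj).
exists (val j), (val k); split=> //.
have := vgeM vP (veq_ge v2E) hjk; rewrite -mulrBl mulrC divfK ?(v2_neq0 vP v2E) //.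
by rewrite opprB addrA subrK -[1]/(1%:R) -natrD add1n.
Qed.

End Pigeonhole.

(** * A bound for the first repetition in a finite orbit *)

Section OrbitRepeats.
Variables (R : realType) (L : Q2closure) (i : {rmorphism Qbar R -> Q2bar L}).
Variables (T : finType) (w : T -> Qbar R) (t0 : T).
Hypothesis w0 : w t0 = 1.
Local Notation n := #|T|.
Local Notation v := (v2 i).

Lemma vbar_two : veq (@vbar L) 2 1.
Proof. by have := Q2_val2 (Q2P L); rewrite /veq rmorph_nat. Qed.

Lemma sqrt_exists (F : closedFieldType) (c : F) : exists y, y ^+ 2 = c.
Proof.
have [y yE] := @solve_monicpoly F 2 (fun k => if k == 0%N then c else 0) isT.
by exists y; rewrite yE !big_ord_recl big_ord0 /= expr0 mulr1 mul0r !addr0.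
Qed.

(** The exponent [6 B + 3] is [B], for multiplying the abscissas by [2^B] to make them integral,
    plus the separation bound [3 s + E + 3] with [s = B] and [E = 2 B]. *)
Lemma orbit_repeats (l a : Qbar R) (B : nat) (e e' : rat) :
  l != 0 -> l != 1 -> finite_orbit l a -> rat_span w l -> rat_span w a ->
  veq v l e -> veq v (1 - l) e' -> - B%:R <= e -> e <= B%:R -> e' <= B%:R ->
  exists j k, (j < k <= (2 ^ (n * (6 * B + 3))).+1)%N /\
    cross (orbx l a j) (orbx l a k) = 0.
Proof.
move=> l0 l1 fin sl sa el el' Be eB e'B.
set M := (2 ^ _).+1%N; apply/not_existsP => no.
have {}no j k : (j < k <= M)%N -> cross (orbx l a j) (orbx l a k) <> 0.
  by move=> jk c; apply: (no j); exists k.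
pose N j := (orbx l a j).1; pose D j := (orbx l a j).2.
(* A zero denominator persists under doubling, so it would give a repetition at [j] and [j + 1]. *)
have D0 j : (j < M)%N -> D j != 0.
  move=> jM; apply: contra_notN (no j j.+1 _); last by rewrite ltnSn.
  rewrite /D => /eqP d0; rewrite /cross /orbx iterS -/(orbx l a j) /dbl /= d0.
  by rewrite !(mulr0, mul0r) subrr.
pose x j := N j / D j.
have two0 : 2 != 0 :> Q2bar L := v2_neq0 (vbarP L) vbar_two.
have il0 : i l != 0 by rewrite fmorph_eq0.
have il1 : i l != 1 by rewrite fmorph_eq1.
have [y yE] := sqrt_exists (i a * (i a - 1) * (i a - i l)).
have cP : on_curve (i l) (Affine (i a) y) by apply/eqP.
have tP : torsion (i l) (Affine (i a) y).
  by apply: finite_orbit_torsion => //; apply/(finite_orbit_map _ _ (fmorph_inj i)).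
have pt j : (j < M)%N -> exists z, mul (i l) (2 ^ j) (Affine (i a) y) = Affine (i (x j)) z.
  move=> jM; have := rep_orb two0 il0 il1 j cP; rewrite -map_orb /rep /=.
  case: (mul _ _ _) => [[d _]|X z [d E]].
    by have := D0 j jM; rewrite -(fmorph_eq0 i) /D d eqxx.
  by exists z; rewrite /x fmorph_div /N E mulfK.
have B0 : 0 <= B%:R :> rat by [].
have lB : vge (@vbar L) (i l) (- B%:R) by rewrite /vge -[vbar _]/(v2 i l) el lee_fin.
have sh j : (j < M)%N -> vge v (x j) (- B%:R).
  move=> jM; have [z E] := pt j jM.
  have := mul_torsion two0 il0 il1 (2 ^ j) cP tP.
  have := on_mul two0 il0 il1 (2 ^ j) cP; rewrite E => c t.
  exact: (torsion_shallow (vbarP L) vbar_two il0 il1 c t B0 lB).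
have v2P := v2P i; have v2E := v2_two i.
have sx j : rat_span w (x j).
  have : rat_span w (N j) /\ rat_span w (D j).
    rewrite /N /D; elim: j => [|j [IH1 IH2]].
      by split=> //; exact/eigs_rat_span/(eigs_nat _ 1).
    rewrite /orbx iterS -/(orbx l a j) /dbl /=.
    have sB x1 x2 : rat_span w x1 -> rat_span w x2 -> rat_span w (x1 - x2).
      by move=> h1 h2; apply: rat_spanD => //; apply: rat_spanN.
    split; first by apply: rat_spanX; apply: sB; [|apply: rat_spanM => //]; apply: rat_spanX.
    apply: rat_spanM; last by apply: sB => //; apply: rat_spanM.
    apply: rat_spanM; last exact: sB.
    by do 2!apply: rat_spanM => //; exact/eigs_rat_span/(eigs_nat _ 4).
  by case=> sN sD; apply: rat_spanM => //; apply: (rat_spanV w0 v2P v2E).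
pose f (j : 'I_M) := 2 ^+ B * x j.
have vB : veq v (2 ^+ B) B%:R by have := veqX v2P B v2E.
have fH j : latt v w (f j).
  split; first by apply: rat_spanM => //; exact/rat_spanX/eigs_rat_span/(eigs_nat _ 2).
  by have := vgeM v2P (veq_ge vB) (sh j (ltn_ord j)); rewrite subrr.
have [|j [k [jk h]]] := latt_pigeonhole v2P v2E w0 (N := 6 * B + 3) _ fH.
  by rewrite card_ord.
have {}h : vge v (x j - x k) (3 * B%:R + 2 * B%:R + 3).
  have := vgeM v2P (veq_ge (veqV v2P vB)) h.
  rewrite /f -mulrBr mulrA mulVf ?mul1r ?expf_neq0 ?(v2_neq0 v2P v2E) // => h'.
  by apply: vge_le h' _; rewrite natrD natrM; lra.
have [z1 E1] := pt j (ltn_ord j); have [z2 E2] := pt k (ltn_ord k).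
apply: (torsion_separated (E := 2 * B%:R) (vbarP L) vbar_two il0 il1 cP tP E1 E2 _ B0 lB el).
- rewrite (inj_eq (fmorph_inj i)); apply/eqP => xE.
  have c0 : cross (orbx l a j) (orbx l a k) = 0.
    rewrite /cross -/(N j) -/(D k) -/(N k) -/(D j).
    have -> : N j = x j * D j by rewrite divfK ?D0.
    have -> : N k = x k * D k by rewrite divfK ?D0.
    by rewrite xE; ring.
  case: (ltngtP j k) => [lt|gt|/val_inj e1]; last by rewrite e1 eqxx in jk.
    by apply: (no j k) c0; rewrite lt ltnW.
  by apply: (no k j); rewrite ?gt ?(ltnW (ltn_ord j)) // -[LHS]opprK /cross opprB -/(cross _ _)
    c0 oppr0.
- by move: el'; rewrite /veq /v2 rmorphB rmorph1; apply.
- exact: (mulr_ge0 _ B0).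
- lra.
by move: h; rewrite /vge /v2 rmorphB.
Qed.

End OrbitRepeats.

(** * The span of the monomials in two algebraic numbers *)

Section Monomials.
Variable K : fieldType.

Lemma eigN (T : finType) (w : T -> K) E x : eig w E x -> eig w E (- x).
Proof.
move=> [f [fE fw]]; exists (fun p q => - f p q); split=> [p q|q]; first by rewrite normrN.
rewrite mulNr -fw -sumrN; apply: eq_bigr => p _.
by rewrite rmorphN mulrN.
Qed.

(** The companion matrix of [p], multiplied by the leading coefficient to stay integral, acting on
    the first index only. *)
Lemma eig_companion (J : finType) (u : J -> K) (p : {poly int}) (a : K) (E : nat) :
  root (map_poly intr p) a -> (forall k, `|p`_k| <= E%:Z) ->
  eig (fun t : 'I_(size p).-1 * J => a ^+ t.1 * u t.2) E ((lead_coef p)%:~R * a).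
Proof.
set d := (size p).-1 => pa pE.
exists (fun s t : 'I_d * J => if s.2 == t.2 then
    if (t.1.+1 < d)%N then (if s.1 == t.1.+1 :> nat then lead_coef p else 0) else - p`_s.1
  else 0); split=> [[i j] [k m]|[k m]] /=.
  by case: ifP => _; rewrite ?normr0 //; case: ifP => _; rewrite ?normrN //;
    case: ifP; rewrite ?normr0 // lead_coefE.
rewrite -(pair_bigA _ (fun i j => a ^+ nat_of_ord i * u j * (if j == m then
  if (k.+1 < d)%N then (if i == k.+1 :> nat then lead_coef p else 0) else - p`_i
  else 0)%:~R)) /=.
transitivity (\sum_(i < d) a ^+ i * u m * (if (k.+1 < d)%N then
   (if i == k.+1 :> nat then lead_coef p else 0) else - p`_i)%:~R).
  apply: eq_bigr => i _; rewrite (bigD1 m) //= eqxx big1 ?addr0 // => j /negPf->.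
  by rewrite mulr0.
have [kd|dk] := ltnP k.+1 d.
  rewrite (bigD1 (Ordinal kd)) //= eqxx big1 ?addr0; last first.
    by move=> i; rewrite -val_eqE /= => /negPf->; rewrite mulr0.
  by rewrite exprS; ring.
have dE : d = k.+1 by apply/eqP; rewrite eqn_leq dk ltn_ord.
have spE : size p = d.+1.
  by have h : (size p).-1 = k.+1 := dE; rewrite dE; lia.
move/rootP: pa; rewrite /map_poly horner_poly spE big_ord_recr /= => e.
have lE : lead_coef p = p`_d by rewrite lead_coefE.
rewrite lE mulrA -[_ * a * _]mulrA -exprS -dE.
have -> : (p`_d)%:~R * a ^+ d = - \sum_(i < d) (p`_i)%:~R * a ^+ i.
  by apply/eqP; rewrite -addr_eq0 addrC e.
rewrite mulNr mulr_suml -sumrN; apply: eq_bigr => i _.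
by rewrite rmorphN /=; ring.
Qed.

Lemma eig_swap (I J : finType) (w : I * J -> K) E x :
  eig (fun t : J * I => w (t.2, t.1)) E x -> eig w E x.
Proof.
move=> [f [fE fw]]; exists (fun p q => f (p.2, p.1) (q.2, q.1)); split=> // -[i j].
rewrite -[RHS](fw (j, i)) (reindex (fun t : J * I => (t.2, t.1))) /=; last first.
  by exists (fun t => (t.2, t.1)) => -[].
by apply: eq_bigr => -[].
Qed.

Lemma eig_ext (T : finType) (w w' : T -> K) E x : w =1 w' -> eig w E x -> eig w' E x.
Proof.
move=> ww [f [fE fw]]; exists f; split=> // q; rewrite -ww -fw.
by apply: eq_bigr => p _; rewrite ww.
Qed.

Lemma cx_companion (T : finType) (w : T -> K) (E Y : nat) (c : int) a :
  (0 < Y)%N -> c != 0 -> `|c| <= E%:Z -> (E <= Y)%N -> eig w E (c%:~R * a) -> cx w Y 1 a.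
Proof.
move=> Y0 c0 cE EY h; exists (absz c).
  by rewrite absz_gt0 c0 expn1 (leq_trans _ EY) // -lez_nat abszE.
rewrite expn1; apply: (@eig_le _ _ _ E) => //.
have : eig w E (`|c|%:~R * a); last by rewrite -abszE.
by case: (ger0P c) => _ //; rewrite rmorphN mulNr; apply: eigN.
Qed.

Variables (p q : {poly int}) (a b : K) (E Y : nat).
Hypotheses (p0 : p != 0) (q0 : q != 0).
Hypotheses (pa : root (map_poly intr p) a) (qb : root (map_poly intr q) b).
Hypotheses (pE : forall k, `|p`_k| <= E%:Z) (qE : forall k, `|q`_k| <= E%:Z).
Hypotheses (Y0 : (0 < Y)%N) (EY : (E <= Y)%N).

Definition monomial_ix := ('I_(size p).-1 * 'I_(size q).-1)%type.
Definition monomial (t : monomial_ix) := a ^+ t.1 * b ^+ t.2.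

Lemma cx_monomial_l : cx monomial Y 1 a.
Proof.
apply: (cx_companion (E := E) (c := lead_coef p)) => //; rewrite ?lead_coef_eq0 ?lead_coefE //.
exact: (@eig_companion _ (fun j : 'I_(size q).-1 => b ^+ j)).
Qed.

Lemma cx_monomial_r : cx monomial Y 1 b.
Proof.
apply: (cx_companion (E := E) (c := lead_coef q)) => //; rewrite ?lead_coef_eq0 ?lead_coefE //.
apply: eig_swap; apply: eig_ext (@eig_companion _ (fun j : 'I_(size p).-1 => a ^+ j) _ _ _ qb qE).
by move=> t; rewrite /monomial mulrC.
Qed.

End Monomials.

(** * The program *)

Notation ldec := CodeSeq.decode.
Create HintDb cmp.

Section Programs.
Local Open Scope nat_scope.

(* Below, [xs] is the list of arguments of a program; under the step function of
   a recursion the bound variables are pushed in front of it. *)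
Definition cmp (m : nat) (F : seq nat -> nat) :=
  exists r, forall xs, size xs = m -> eval r xs (F xs).

Lemma evals_proj xs : evals [seq Proj k | k <- iota 0 (size xs)] xs xs.
Proof.
have h s : evals [seq Proj k | k <- s] xs [seq nth 0 xs k | k <- s].
  by elim: s => [|k s IH]; constructor=> //; constructor.
by have e := mkseq_nth 0 xs; have := h (iota 0 (size xs)); rewrite [X in evals _ _ X]e.
Qed.

Lemma evals_proj_behead y ys : evals [seq Proj k | k <- iota 1 (size ys)] (y :: ys) ys.
Proof.
have h s : evals [seq Proj k | k <- s] (y :: ys) [seq nth 0 (y :: ys) k | k <- s].
  by elim: s => [|k s IH]; constructor=> //; constructor.
have := h (iota 1 (size ys)); rewrite [X in evals _ _ X](_ : _ = ys) //.
by rewrite (iotaDl 1 0) -map_comp -[RHS](mkseq_nth 0 ys).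
Qed.

Lemma cmp_ext m F G : (forall xs, size xs = m -> F xs = G xs) -> cmp m F -> cmp m G.
Proof. by move=> e [r h]; exists r => xs xm; rewrite -e //; apply: h. Qed.

Lemma cmp_var m k : cmp m (fun xs => nth 0 xs k).
Proof. by exists (Proj k) => xs _; constructor. Qed.

Lemma cmp_zero m : cmp m (fun=> 0).
Proof. by exists Zero => xs _; constructor. Qed.

Lemma cmp_succ m F : cmp m F -> cmp m (fun xs => (F xs).+1).
Proof.
move=> [r h]; exists (Comp Succ [:: r]) => xs xm.
apply: (@eval_comp _ _ _ [:: F xs]); first by repeat constructor; apply: h.
exact: (eval_succ [:: F xs]).
Qed.

Lemma cmp_const m c : cmp m (fun=> c).
Proof. by elim: c => [|c IH]; [exact: cmp_zero|exact: cmp_succ]. Qed.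

Definition rc1 (f : nat -> nat) := cmp 1 (fun xs => f (nth 0 xs 0)).
Definition rc2 (f : nat -> nat -> nat) := cmp 2 (fun xs => f (nth 0 xs 0) (nth 0 xs 1)).
Definition rc3 (f : nat -> nat -> nat -> nat) :=
  cmp 3 (fun xs => f (nth 0 xs 0) (nth 0 xs 1) (nth 0 xs 2)).
Definition rc4 (f : nat -> nat -> nat -> nat -> nat) :=
  cmp 4 (fun xs => f (nth 0 xs 0) (nth 0 xs 1) (nth 0 xs 2) (nth 0 xs 3)).

Lemma app1 f m F : rc1 f -> cmp m F -> cmp m (fun xs => f (F xs)).
Proof.
move=> [r h] [s g]; exists (Comp r [:: s]) => xs xm.
apply: (@eval_comp _ _ _ [:: F xs]); last exact: (h [:: F xs]).
by repeat constructor; apply: g.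
Qed.

Lemma app2 f m F G : rc2 f -> cmp m F -> cmp m G -> cmp m (fun xs => f (F xs) (G xs)).
Proof.
move=> [r h] [s g] [s' g']; exists (Comp r [:: s; s']) => xs xm.
apply: (@eval_comp _ _ _ [:: F xs; G xs]); last exact: (h [:: F xs; G xs]).
by repeat constructor; [apply: g|apply: g'].
Qed.

Lemma app3 f m F G H : rc3 f -> cmp m F -> cmp m G -> cmp m H ->
  cmp m (fun xs => f (F xs) (G xs) (H xs)).
Proof.
move=> [r h] [s g] [s' g'] [t k]; exists (Comp r [:: s; s'; t]) => xs xm.
apply: (@eval_comp _ _ _ [:: F xs; G xs; H xs]); last exact: (h [:: F xs; G xs; H xs]).
by repeat constructor; [apply: g|apply: g'|apply: k].
Qed.

Lemma app4 f m F G H I : rc4 f -> cmp m F -> cmp m G -> cmp m H -> cmp m I ->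
  cmp m (fun xs => f (F xs) (G xs) (H xs) (I xs)).
Proof.
move=> [r h] [s g] [s' g'] [t k] [t' k']; exists (Comp r [:: s; s'; t; t']) => xs xm.
apply: (@eval_comp _ _ _ [:: F xs; G xs; H xs; I xs]);
  last exact: (h [:: F xs; G xs; H xs; I xs]).
by repeat constructor; [apply: g|apply: g'|apply: k|apply: k'].
Qed.

Fixpoint nrec (a : nat) (g : nat -> nat -> nat) n :=
  if n is k.+1 then g k (nrec a g k) else a.

Lemma nrec_iter a g n : nrec a (fun=> g) n = iter n g a.
Proof. by elim: n => //= n ->. Qed.

Lemma cmp_rec m N A G : cmp m N -> cmp m A -> cmp m.+2 G ->
  cmp m (fun xs => nrec (A xs) (fun k r => G [:: k, r & xs]) (N xs)).
Proof.
move=> [rn hn] [ra ha] [rg hg].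
exists (Comp (PrimRec ra rg) (rn :: [seq Proj k | k <- iota 0 m])) => xs xm.
apply: (@eval_comp _ _ _ (N xs :: xs)).
  by constructor; [apply: hn|rewrite -xm; apply: evals_proj].
elim: (N xs) => [|k IH] /=; first by constructor; apply: ha.
by apply: eval_recS IH _; apply: hg; rewrite /= xm.
Qed.

Lemma cmp_iter m N A B : cmp m N -> cmp m A -> cmp m.+1 B ->
  cmp m (fun xs => iter (N xs) (fun s => B (s :: xs)) (A xs)).
Proof.
move=> hN hA [rb hb].
have hG : cmp m.+2 (fun ys => B (behead ys)).
  exists (Comp rb [seq Proj k | k <- iota 1 m.+1]) => -[//|y ys] [ym].
  apply: (@eval_comp _ _ _ ys); last exact: hb.
  by rewrite -ym; exact: evals_proj_behead.
apply: cmp_ext (cmp_rec hN hA hG) => xs _; exact: (nrec_iter (A xs) (fun s => B (s :: xs))).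
Qed.

Lemma rc_succ : rc1 succn. Proof. exact: cmp_succ (cmp_var 1 0). Qed.

Lemma rc_add : rc2 addn.
Proof.
apply: cmp_ext (cmp_iter (B := fun ys => (nth 0 ys 0).+1) (cmp_var 2 0) (cmp_var 2 1) _).
  by move=> xs _ /=; rewrite iter_succn addnC.
exact/cmp_succ/cmp_var.
Qed.

Lemma rc_mul : rc2 muln.
Proof.
apply: cmp_ext (cmp_iter (B := fun ys => nth 0 ys 0 + nth 0 ys 2) (cmp_var 2 0) (cmp_zero 2) _).
  by move=> xs _ /=; elim: (nth 0 xs 0) => //= n ->; rewrite mulSn addnC.
by apply: (app2 rc_add); apply: cmp_var.
Qed.

Lemma rc_exp : rc2 expn.
Proof.
apply: cmp_ext (cmp_iter (B := fun ys => nth 0 ys 0 * nth 0 ys 1) (cmp_var 2 1) (cmp_const 2 1) _).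
  by move=> xs _ /=; elim: (nth 0 xs 1) => //= n ->; rewrite expnSr.
by apply: (app2 rc_mul); apply: cmp_var.
Qed.

Lemma rc_pred : rc1 predn.
Proof.
apply: cmp_ext (cmp_rec (G := fun ys => nth 0 ys 0) (cmp_var 1 0) (cmp_zero 1) (cmp_var 3 0)).
by move=> xs _; case: (nth 0 xs 0).
Qed.

Lemma rc_sub : rc2 subn.
Proof.
apply: cmp_ext (cmp_iter (B := fun ys => (nth 0 ys 0).-1) (cmp_var 2 1) (cmp_var 2 0) _).
  by move=> xs _ /=; elim: (nth 0 xs 1) => [|n IH] /=; rewrite ?subn0 // IH subnS.
by apply: (app1 rc_pred); apply: cmp_var.
Qed.

Definition cond (b x y : nat) := if b is 0 then y else x.

Lemma rc_cond : rc3 cond.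
Proof.
apply: cmp_ext (cmp_iter (B := fun ys => nth 0 ys 2) (cmp_var 3 0) (cmp_var 3 2) (cmp_var 4 2)).
by move=> xs _; case: (nth 0 xs 0) => //= n; elim: n => //= n.
Qed.

Definition ltb x y : nat := x < y.

Lemma rc_ltb : rc2 ltb.
Proof.
apply: cmp_ext (_ : cmp 2 (fun xs => cond (nth 0 xs 1 - nth 0 xs 0) 1 0)).
  move=> xs _; rewrite /ltb /cond; case e : (_ - _) => [|k].
    by symmetry; apply/eqP; rewrite eqb0 -leqNgt -subn_eq0 e.
  by rewrite ltnNge -subn_eq0 e.
apply: (app3 rc_cond); [|exact: cmp_const|exact: cmp_const].
by apply: (app2 rc_sub); apply: cmp_var.
Qed.

Definition oddn x : nat := odd x.

Lemma rc_odd : rc1 oddn.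
Proof.
apply: cmp_ext (cmp_iter (B := fun ys => 1 - nth 0 ys 0) (cmp_var 1 0) (cmp_zero 1) _).
  by move=> xs _; rewrite /oddn; elim: (nth 0 xs 0) => //= n ->; case: (odd n).
by apply: (app2 rc_sub); [exact: cmp_const|exact: cmp_var].
Qed.

Lemma rc_half : rc1 half.
Proof.
apply: cmp_ext (cmp_rec (G := fun ys => nth 0 ys 1 + oddn (nth 0 ys 0)) (cmp_var 1 0) (cmp_zero
  1) _).
  by move=> xs _; elim: (nth 0 xs 0) => //= n ->; rewrite uphalf_half addnC.
by apply: (app2 rc_add); [exact: cmp_var|apply: (app1 rc_odd); exact: cmp_var].
Qed.

(* [CodeSeq.code] maps [x :: s] to [pr x (CodeSeq.code s)], so [hd] and [tl]
   decode lists. *)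
Definition pr x y := 2 ^ x * y.*2.+1.

Lemma rc_pr : rc2 pr.
Proof.
apply: cmp_ext (_ : cmp 2 (fun xs => 2 ^ nth 0 xs 0 * (2 * nth 0 xs 1).+1)).
  by move=> xs _; rewrite /pr mul2n.
apply: (app2 rc_mul); first by apply: (app2 rc_exp); [exact: cmp_const|exact: cmp_var].
by apply: cmp_succ; apply: (app2 rc_mul); [exact: cmp_const|exact: cmp_var].
Qed.

(** Halves [c] at most [k] times, as long as it is even. Since [pr x y = 2^x (2 y + 1)], counting
    the even stages recovers [x], and the odd part recovers [y]. On 0, the code of the empty list,
    [hd] and [tl] both give 0. *)
Definition strip k c := iter k (fun s => if odd s then s else s./2) c.
Definition hd c := nrec 0 (fun k r => r + (1 - oddn (strip k c))) c.
Definition tl c := (strip c c)./2.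

Lemma strip_pr k x y : strip k (pr x y) = pr (x - k) y.
Proof.
rewrite /strip; elim: k => [|k IH] /=; first by rewrite subn0.
rewrite {}IH /pr; case e : (x - k) => [|m].
  by rewrite expn0 mul1n /= odd_double subnS e expn0 mul1n.
by rewrite expnS -mulnA mul2n odd_double doubleK subnS e.
Qed.

Lemma pr_gt x y : x < pr x y.
Proof. by rewrite /pr; apply: leq_trans (ltn_expl x (leqnn 2)) _; rewrite leq_pmulr. Qed.

Lemma pr_gt_r x y : y < pr x y.
Proof.
rewrite /pr; apply: leq_trans (_ : y.*2.+1 <= _); first by rewrite ltnS -addnn leq_addr.
by rewrite leq_pmull // expn_gt0.
Qed.

Lemma hd_pr x y : hd (pr x y) = x.
Proof.
have h n : nrec 0 (fun k r => r + (1 - oddn (strip k (pr x y)))) n = minn n x.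
  elim: n => [|n IH] /=; first by rewrite min0n.
  rewrite IH strip_pr /oddn /pr; case: (ltnP n x) => nx.
    rewrite (_ : odd _ = false); last by rewrite oddM oddX subn_eq0 leqNgt nx.
    by lia.
  by rewrite (eqP (_ : x - n == 0)) ?subn_eq0 // mul1n oddS odd_double; lia.
by rewrite /hd h; apply/minn_idPr/ltnW/pr_gt.
Qed.

Lemma tl_pr x y : tl (pr x y) = y.
Proof.
rewrite /tl strip_pr (eqP (_ : x - _ == 0)) ?subn_eq0 ?(ltnW (pr_gt _ _)) //.
by rewrite /pr expn0 mul1n -[_.+1]/(true + y.*2) half_bit_double.
Qed.

Lemma rc_strip : rc2 strip.
Proof.
apply: cmp_ext (cmp_iter (B := fun ys => cond (oddn (nth 0 ys 0)) (nth 0 ys 0) (nth 0 ys 0)./2)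
   (cmp_var 2 0) (cmp_var 2 1) _).
  move=> xs _; rewrite /strip; apply: eq_iter => s; rewrite /cond /oddn /=.
  by case: (odd s).
apply: (app3 rc_cond); [|exact: cmp_var|by apply: (app1 rc_half); exact: cmp_var].
by apply: (app1 rc_odd); exact: cmp_var.
Qed.

Lemma rc_hd : rc1 hd.
Proof.
apply: (cmp_rec (G := fun ys => nth 0 ys 1 + (1 - oddn (strip (nth 0 ys 0) (nth 0 ys 2))))
  (cmp_var 1 0) (cmp_zero 1)).
apply: (app2 rc_add); first exact: cmp_var.
apply: (app2 rc_sub); first exact: cmp_const.
by apply: (app1 rc_odd); apply: (app2 rc_strip); exact: cmp_var.
Qed.

Lemma rc_tl : rc1 tl.
Proof. by apply: (app1 rc_half); apply: (app2 rc_strip); exact: cmp_var. Qed.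

Lemma code_cons x s : CodeSeq.code (x :: s) = pr x (CodeSeq.code s).
Proof. by []. Qed.

Lemma hd_code x s : hd (CodeSeq.code (x :: s)) = x.
Proof. by rewrite code_cons hd_pr. Qed.

Lemma tl_code s : tl (CodeSeq.code s) = CodeSeq.code (behead s).
Proof. by case: s => [|x s]; rewrite ?code_cons ?tl_pr. Qed.

Lemma hd_ldec c : hd c = head 0 (ldec c).
Proof. by rewrite -{1}[c]CodeSeq.decodeK; case: (ldec c) => [|x s]; rewrite ?hd_code. Qed.

Lemma tl_ldec c : ldec (tl c) = behead (ldec c).
Proof. by rewrite -{1}[c]CodeSeq.decodeK tl_code CodeSeq.codeK. Qed.

Lemma size_ldec c : size (ldec c) <= c.
Proof.
rewrite -{2}[c]CodeSeq.decodeK; elim: (ldec c) => //= x s IH.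
by apply: leq_ltn_trans IH (pr_gt_r _ _).
Qed.

Lemma mem_ldec c x : x \in ldec c -> x < c.
Proof. by move=> xc; have /allP/(_ x xc) := CodeSeq.gtn_decode c. Qed.

(** The state is the accumulator followed by the unread entries. [N] steps suffice because a list is
    no longer than its code, and a state with nothing left to read is fixed. *)
Lemma cmp_foldl m N A F : cmp m N -> cmp m A -> cmp m.+2 F ->
  cmp m (fun xs => foldl (fun a x => F [:: a, x & xs]) (A xs) (ldec (N xs))).
Proof.
move=> hN hA [rf hf].
pose stp (st : nat) xs := cond (tl st) (pr (F [:: hd st, hd (tl st) & xs]) (tl (tl st))) st.
apply: cmp_ext (_ : cmp m (fun xs => hd (iter (N xs) (fun s => stp s xs) (pr (A xs) (N xs))))).
  move=> xs _.
  have h k a s : size s <= k ->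
    hd (iter k (fun s => stp s xs) (pr a (CodeSeq.code s))) =
    foldl (fun a x => F [:: a, x & xs]) a s.
    elim: k a s => [|k IH] a s sk; first by case: s sk => // _; rewrite /= hd_pr.
    rewrite iterSr; case: s sk => [|x s] sk.
      by rewrite [stp _ _](_ : _ = pr a (CodeSeq.code [::])); [exact: IH|rewrite /stp tl_pr].
    rewrite [stp _ _](_ : _ = pr (F [:: a, x & xs]) (CodeSeq.code s)); first exact: IH.
    rewrite /stp tl_pr hd_pr hd_code tl_code.
    by have := leq_ltn_trans (leq0n x) (pr_gt x (CodeSeq.code s)); rewrite -code_cons;
      case: CodeSeq.code.
  by rewrite -[X in pr _ X]CodeSeq.decodeK h ?size_ldec.
apply: (app1 rc_hd).
apply: (cmp_iter (B := fun ys => stp (head 0 ys) (behead ys))) => //.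
  exact: (app2 rc_pr).
have hv : cmp m.+1 (head 0) by apply: cmp_ext (cmp_var m.+1 0) => -[|].
apply: (app3 rc_cond) => //; first exact: (app1 rc_tl).
apply: (app2 rc_pr); last by do 2!apply: (app1 rc_tl).
have [[r1 h1] [r2 h2]] : cmp m.+1 (fun ys => hd (head 0 ys)) /\ cmp m.+1 (fun ys => hd (tl (head
  0 ys))).
  by split; apply: (app1 rc_hd) => //; apply: (app1 rc_tl).
exists (Comp rf [:: r1, r2 & [seq Proj k | k <- iota 1 m]]) => -[//|y ys] ym.
apply: (@eval_comp _ _ _ [:: hd y, hd (tl y) & ys]); last by apply: hf; case: ym => /= ->.
constructor; first exact: (h1 (y :: ys)).
constructor; first exact: (h2 (y :: ys)).
by case: ym => <-; exact: evals_proj_behead.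
Qed.

#[local] Hint Extern 0 (cmp _ (fun xs => nth 0 xs _)) => apply cmp_var : cmp.
#[local] Hint Extern 0 (cmp _ (fun xs => ?c)) => apply cmp_const : cmp.
#[local] Hint Extern 4 (cmp _ (fun xs => ?f (@?F xs))) =>
  apply (@app1 f _ F) : cmp.
#[local] Hint Extern 3 (cmp _ (fun xs => ?f (@?F xs) (@?G xs))) =>
  apply (@app2 f _ F G) : cmp.
#[local] Hint Extern 2 (cmp _ (fun xs => ?f (@?F xs) (@?G xs) (@?H xs))) =>
  apply (@app3 f _ F G H) : cmp.
#[local] Hint Extern 1 (cmp _ (fun xs => ?f (@?F xs) (@?G xs) (@?H xs) (@?I xs))) =>
  apply (@app4 f _ F G H I) : cmp.
#[local] Hint Resolve rc_succ rc_pred rc_half rc_odd rc_hd rc_tl rc_add rc_sub rc_mul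
  rc_exp rc_pr rc_ltb rc_cond : cmp.
Ltac cmpt := auto 200 with cmp nocore.

(* The Gaussian rational [((p - n) + i (p' - n')) / (s + 1)]; the components
   are natural numbers, never normalised. *)
Definition mkg p n p' n' s := pr p (pr n (pr p' (pr n' s))).
Definition gp z := hd z.
Definition gn z := hd (tl z).
Definition gp' z := hd (tl (tl z)).
Definition gn' z := hd (tl (tl (tl z))).
Definition gs z := (tl (tl (tl (tl z)))).+1.

Definition gadd x y := mkg (gp x * gs y + gp y * gs x) (gn x * gs y + gn y * gs x)
  (gp' x * gs y + gp' y * gs x) (gn' x * gs y + gn' y * gs x) (gs x * gs y).-1.
Definition gmul x y := mkg
  (gp x * gp y + gn x * gn y + (gp' x * gn' y + gn' x * gp' y))
  (gp x * gn y + gn x * gp y + (gp' x * gp' y + gn' x * gn' y))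
  (gp x * gp' y + gn x * gn' y + (gp' x * gp y + gn' x * gn y))
  (gp x * gn' y + gn x * gp' y + (gp' x * gn y + gn' x * gp y)) (gs x * gs y).-1.
Definition gneg x := mkg (gn x) (gp x) (gn' x) (gp' x) (gs x).-1.
Definition intp m := cond (oddn m) 0 m./2.
Definition intn m := cond (oddn m) (m./2).+1 0.
Definition gint m := mkg (intp m) (intn m) 0 0 0.
Definition gcenter re im s := mkg (intp re) (intn re) (intp im) (intn im) s.
(** Equals [(|z| gs z)^2]; the truncated subtractions are exact since [2 p n <= p^2 + n^2]. *)
Definition gnorm z := (gp z * gp z + gn z * gn z - 2 * (gp z * gn z)) +
  (gp' z * gp' z + gn' z * gn' z - 2 * (gp' z * gn' z)).
(** Decides [|z| u < |z'| w] on squares, so that no square root is computed. *)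
Definition glt z u z' w :=
  ltb (gnorm z * (u * u) * (gs z' * gs z')) (gnorm z' * (w * w) * (gs z * gs z)).
(** [code_int] doubles nonnegative integers, so 2 is the code of 1; in the same way [gtwo] and
    [gfour] use 4 and 8. *)
Definition gone := gint 2.

Lemma rc_gadd : rc2 gadd. Proof. rewrite /rc2 /gadd /mkg /gp /gn /gp' /gn' /gs; cmpt. Qed.
Lemma rc_gmul : rc2 gmul. Proof. rewrite /rc2 /gmul /mkg /gp /gn /gp' /gn' /gs; cmpt. Qed.
Lemma rc_gneg : rc1 gneg. Proof. rewrite /rc1 /gneg /mkg /gp /gn /gp' /gn' /gs; cmpt. Qed.
Lemma rc_gint : rc1 gint. Proof. rewrite /rc1 /gint /mkg /intp /intn; cmpt. Qed.
Lemma rc_gcenter : rc3 gcenter. Proof. rewrite /rc3 /gcenter /mkg /intp /intn; cmpt. Qed.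
Lemma rc_glt : rc4 glt. Proof. rewrite /rc4 /glt /gnorm /gp /gn /gp' /gn' /gs; cmpt. Qed.

#[local] Hint Resolve rc_gadd rc_gmul rc_gneg rc_gint rc_gcenter rc_glt : cmp.

Lemma mkgE p n p' n' s : [/\ gp (mkg p n p' n' s) = p, gn (mkg p n p' n' s) = n,
  gp' (mkg p n p' n' s) = p', gn' (mkg p n p' n' s) = n' & gs (mkg p n p' n' s) = s.+1].
Proof. by rewrite /gp /gn /gp' /gn' /gs /mkg !(tl_pr, hd_pr). Qed.

Lemma gs_gt0 x : 0 < gs x. Proof. by []. Qed.

Definition gtwo := gint 4.
Definition gfour := gint 8.
Definition gsub x y := gadd x (gneg y).
(* Nonzero means [|z| T < 1]. *)
Definition ztest z T := glt z T gone 1.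
Definition nthc k c := hd (iter k tl c).

(* [cl1 k z / cl2 k z] for [k = 0, 1, 2, 3] are the elements of [Sset z]. *)
Definition cl1 k z := cond k (cond k.-1 (cond k.-2 (gmul z z) (gmul z (gsub gtwo z)))
  (gmul z z)) z.
Definition cl2 k z := cond k.-2 (gsub (gmul gtwo z) gone) gone.

(* Doubling for [l = hd L / tl L], with denominators cleared. *)
Definition onum L st := gsub (gmul (tl L) (gmul (hd st) (hd st)))
  (gmul (hd L) (gmul (tl st) (tl st))).
Definition oden L st := gmul (gmul (gmul gfour (tl L)) (gmul (hd st) (tl st)))
  (gmul (gsub (hd st) (tl st)) (gsub (gmul (tl L) (hd st)) (gmul (hd L) (tl st)))).
Definition ostep L st := pr (gmul (onum L st) (onum L st)) (oden L st).
Definition orbg L z j := iter j (ostep L) (pr z gone).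
Definition crossg p q := gsub (gmul (hd p) (tl q)) (gmul (hd q) (tl p)).
(** Tests are numbers, nonzero meaning true: sums act as existential quantifiers and products as
    conjunctions. *)
Definition exorb1 L z k T :=
  nrec 0 (fun j r => r + ztest (crossg (orbg L z j) (orbg L z k)) T) k.
Definition exorb L z M T := nrec 0 (fun k r => r + exorb1 L z k T) M.+1.

(* A certificate lists approximations of [a] and [b], a precision parameter, the
   codes of the eight presentations and bounds for the moduli of their centres. *)
Definition pza w := hd w.
Definition pzb w := hd (tl w).
Definition pkap w := hd (tl (tl w)).
Definition pcs w := hd (tl (tl (tl w))).
Definition prho w := tl (tl (tl (tl w))).

(* With [n <= X^2] the dimension of the span of the monomials [a^i b^j], [Y]
   bounds the integer matrices of [a] and [b], [Z] bounds and separates from 0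
   expressions of size 1, [M] is the number of doublings to examine, [S] bounds
   the sizes of all expressions tested, [T] is the threshold of [ztest], and
   [1 / K] is the accuracy required of the approximations. *)
Definition pY X cs := 2 * (X * X) + X + cs + 10.
Definition pZ X Y := Y ^ (3 * (X * X)).
Definition pM X Z := (2 ^ (X * X * (12 * Z ^ 30 + 3))).+1.
Definition pS M Y := 200 * 23 ^ M * ((Y + 2) * (Y + 2)).
Definition pT Z S := 2 * Z ^ (2 * S).
Definition pK Z S kap := 4 * Z ^ (8 * S) * kap.+1.

Definition cY w X := pY X (pcs w).
Definition cZ w X := pZ X (cY w X).
Definition cM w X := pM X (cZ w X).
Definition cS w X := pS (cM w X) (cY w X).
Definition cT w X := pT (cZ w X) (cS w X).
Definition cK w X := pK (cZ w X) (cS w X) (pkap w).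

Definition candL w k := cond (ltb k 4) (pr (cl1 k (pza w)) (cl2 k (pza w)))
  (pr (cl1 (k - 4) (pzb w)) (cl2 (k - 4) (pzb w))).

Definition inT k w X :=
  (1 - ztest (hd (candL w k)) (cT w X)) * (1 - ztest (tl (candL w k)) (cT w X)) *
  (1 - ztest (gsub (hd (candL w k)) (tl (candL w k))) (cT w X)) *
  exorb (candL w k) (pza w) (cM w X) (cT w X) *
  exorb (candL w k) (pzb w) (cM w X) (cT w X).

(* Homogenised Horner scheme at [hd L / tl L]. *)
Definition homstep L st c := pr (gmul (gadd (hd st) (gmul (gint c) (tl st))) (tl L))
  (gmul (tl st) (hd L)).
Definition hom q L := hd (foldl (homstep L) (pr (gint 0) gone) (ldec q)).
(** The state holds [z^k], its derivative [k z^(k - 1)], and the partial sum of the derivative of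
    the polynomial. *)
Definition derstep z st c := pr (gmul (hd st) z)
  (pr (gadd (gmul (hd (tl st)) z) (hd st)) (gadd (tl (tl st)) (gmul (gint c) (hd (tl st))))).
Definition qder q z := tl (tl (foldl (derstep z) (pr gone (pr (gint 0) (gint 0))) (ldec q))).
Definition evstep z st c := pr (gmul (hd st) z) (gadd (tl st) (gmul (gint c) (hd st))).
Definition qeval q z := tl (foldl (evstep z) (pr gone (gint 0)) (ldec q)).

Definition ccen c := gcenter (hd (tl c)) (hd (tl (tl c))) (hd c).
Definition cpol c := tl (tl (tl c)).
(* Bounds, up to the radius of the disc, the distance from the divided differences
   of the polynomial with code [q] to its derivative at a centre of modulus at
   most [rho]. *)
Definition cbnd q rho := q ^ 4 * (rho + 2) ^ q.

(* [hd L / tl L] is a root, lies in the disc presented by [c], and is the only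
   root there because the derivative at the centre is large. The first factor
   ensures that [c] is the code of a presentation. *)
Definition pcheck c rho L T :=
  cond (tl (tl c)) 1 0 * ztest (hom (cpol c) L) T *
  glt (gsub (hd L) (gmul (ccen c) (tl L))) (4 * (hd c).+1) (tl L) 3 *
  glt gone (cbnd (cpol c) rho) (qder (cpol c) (ccen c)) (hd c).+1 *
  glt (ccen c) 1 gone rho.

(* A small value of the polynomial puts [z] close to some root, the second
   condition puts that root into the disc. *)
Definition acheck na z K :=
  glt (qeval (cpol na) z) (K ^ na) gone 1 *
  glt (gsub z (ccen na)) (K * (hd na).+1) gone (K - (hd na).+1).

Definition check w na nb :=
  acheck na (pza w) (cK w (na + nb)) * acheck nb (pzb w) (cK w (na + nb)) *
  nrec 1 (fun k r => r * cond (inT k w (na + nb))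
    (pcheck (nthc k (pcs w)) (nthc k (prho w)) (candL w k) (cT w (na + nb))) 1) 8.

Definition out w na nb := nrec 0 (fun k r => cond (inT k w (na + nb))
  (pr (nthc k (pcs w)) r) r) 8.

Lemma rc_gsub : rc2 gsub. Proof. rewrite /rc2 /gsub; cmpt. Qed.
#[local] Hint Resolve rc_gsub : cmp.
Lemma rc_ztest : rc2 ztest. Proof. rewrite /rc2 /ztest; cmpt. Qed.
#[local] Hint Resolve rc_ztest : cmp.
Lemma rc_nthc : rc2 nthc.
Proof.
apply: (app1 rc_hd); apply: (cmp_iter (B := fun ys => tl (nth 0 ys 0))); cmpt.
Qed.
#[local] Hint Resolve rc_nthc : cmp.
Lemma rc_cl1 : rc2 cl1. Proof. rewrite /rc2 /cl1; cmpt. Qed.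
#[local] Hint Resolve rc_cl1 : cmp.
Lemma rc_cl2 : rc2 cl2. Proof. rewrite /rc2 /cl2; cmpt. Qed.
#[local] Hint Resolve rc_cl2 : cmp.
Lemma rc_ostep : rc2 ostep. Proof. rewrite /rc2 /ostep /onum /oden; cmpt. Qed.
#[local] Hint Resolve rc_ostep : cmp.
Lemma rc_orbg : rc3 orbg.
Proof. by apply: (cmp_iter (B := fun ys => ostep (nth 0 ys 1) (nth 0 ys 0))); cmpt. Qed.
#[local] Hint Resolve rc_orbg : cmp.
Lemma rc_crossg : rc2 crossg. Proof. rewrite /rc2 /crossg; cmpt. Qed.
#[local] Hint Resolve rc_crossg : cmp.
Lemma rc_exorb1 : rc4 exorb1.
Proof.
apply: (cmp_rec (G := fun ys => nth 0 ys 1 + ztest (crossg (orbg (nth 0 ys 2) (nth 0 ys 3) (nth 0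
  ys 0))
  (orbg (nth 0 ys 2) (nth 0 ys 3) (nth 0 ys 4))) (nth 0 ys 5))); cmpt.
Qed.
#[local] Hint Resolve rc_exorb1 : cmp.
Lemma rc_exorb : rc4 exorb.
Proof.
apply: (cmp_rec (G := fun ys => nth 0 ys 1 + exorb1 (nth 0 ys 2) (nth 0 ys 3) (nth 0 ys 0) (nth 0
  ys 5))
   (N := fun ys => (nth 0 ys 2).+1)); cmpt.
Qed.
#[local] Hint Resolve rc_exorb : cmp.
Lemma rc_cM : rc2 cM. Proof. rewrite /rc2 /cM /pM /cZ /pZ /cY /pY /pcs; cmpt. Qed.
#[local] Hint Resolve rc_cM : cmp.
Lemma rc_cS : rc2 cS. Proof. rewrite /rc2 /cS /pS /cY /pY /pcs; cmpt. Qed.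
#[local] Hint Resolve rc_cS : cmp.
Lemma rc_cT : rc2 cT. Proof. rewrite /rc2 /cT /pT /cZ /pZ /cY /pY /pcs; cmpt. Qed.
#[local] Hint Resolve rc_cT : cmp.
Lemma rc_cK : rc2 cK. Proof. rewrite /rc2 /cK /pK /cZ /pZ /cY /pY /pcs /pkap; cmpt. Qed.
#[local] Hint Resolve rc_cK : cmp.
Lemma rc_candL : rc2 candL. Proof. rewrite /rc2 /candL /pza /pzb; cmpt. Qed.
#[local] Hint Resolve rc_candL : cmp.
Lemma rc_inT : rc3 inT. Proof. rewrite /rc3 /inT /pza /pzb; cmpt. Qed.
#[local] Hint Resolve rc_inT : cmp.
Lemma rc_hom : rc2 hom.
Proof.
apply: (app1 rc_hd); apply: (cmp_foldl (F := fun ys => homstep (nth 0 ys 3) (nth 0 ys 0) (nth 0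
  ys 1))).
- cmpt.
- cmpt.
rewrite /homstep; cmpt.
Qed.
#[local] Hint Resolve rc_hom : cmp.
Lemma rc_qder : rc2 qder.
Proof.
do 2!apply: (app1 rc_tl); apply: (cmp_foldl (F := fun ys => derstep (nth 0 ys 3) (nth 0 ys 0)
  (nth 0 ys 1))).
- cmpt.
- cmpt.
rewrite /derstep; cmpt.
Qed.
#[local] Hint Resolve rc_qder : cmp.
Lemma rc_qeval : rc2 qeval.
Proof.
apply: (app1 rc_tl); apply: (cmp_foldl (F := fun ys => evstep (nth 0 ys 3) (nth 0 ys 0) (nth 0 ys
  1))).
- cmpt.
- cmpt.
rewrite /evstep; cmpt.
Qed.
#[local] Hint Resolve rc_qeval : cmp.
Lemma rc_ccen : rc1 ccen. Proof. rewrite /rc1 /ccen; cmpt. Qed.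
#[local] Hint Resolve rc_ccen : cmp.
Lemma rc_pcheck : rc4 pcheck. Proof. rewrite /rc4 /pcheck /cpol /cbnd; cmpt. Qed.
#[local] Hint Resolve rc_pcheck : cmp.
Lemma rc_acheck : rc3 acheck. Proof. rewrite /rc3 /acheck /cpol; cmpt. Qed.
#[local] Hint Resolve rc_acheck : cmp.
Lemma rc_check : rc3 check.
Proof.
apply: (app2 rc_mul); first by rewrite /pza /pzb; cmpt.
apply: (cmp_rec (G := fun ys => nth 0 ys 1 * cond (inT (nth 0 ys 0) (nth 0 ys 2) (nth 0 ys 3 +
  nth 0 ys 4))
    (pcheck (nthc (nth 0 ys 0) (pcs (nth 0 ys 2))) (nthc (nth 0 ys 0) (prho (nth 0 ys 2)))
      (candL (nth 0 ys 2) (nth 0 ys 0)) (cT (nth 0 ys 2) (nth 0 ys 3 + nth 0 ys 4))) 1)).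
- cmpt.
- cmpt.
rewrite /pcs /prho; cmpt.
Qed.
Lemma rc_out : rc3 out.
Proof.
apply: (cmp_rec (G := fun ys => cond (inT (nth 0 ys 0) (nth 0 ys 2) (nth 0 ys 3 + nth 0 ys 4))
  (pr (nthc (nth 0 ys 0) (pcs (nth 0 ys 2))) (nth 0 ys 1)) (nth 0 ys 1))).
- cmpt.
- cmpt.
rewrite /pcs; cmpt.
Qed.

(** * Unbounded search for a certificate *)

Lemma rc3_search (F G : nat -> nat -> nat -> nat) : rc3 F -> rc3 G ->
  exists f : recfun, forall na nb, (exists w, F w na nb != 0) ->
  exists2 w, F w na nb != 0 & eval f [:: na; nb] (G w na nb).
Proof.
move=> hF [ro ho].
have [rc hc] : cmp 3 (fun xs => 1 - F (nth 0 xs 0) (nth 0 xs 1) (nth 0 xs 2)).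
  by apply: (app2 rc_sub); [exact: cmp_const|exact: hF].
exists (Comp ro [:: Mu rc; Proj 0; Proj 1]) => na nb ex.
case: (ex_minnP ex) => w hw wmin; exists w => //.
apply: (@eval_comp _ _ _ [:: w; na; nb]); last exact: (ho [:: w; na; nb]).
constructor.
  constructor.
    have := hc [:: w; na; nb] erefl; rewrite /= (_ : 1 - _ = 0) //.
    by apply/eqP; rewrite subn_eq0 lt0n.
  move=> m mw; exists 0; have := hc [:: m; na; nb] erefl.
  rewrite /= (_ : F m na nb = 0) ?subn0 //.
  by apply/eqP; apply: contraTT mw => /wmin; rewrite -leqNgt.
by do 2!(constructor; first by constructor); constructor.
Qed.

Lemma search_program : exists f : recfun, forall na nb,
  (exists w, check w na nb != 0) ->
  exists2 w, check w na nb != 0 & eval f [:: na; nb] (out w na nb).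
Proof. exact: rc3_search rc_check rc_out. Qed.

End Programs.

(** * Values of coded Gaussian rationals *)

Section Values.
Variable R : realType.
Import Normc.

Definition gval (z : nat) : R[i] :=
  Complex ((gp z)%:R - (gn z)%:R) ((gp' z)%:R - (gn' z)%:R) / (gs z)%:R.

Lemma gs_neq0 z : (gs z)%:R != 0 :> R[i]. Proof. by rewrite pnatr_eq0. Qed.

Lemma complex_natE (m n m' n' : nat) :
  Complex (m%:R - n%:R : R) (m'%:R - n'%:R) =
  (m%:R - n%:R) + (m'%:R - n'%:R) * Complex 0 1 :> R[i].
Proof.
have h k : k%:R = Complex k%:R 0 :> R[i] by rewrite -(rmorph_nat (real_complex R)).
rewrite (h m) (h n) (h m') (h n').
by apply/eqP; rewrite eq_complex /=; apply/andP; split; apply/eqP; ring.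
Qed.

Lemma sqr_im : Complex 0 1 * Complex 0 1 = -1 :> R[i].
Proof. by apply/eqP; rewrite eq_complex /=; apply/andP; split; apply/eqP; ring. Qed.

Lemma gvalM x y : gval (gmul x y) = gval x * gval y.
Proof.
rewrite /gval /gmul; case: (mkgE (gp x * gp y + gn x * gn y + (gp' x * gn' y + gn' x * gp' y))
  (gp x * gn y + gn x * gp y + (gp' x * gp' y + gn' x * gn' y))
  (gp x * gp' y + gn x * gn' y + (gp' x * gp y + gn' x * gn y))
  (gp x * gn' y + gn x * gp' y + (gp' x * gn y + gn' x * gp y)) (gs x * gs y).-1) => -> -> -> -> ->.
rewrite prednK ?muln_gt0 ?gs_gt0 // natrM invfM mulrACA; congr (_ * _).
rewrite !complex_natE !natrD !natrM; set I := Complex 0 1.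
have e : I * I = -1 by exact: sqr_im.
rewrite [RHS](_ : _ = ((gp x)%:R - (gn x)%:R) * ((gp y)%:R - (gn y)%:R) +
  (I * I) * (((gp' x)%:R - (gn' x)%:R) * ((gp' y)%:R - (gn' y)%:R)) +
  I * (((gp x)%:R - (gn x)%:R) * ((gp' y)%:R - (gn' y)%:R) +
       ((gp' x)%:R - (gn' x)%:R) * ((gp y)%:R - (gn y)%:R))); last by ring.
by rewrite e; ring.
Qed.

Lemma gvalD x y : gval (gadd x y) = gval x + gval y.
Proof.
rewrite /gval /gadd; case: (mkgE (gp x * gs y + gp y * gs x) (gn x * gs y + gn y * gs x)
  (gp' x * gs y + gp' y * gs x) (gn' x * gs y + gn' y * gs x) (gs x * gs y).-1) => -> -> -> -> ->.
rewrite prednK ?muln_gt0 ?gs_gt0 // !complex_natE !natrD !natrM.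
have hx := gs_neq0 x; have hy := gs_neq0 y.
by field; rewrite hx hy.
Qed.

Lemma gvalN x : gval (gneg x) = - gval x.
Proof.
rewrite /gval /gneg; case: (mkgE (gn x) (gp x) (gn' x) (gp' x) (gs x).-1) => -> -> -> -> ->.
by rewrite prednK ?gs_gt0 // !complex_natE; field; exact: gs_neq0.
Qed.

Lemma code_intE m : (intp (code_int m))%:R - (intn (code_int m))%:R = m%:~R :> R.
Proof.
case: m => k; rewrite /intp /intn /oddn /= ?odd_double /= ?doubleK ?subr0 //.
by rewrite uphalf_double NegzE mulrNz sub0r.
Qed.

Lemma gval_center re im s : gval (gcenter (code_int re) (code_int im) s) =
  Complex re%:~R im%:~R / s.+1%:R.
Proof.
rewrite /gval /gcenter; case: (mkgE (intp (code_int re)) (intn (code_int re))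
  (intp (code_int im)) (intn (code_int im)) s) => -> -> -> -> ->.
by rewrite !code_intE.
Qed.

Lemma gval_int m : gval (gint (code_int m)) = m%:~R.
Proof.
rewrite -[gint _]/(gcenter (code_int m) (code_int 0) 0) gval_center divr1.
by rewrite -(rmorph_int (real_complex R)).
Qed.

Lemma gval_one : gval gone = 1. Proof. exact: (gval_int 1). Qed.

Lemma sqr_normcE (z : R[i]) : normc z ^+ 2 = complex.Re z ^+ 2 + complex.Im z ^+ 2.
Proof. by case: z => a b; rewrite /= sqr_sqrtr // addr_ge0 ?sqr_ge0. Qed.

Lemma gnormE z : (gnorm z)%:R = (normc (gval z) * (gs z)%:R) ^+ 2.
Proof.
rewrite /gval -{1}(normc_nat R (gs z)) -normcM divfK ?gs_neq0 // sqr_normcE /= /gnorm.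
have h (a b : nat) : (a * a + b * b - 2 * (a * b))%:R = (a%:R - b%:R) ^+ 2 :> R.
  rewrite natrB; last by rewrite !mulnn (nat_Cauchy a b).
  by rewrite natrD !natrM; ring.
by rewrite natrD !h.
Qed.

Lemma gltE z u z' w :
  (glt z u z' w != 0%N) = (normc (gval z) * u%:R < normc (gval z') * w%:R).
Proof.
rewrite /glt /ltb eqb0 negbK -(ltr_nat R) !natrM !gnormE.
set a := normc _; set b := normc _; set s := (gs z)%:R; set t := (gs z')%:R.
have s0 : 0 < s by rewrite ltr0n.
have t0 : 0 < t by rewrite ltr0n.
have a0 : 0 <= a by apply: normc_ge0.
have b0 : 0 <= b by apply: normc_ge0.
have -> : (a * s) ^+ 2 * (u%:R * u%:R) * (t * t) = (s * t) ^+ 2 * (a * u%:R) ^+ 2 by ring.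
have -> : (b * t) ^+ 2 * (w%:R * w%:R) * (s * s) = (s * t) ^+ 2 * (b * w%:R) ^+ 2 by ring.
by rewrite ltr_pM2l ?exprn_gt0 ?mulr_gt0 // ltr_pXn2r // nnegrE mulr_ge0.
Qed.

Lemma nearest_int (x : R) : exists m : int, `|x - m%:~R| <= 2^-1.
Proof.
exists (Num.floor (x + 2^-1)).
have h1 := ge_floor (x + 2^-1); have h2 := floorD1_gt (x + 2^-1).
by rewrite rmorphD /= in h2; rewrite ler_norml; apply/andP; split; lra.
Qed.

(** Rounding both coordinates to a grid errs by at most half a step in each, hence by [1 / sqrt 2]
    of a step in modulus; the room left up to 1 is needed in [pcheck_complete]. *)
Lemma nearest_center (z : R[i]) (s : nat) : exists re im : int,
  2 * (normc (z - Complex re%:~R im%:~R / s.+1%:R) * s.+1%:R) ^+ 2 <= 1.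
Proof.
case: z => x y; have [re hre] := nearest_int (x * s.+1%:R).
have [im him] := nearest_int (y * s.+1%:R); exists re, im.
rewrite -{1}(normc_nat R s.+1) -normcM mulrBl divfK ?pnatr_eq0 // sqr_normcE.
rewrite -(rmorph_nat (real_complex R)) /= !mulr0 subr0 add0r.
have sq (u : R) : `|u| <= 2^-1 -> u ^+ 2 <= 4^-1.
  rewrite ler_norml => /andP[h1 h2]; have -> : 4^-1 = 2^-1 * 2^-1 :> R by field.
  nra.
by have := sq _ hre; have := sq _ him; lra.
Qed.

Lemma gval_dense (w : R[i]) (e : R) : 0 < e -> exists z, normc (gval z - w) < e.
Proof.
move=> e0; pose s := Num.truncn e^-1.
have hs : e^-1 < s.+1%:R by exact: truncnS_gt.
have [re [im h]] := nearest_center w s.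
exists (gcenter (code_int re) (code_int im) s).
rewrite gval_center -normcN opprB.
set d := normc _ in h *; have d0 : 0 <= d by apply: normc_ge0.
have h1 : 1 < e * s.+1%:R by rewrite -(ltr_pM2l e0) mulfV ?gt_eqF // in hs.
have h2 : d * s.+1%:R < 1.
  by move: (d * _) h => q h; rewrite ltNge; apply/negP => g; nra.
have s0 : 0 < s.+1%:R :> R by rewrite ltr0n.
by rewrite -(ltr_pM2r s0); lra.
Qed.

End Values.

(** * Correctness of the program *)

Section Good.
Variables (R : realType) (T : finType) (w : T -> Qbar R) (t0 : T).
Hypothesis w0 : w t0 = 1.
Variables (Y Z K : nat).
Hypotheses (YP : (2 * #|T| <= Y)%N) (ZP : (Y ^ (3 * #|T|) <= Z)%N) (K0 : (0 < K)%N).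
Import Normc.

(* [z] is the code of an approximation of [x]; [s] bounds the size of an
   expression of [x] in terms of the two given algebraic numbers. *)
Definition good s (x : Qbar R) (z : nat) :=
  [/\ (0 < s)%N, cx w Y s x &
      normc (gval R z - qval x) <= Z%:R ^+ (4 * s) / K%:R].

Lemma Z_ge8 : (8 <= Z)%N.
Proof.
apply: leq_trans ZP; have Y2 := Y_gt1 t0 YP; have T0 := n_gt0 t0.
apply: leq_trans (_ : 2 ^ (3 * #|T|) <= _)%N; last by rewrite leq_exp2r // muln_gt0 T0.
by rewrite -[8%N]/(2 ^ 3)%N leq_exp2l // leq_pmulr.
Qed.

Lemma Zr_ge8 : 8 <= Z%:R :> R. Proof. by rewrite ler_nat Z_ge8. Qed.
Lemma Zr_ge1 : 1 <= Z%:R :> R. Proof. by have := Zr_ge8; lra. Qed.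
Lemma Kr_gt0 : 0 < K%:R :> R. Proof. by rewrite ltr0n. Qed.
Lemma Kr_ge1 : 1 <= K%:R :> R. Proof. by rewrite ler1n. Qed.
Lemma expZ_ge1 k : 1 <= Z%:R ^+ k :> R. Proof. exact: exprn_ege1 Zr_ge1. Qed.
Lemma expZ_le j k : (j <= k)%N -> Z%:R ^+ j <= Z%:R ^+ k :> R.
Proof. by move=> jk; rewrite ler_weXn2l ?Zr_ge1. Qed.

Lemma good_le s t x z : (s <= t)%N -> good s x z -> good t x z.
Proof.
move=> st [s0 cxs h]; split; [exact: leq_trans st|exact: cx_le cxs|].
by apply: le_trans h _; rewrite ler_pM2r ?invr_gt0 ?Kr_gt0 // expZ_le // leq_mul2l.
Qed.

Lemma good_int (m : int) : `|m| <= Y%:Z -> good 1 m%:~R (gint (code_int m)).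
Proof.
move=> mY; split=> //; first exact: (@cx_int _ _ _ t0).
rewrite gval_int rmorph_int subrr normc0 divr_ge0 ?exprn_ge0 //.
Qed.

Lemma goodN s x z : good s x z -> good s (- x) (gneg z).
Proof.
move=> [s0 cxs h]; split=> //; first exact: cxN.
by rewrite gvalN rmorphN -opprB opprK normcN addrC.
Qed.

Lemma goodD s t x y u z : good s x u -> good t y z -> good (s + t).+1 (x + y) (gadd u z).
Proof.
move=> [s0 cs hs] [t0' ct ht]; split=> //; first exact: (@cxD _ _ _ t0).
rewrite gvalD rmorphD (_ : _ - _ = (gval R u - qval x) + (gval R z - qval y)); last by ring.
apply: le_trans (le_normcD _ _) _; apply: le_trans (lerD hs ht) _.
rewrite -mulrDl ler_pM2r ?invr_gt0 ?Kr_gt0 //.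
rewrite -[(4 * _.+1)%N]/(4 * (s + t).+1)%N.
have h1 : Z%:R ^+ (4 * s) <= Z%:R ^+ (4 * (s + t)) :> R by apply: expZ_le; lia.
have h2 : Z%:R ^+ (4 * t) <= Z%:R ^+ (4 * (s + t)) :> R by apply: expZ_le; lia.
have -> : (4 * (s + t).+1 = 4 * (s + t) + 4)%N by lia.
rewrite exprD; have h3 : 2 <= Z%:R ^+ 4 :> R.
  by apply: le_trans (expZ_le (isT : 1 <= 4)%N); rewrite expr1; have := Zr_ge8; lra.
have h4 := expZ_ge1 (4 * (s + t)).
nra.
Qed.

Lemma goodB s t x y u z : good s x u -> good t y z -> good (s + t).+1 (x - y) (gsub u z).
Proof. by move=> gx gy; apply: goodD gx (goodN gy). Qed.

(** With [|x| <= Z^(2 s)] and [|y| <= Z^(2 t)], each of the three error terms is at most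
    [Z^(4 s + 4 t) / K]; the extra unit of size contributes [Z^4 >= 3]. *)
Lemma goodM s t x y u z : good s x u -> good t y z -> good (s + t).+1 (x * y) (gmul u z).
Proof.
move=> [s0 cs hs] [t0' ct ht]; split=> //; first exact: (@cxM _ _ _ t0).
rewrite gvalM rmorphM.
rewrite (_ : _ - _ = (gval R u - qval x) * (gval R z - qval y) +
  qval x * (gval R z - qval y) + (gval R u - qval x) * qval y); last by ring.
apply: le_trans (le_normcD _ _) _; apply: le_trans (lerD (le_normcD _ _) (lexx _)) _.
rewrite !normcM.
have ux := cx_upper w0 YP ZP (qval : {rmorphism _ -> _}) s0 cs.
have uy := cx_upper w0 YP ZP (qval : {rmorphism _ -> _}) t0' ct.
have -> : (4 * (s + t).+1 = 2 * s + 2 * s + (2 * t + 2 * t) + 4)%N by lia.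
rewrite (exprD _ (2 * s + 2 * s + (2 * t + 2 * t))%N 4) (exprD _ (2 * s + 2 * s)%N) (exprD _ (2 *
  s)%N (2 * s)%N) (exprD _ (2 * t)%N (2 * t)%N).
have Es : Z%:R ^+ (4 * s) = Z%:R ^+ (2 * s) * Z%:R ^+ (2 * s) :> R.
  by rewrite -exprD; congr (_ ^+ _); lia.
have Et : Z%:R ^+ (4 * t) = Z%:R ^+ (2 * t) * Z%:R ^+ (2 * t) :> R.
  by rewrite -exprD; congr (_ ^+ _); lia.
rewrite Es in hs; rewrite Et in ht.
have A1 := expZ_ge1 (2 * s); have B1 := expZ_ge1 (2 * t).
have h3 : 3 <= Z%:R ^+ 4 :> R.
  by apply: le_trans (expZ_le (isT : 1 <= 4)%N); rewrite expr1; have := Zr_ge8; lra.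
have k1 : K%:R^-1 <= 1 :> R by rewrite invf_le1 ?Kr_gt0 ?Kr_ge1.
have k0 : 0 < K%:R^-1 :> R by rewrite invr_gt0 Kr_gt0.
move: (normc_ge0 (gval R u - qval x)) (normc_ge0 (gval R z - qval y))
  (normc_ge0 (qval x)) (normc_ge0 (qval y)).
move: ux uy hs ht A1 B1 h3 k1 k0.
set A := _ ^+ (2 * s); set B := _ ^+ (2 * t); set k := _^-1; set C := _ ^+ 4.
set e := normc (_ - qval x); set f := normc (_ - qval y).
set g := normc (qval x); set h := normc (qval y).
move=> ux uy hs ht A1 B1 h3 k1 k0 e0 f0 g0 h0.
have P0 : 0 <= A * A * (B * B) by rewrite !mulr_ge0 //; lra.
have e1 : e * f <= A * A * (B * B) * k.
  apply: le_trans (ler_pM e0 f0 hs ht) _.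
  rewrite [X in X <= _](_ : _ = A * A * (B * B) * k * k); last by ring.
  by rewrite ler_piMr // mulr_ge0 // ltW.
have AA : A <= A * A by rewrite ler_peMl //; lra.
have BB : B <= B * B by rewrite ler_peMl //; lra.
have A0 : 0 <= A by lra. have B0 : 0 <= B by lra.
have e2 : g * f <= A * A * (B * B) * k.
  apply: le_trans (ler_pM g0 f0 ux ht) _.
  rewrite [X in X <= _](_ : _ = A * (B * B) * k); last by ring.
  rewrite ler_pM2r //.
  by rewrite ler_wpM2r // mulr_ge0.
have e3 : e * h <= A * A * (B * B) * k.
  apply: le_trans (ler_pM e0 h0 hs uy) _.
  rewrite [X in X <= _](_ : _ = A * A * B * k); last by ring.
  rewrite ler_pM2r //.
  by rewrite ler_wpM2l // mulr_ge0.
apply: le_trans (lerD (lerD e1 e2) e3) _.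
rewrite [X in X <= _](_ : _ = A * A * (B * B) * k * 3); last by ring.
rewrite [X in _ <= X](_ : _ = A * A * (B * B) * k * C); last by ring.
by rewrite ler_wpM2l // mulr_ge0 // ltW.
Qed.

(** In the unit [Z^(- 2 S)]: a nonzero [x] has modulus at least 1, the error is at most [1 / 4], and
    the threshold is [1 / 2]. *)
Lemma ztestP S s x z : good s x z -> (s <= S)%N -> (4 * Z ^ (6 * S) <= K)%N ->
  (ztest z (pT Z S) != 0%N) = (x == 0).
Proof.
move=> gs sS KS; have [S0 cS h] := good_le sS gs.
rewrite /ztest (gltE R) gval_one normc_one mulr1 /pT natrM natrX.
have Kb : 4 * Z%:R ^+ (6 * S) <= K%:R :> R by rewrite -natrX -natrM ler_nat.
have E6 : Z%:R ^+ (6 * S) = Z%:R ^+ (2 * S) * Z%:R ^+ (4 * S) :> R.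
  by rewrite -exprD; congr (_ ^+ _); lia.
rewrite E6 in Kb; have A1 := expZ_ge1 (2 * S); have B1 := expZ_ge1 (4 * S).
have k0 := Kr_gt0.
have eB : Z%:R ^+ (4 * S) / K%:R * Z%:R ^+ (2 * S) <= 4^-1 :> R.
  by rewrite mulrAC ler_pdivrMr //; lra.
have A0 : 0 < Z%:R ^+ (2 * S) :> R by lra.
have hA : normc (gval R z - qval x) * Z%:R ^+ (2 * S) <= 4^-1.
  by apply: le_trans eB; rewrite ler_pM2r.
apply/idP/eqP => [t|x0]; last first.
  by move: hA; rewrite x0 rmorph0 subr0; lra.
apply/eqP; apply: contraLR t => x0; rewrite -leNgt.
have := cx_lower w0 YP ZP (qval : {rmorphism _ -> _}) S0 cS x0 => L.
have : normc (qval x) <= normc (gval R z) + normc (gval R z - qval x).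
  rewrite -{1}[qval x](subKr (gval R z)); apply: le_trans (le_normcD _ _) _.
  by rewrite normcN.
rewrite -(ler_pM2r A0) mulrDl; lra.
Qed.

Section Orbit.
Variables (l1 l2 a : Qbar R) (L za : nat).
Hypotheses (gl1 : good 5 l1 (hd L)) (gl2 : good 5 l2 (tl L)) (ga : good 1 a za).

Definition hnum (p : Qbar R * Qbar R) := l2 * (p.1 * p.1) - l1 * (p.2 * p.2).
Definition hden (p : Qbar R * Qbar R) :=
  (4 * l2 * (p.1 * p.2)) * ((p.1 - p.2) * (l2 * p.1 - l1 * p.2)).
Definition horb j := iter j (fun p => (hnum p * hnum p, hden p)) (a, 1).

Lemma horbE j : l2 != 0 -> exists2 e, e != 0 &
  horb j = (e * (orbx (l1 / l2) a j).1, e * (orbx (l1 / l2) a j).2).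
Proof.
move=> l20; elim: j => [|j [e e0 IH]]; first by exists 1; rewrite ?oner_eq0 // !mul1r.
exists (e ^+ 4 * l2 ^+ 2); first by rewrite mulf_neq0 ?expf_neq0.
rewrite /horb iterS -/(horb j) IH [orbx _ _ j.+1]iterS -/(orbx _ _ j) /dbl /hnum /hden /=.
by congr pair; field.
Qed.

Lemma Y_ge4 : (4 <= Y)%N -> good 1 4 gfour.
Proof. by move=> Y4; apply: (@good_int 4). Qed.

Hypothesis Y4 : (4 <= Y)%N.

(** Entries of size [t = 5 * 23^j] lead to a numerator of size at most [8 t + 31], the denominator
    being smaller, and this is at most [23 t]. *)
Lemma good_orb j : good (5 * 23 ^ j) (horb j).1 (hd (orbg L za j)) /\
  good (5 * 23 ^ j) (horb j).2 (tl (orbg L za j)).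
Proof.
elim: j => [|j [IH1 IH2]].
  rewrite /orbg /= hd_pr tl_pr; split; first exact: good_le ga.
  by apply: good_le (@good_int 1 _) => //; rewrite normr1 lez_nat; lia.
have s1 : (1 <= 23 ^ j)%N by rewrite expn_gt0.
rewrite /orbg iterS -/(orbg L za j) /ostep hd_pr tl_pr.
rewrite /horb iterS -/(horb j) /= expnS.
set s := (23 ^ j)%N in IH1 IH2 s1 *.
have gn : good (2 * 5 + 4 * (5 * s) + 5) (hnum (horb j)) (onum L (orbg L za j)).
  apply: good_le (goodB (goodM gl2 (goodM IH1 IH1)) (goodM gl1 (goodM IH2 IH2))).
  by lia.
split; first by apply: good_le (goodM gn gn); lia.
apply: good_le (goodM (goodM (goodM (Y_ge4 Y4) gl2) (goodM IH1 IH2))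
  (goodM (goodB IH1 IH2) (goodB (goodM gl2 IH1) (goodM gl1 IH2)))); lia.
Qed.

Lemma good_cross M j k : (j <= M)%N -> (k <= M)%N ->
  good (35 * 23 ^ M) (cross (horb j) (horb k)) (crossg (orbg L za j) (orbg L za k)).
Proof.
move=> jM kM; have [g1 g2] := good_orb j; have [g3 g4] := good_orb k.
have h m : (m <= M)%N -> (5 * 23 ^ m <= 5 * 23 ^ M)%N by move=> mM; rewrite leq_mul2l leq_pexp2l.
have s1 : (1 <= 23 ^ M)%N by rewrite expn_gt0.
move: (good_le (h j jM) g1) (good_le (h j jM) g2) (good_le (h k kM) g3) (good_le (h k kM) g4).
move=> {}g1 {}g2 {}g3 {}g4.
by apply: good_le (goodB (goodM g1 g4) (goodM g3 g2)); lia.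
Qed.

Lemma nrec_sum_neq0 f m : (nrec 0 (fun k r => r + f k)%N m != 0%N) <->
  exists2 k, (k < m)%N & f k != 0%N.
Proof.
elim: m => [|m IH] /=; first by split=> // -[].
rewrite addn_eq0 negb_and; split=> [/orP[/IH[k km fk]|fm]|[k]].
- by exists k => //; apply: ltnW.
- by exists m.
rewrite ltnS leq_eqVlt => /orP[/eqP->->|km fk]; first by rewrite orbT.
by apply/orP; left; apply/IH; exists k.
Qed.

Lemma exorbP M S : (35 * 23 ^ M <= S)%N -> (4 * Z ^ (6 * S) <= K)%N -> l2 != 0 ->
  (exorb L za M (pT Z S) != 0%N) <->
  exists j k, (j < k <= M)%N /\ cross (orbx (l1 / l2) a j) (orbx (l1 / l2) a k) = 0.
Proof.
move=> MS KS l20.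
have tE j k : (j < k)%N -> (k <= M)%N ->
    (ztest (crossg (orbg L za j) (orbg L za k)) (pT Z S) != 0%N) =
    (cross (orbx (l1 / l2) a j) (orbx (l1 / l2) a k) == 0).
  move=> jk kM; rewrite (ztestP (good_cross (ltnW (leq_trans jk kM)) kM) MS KS).
  have [e e0 ->] := horbE j l20; have [e' e'0 ->] := horbE k l20.
  rewrite [X in X == 0](_ : _ = e * e' * cross (orbx (l1 / l2) a j) (orbx (l1 / l2) a k)).
    by rewrite mulf_eq0 (negPf (mulf_neq0 e0 e'0)).
  by rewrite /cross /=; ring.
rewrite /exorb nrec_sum_neq0; split=> [[k kM]|[j [k [/andP[jk kM] c]]]].
  rewrite ltnS in kM; rewrite /exorb1 nrec_sum_neq0 => -[j jk].
  by rewrite tE // => /eqP c; exists j, k; rewrite jk kM.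
exists k => //; rewrite /exorb1 nrec_sum_neq0; exists j => //.
by rewrite tE //; apply/eqP.
Qed.

(** The sizes 5, 5 and 11 of [l1], [l2] and [l2 - l1] are at most 30, so their valuations lie
    between [- Z^30] and [Z^30]. [orbit_repeats] applies with [B = 2 Z^30], whence [12 Z^30 + 3] in
    [pM]. *)
Lemma inT_orbit (Q : Q2closure) (i : {rmorphism Qbar R -> Q2bar Q}) (Xb : nat) M :
  (#|T| <= Xb)%N -> (2 ^ (Xb * (12 * Z ^ 30 + 3))).+1 = M ->
  l1 != 0 -> l2 != 0 -> l1 != l2 ->
  finite_orbit (l1 / l2) a <->
  exists j k, (j < k <= M)%N /\ cross (orbx (l1 / l2) a j) (orbx (l1 / l2) a k) = 0.
Proof.
move=> TX ME l10 l20 l12; split=> [fin|[j [k [/andP[jk _] c]]]]; last by exists j, k.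
have [_ c1 _] := gl1; have [_ c2 _] := gl2; have [_ ca _] := ga.
have l0 : l1 / l2 != 0 by rewrite mulf_neq0 ?invr_eq0.
have lE : 1 - l1 / l2 = (l2 - l1) / l2 by rewrite mulrBl divff.
have l21 : l2 - l1 != 0 by rewrite subr_eq0 eq_sym.
have l1' : l1 / l2 != 1.
  by rewrite -subr_eq0 -oppr_eq0 opprB lE mulf_neq0 ?invr_eq0.
have vP := v2P i; have vE := v2_two i.
have [e1 E1] := v_fin vP l10; have [e2 E2] := v_fin vP l20; have [e3 E3] := v_fin vP l21.
have c21 : cx w Y (5 + 5).+1 (l2 - l1) by apply: (@cxD _ _ _ t0) => //; apply: cxN.
have b s x e : (0 < s)%N -> (s <= 30)%N -> cx w Y s x -> veq (v2 i) x e ->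
    - Z%:R ^+ 30 <= e /\ e <= Z%:R ^+ 30.
  move=> s0 s30 cxs ex; apply: (cx_val w0 YP ZP vP vE _ _ ex) => //.
  by apply: (@cx_le _ _ _ t0) cxs.
have [b1 b1'] := b 5%N _ _ isT isT c1 E1.
have [b2 b2'] := b 5%N _ _ isT isT c2 E2.
have [b3 b3'] := b 11%N _ _ isT isT c21 E3.
have sp x s : cx w Y s x -> rat_span w x by exact: cx_rat_span.
have sl : rat_span w (l1 / l2).
  by apply: rat_spanM; [exact: sp c1|apply: (rat_spanV w0 vP vE); exact: sp c2].
have eE : veq (v2 i) (l1 / l2) (e1 - e2) by apply: veqM => //; apply: veqV.
have eE' : veq (v2 i) (1 - l1 / l2) (e3 - e2) by rewrite lE; apply: veqM => //; apply: veqV.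
have [|||j [k [jk c]]] := @orbit_repeats R Q i T w t0 w0 _ a (2 * Z ^ 30) _ _ l0 l1' fin sl (sp _
  _ ca) eE eE'.
- by rewrite natrM natrX; lra.
- by rewrite natrM natrX; lra.
- by rewrite natrM natrX; lra.
- exists j, k; split=> //; case/andP: jk => -> kM /=; apply: leq_trans kM _.
  rewrite -ME ltnS leq_pexp2l // mulnA; apply: leq_mul => //.
Qed.

End Orbit.

End Good.

(** * Codes of algebraic numbers *)

Section Decoding.

Definition cpoly (s : seq int) := CodeSeq.code (map code_int s).

Lemma hd_algnum c : hd (code_algnum c) = an_prec c.
Proof. exact: hd_code. Qed.

Lemma ccenE c : ccen (code_algnum c) =
  gcenter (code_int (an_re c)) (code_int (an_im c)) (an_prec c).
Proof. by rewrite /ccen /code_algnum !tl_code /= !hd_pr. Qed.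

Lemma cpolE c : cpol (code_algnum c) = cpoly (an_poly c).
Proof. by rewrite /cpol /code_algnum !tl_code. Qed.

Lemma ldec_cpoly s : CodeSeq.decode (cpoly s) = map code_int s.
Proof. exact: CodeSeq.codeK. Qed.

Lemma cpoly_size s : (size s <= cpoly s)%N.
Proof. by rewrite -(size_map code_int) -ldec_cpoly size_ldec. Qed.

Lemma code_int_abs m : (`|m| <= (code_int m)%:Z)%R.
Proof. by case: m => k /=; lia. Qed.

Lemma cpoly_coef s m : m \in s -> (`|m| <= (cpoly s)%:Z)%R.
Proof.
move=> ms; apply: le_trans (code_int_abs m) _; rewrite lez_nat ltnW //.
by apply: mem_ldec; rewrite ldec_cpoly map_f.
Qed.

Lemma cpoly_le c : (cpoly (an_poly c) <= code_algnum c)%N.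
Proof.
have h x s : (CodeSeq.code s <= CodeSeq.code (x :: s))%N by exact: ltnW (pr_gt_r _ _).
by do 2!apply: leq_trans (h _ _) _; exact: h.
Qed.

Lemma prec_lt c : (an_prec c < code_algnum c)%N.
Proof. exact: pr_gt. Qed.

Definition int_of_code n := if odd n then Negz n./2 else Posz n./2.

Lemma code_intK n : code_int (int_of_code n) = n.
Proof.
rewrite /int_of_code; case: ifP => on /=; rewrite -{2}(odd_double_half n) on //.
Qed.

(** Codes inside a certificate are arbitrary numbers; since [code_int] is onto, having at least
    three entries is all that must be tested. *)
Lemma algnum_of_code c : tl (tl c) != 0%N -> exists cc, code_algnum cc = c.
Proof.
rewrite -[c]CodeSeq.decodeK !tl_code.
case: (CodeSeq.decode c) => [|x [|y [|z s]]] //= _.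
exists (AlgNum (map int_of_code s) (int_of_code y) (int_of_code z) x).
rewrite /code_algnum /= !code_intK -map_comp (eq_map code_intK) map_id.
by [].
Qed.

End Decoding.

(** * Evaluation of integer polynomials and approximation of the inputs *)

Section Evaluation.
Variable R : realType.
Import Normc.
Local Notation C := R[i].

Definition ipoly (s : seq int) : {poly C} := map_poly intr (Poly s).

Lemma ipoly_cons c s : ipoly (c :: s) = ipoly s * 'X + (c%:~R)%:P.
Proof. by rewrite /ipoly /= cons_poly_def rmorphD rmorphM /= map_polyX map_polyC. Qed.

Lemma ipoly_nil : ipoly [::] = 0.
Proof. by rewrite /ipoly rmorph0. Qed.

Lemma qevalE s z : gval R (qeval (cpoly s) z) = (ipoly s).[gval R z].
Proof.
rewrite /qeval ldec_cpoly.
have h pw S : gval R (tl (foldl (evstep z) (pr pw S) (map code_int s))) =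
    gval R S + gval R pw * (ipoly s).[gval R z].
  elim: s pw S => [|c s IH] pw S /=; first by rewrite ipoly_nil horner0 mulr0 addr0 tl_pr.
  rewrite [X in foldl _ X _]/evstep hd_pr tl_pr IH ipoly_cons gvalD !gvalM gval_int hornerD
    hornerM hornerX hornerC; ring.
by rewrite h gval_one mul1r -[gint 0]/(gint (code_int 0)) gval_int add0r.
Qed.

Lemma qderE s z : gval R (qder (cpoly s) z) = (ipoly s)^`().[gval R z].
Proof.
rewrite /qder ldec_cpoly.
have h pw dpw D : gval R (tl (tl (foldl (derstep z) (pr pw (pr dpw D)) (map code_int s)))) =
    gval R D + gval R dpw * (ipoly s).[gval R z] + gval R pw * (ipoly s)^`().[gval R z].
  elim: s pw dpw D => [|c s IH] pw dpw D /=.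
    by rewrite ipoly_nil deriv0 horner0 !mulr0 !addr0 !tl_pr.
  rewrite [X in foldl _ X _]/derstep !(hd_pr, tl_pr) IH ipoly_cons !gvalD !gvalM gval_int derivD
    derivM.
  by rewrite derivX derivC mulr1 addr0 !(hornerD, hornerM, hornerX, hornerC); ring.
by rewrite h gval_one mul1r -[gint 0]/(gint (code_int 0)) gval_int mul0r !add0r.
Qed.

Lemma horner_bound (q : {poly C}) (a : C) :
  exists2 B, 0 < B & forall z, normc (z - a) <= 1 -> normc q.[z] <= B.
Proof.
pose r := normc a + 1.
exists (1 + \sum_(i < size q) normc q`_i * r ^+ i).
  rewrite ltr_wpDr // sumr_ge0 // => i _; rewrite mulr_ge0 ?normc_ge0 // exprn_ge0 //.
  by rewrite addr_ge0 ?normc_ge0.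
move=> z za; rewrite horner_coef; apply: le_trans (le_normc_sum _ _ _) _.
rewrite -[X in X <= _]add0r lerD //; apply: ler_sum => i _; rewrite normcM normc_exp.
apply: ler_wpM2l; first exact: normc_ge0.
apply: lerXn2r; rewrite ?nnegrE ?normc_ge0 ?addr_ge0 ?normc_ge0 //.
by rewrite -[z](subrK a) addrC; apply: le_trans (le_normcD _ _) _; rewrite lerD.
Qed.

Lemma root_near (p : {poly C}) a : root p a ->
  exists2 B, 0 < B & forall z, normc (z - a) <= 1 -> normc p.[z] <= B * normc (z - a).
Proof.
move=> /factor_theorem[q ->]; have [B B0 h] := horner_bound q a; exists B => // z za.
by rewrite hornerM normcM hornerXsubC ler_wpM2r ?normc_ge0 // h.
Qed.

(** The leading coefficient is a nonzero integer, of modulus at least 1; if all roots were at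
    distance at least [1 / K], the value would have modulus at least [K^(- k)]. *)
Lemma small_value_root (s : seq int) (z : C) (k K : nat) : (0 < K)%N ->
  ipoly s != 0 -> (size s <= k)%N -> normc (ipoly s).[z] * (K ^ k)%:R < 1 ->
  exists2 r, root (ipoly s) r & normc (z - r) < K%:R^-1.
Proof.
move=> K0 p0 sk; have [rs E] := closed_field_poly_normal (ipoly s).
have k0 : 0 < K%:R :> R by rewrite ltr0n.
have k1 : 1 <= K%:R :> R by rewrite ler1n.
have lc : 1 <= normc (lead_coef (ipoly s)).
  rewrite /ipoly lead_coef_map_inj ?rmorph0 //; last exact: intr_inj.
  rewrite normc_int -[1]/(1%:~R) ler_int -gtz0_ge1 normr_gt0 lead_coef_eq0.
  by apply: contraNneq p0 => h; rewrite /ipoly h rmorph0.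
have szr : (size rs <= k)%N.
  have := congr1 (size \o polyseq) E; rewrite /= size_scale ?lead_coef_eq0 //.
  rewrite size_prod_XsubC => h; rewrite -ltnS -h.
  apply: leq_trans (size_poly _ _) _; apply: leq_trans (size_Poly _) _.
  exact: leq_trans sk (leqnSn _).
move=> small; apply: contrapT => no.
have far r : r \in rs -> K%:R^-1 <= normc (z - r).
  move=> rr; rewrite leNgt; apply/negP => h; apply: no; exists r => //.
  by rewrite E rootZ ?lead_coef_eq0 // root_prod_XsubC.
move: small; apply/negP; rewrite -leNgt {1}E hornerZ normcM.
have prodh : (K%:R ^+ size rs)^-1 <= normc (\prod_(r <- rs) ('X - r%:P)).[z].
  elim: (rs) far => [|r rr IH] far; first by rewrite big_nil hornerC normc_one invr1.
  rewrite big_cons hornerM hornerXsubC normcM exprS invfM.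
  apply: ler_pM; rewrite ?invr_ge0 ?exprn_ge0 ?(ltW k0) //.
    by apply: far; rewrite inE eqxx.
  by apply: IH => r' h; apply: far; rewrite inE h orbT.
have kk : 1 <= (K%:R ^+ size rs)^-1 * K%:R ^+ k :> R.
  by rewrite mulrC ler_pdivlMr ?exprn_gt0 // mul1r ler_weXn2l.
rewrite natrX; apply: le_trans kk _; rewrite ler_pM2r ?exprn_gt0 //.
by apply: le_trans prodh _; rewrite ler_peMl ?normc_ge0.
Qed.

Lemma in_discE c (z : C) : in_disc c z =
  (normc (z - gval R (ccen (code_algnum c))) * (an_prec c).+1%:R < 1).
Proof.
rewrite ccenE gval_center /in_disc.
have -> : `|z - Complex (an_re c)%:~R (an_im c)%:~R / (an_prec c).+1%:R| =
  real_complex R (normc (z - Complex (an_re c)%:~R (an_im c)%:~R / (an_prec c).+1%:R)) by [].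
rewrite -(rmorph_nat (real_complex R)) -fmorphV ltcR.
by rewrite -[X in _ < X]mul1r ltr_pdivlMr ?ltr0n.
Qed.

Lemma acheck_sound c z K (a : C) : (0 < K)%N -> presents c a ->
  acheck (code_algnum c) z K != 0%N -> normc (gval R z - a) < K%:R^-1.
Proof.
move=> K0 [p0 pa da uniq]; rewrite /acheck muln_eq0 negb_or cpolE.
rewrite !(gltE R) gval_one normc_one mul1r mulr1n qevalE hd_algnum => /andP[h1 h2].
have sz : (size (an_poly c) <= code_algnum c)%N.
  by apply: leq_trans (cpoly_size _) (cpoly_le c).
have [r rr zr] := small_value_root K0 p0 sz h1.
suff -> : a = r by [].
symmetry; apply: uniq => //; rewrite in_discE.
(* If [K] were smaller, the truncated difference in the test would be 0 and the strict inequality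
   would fail. *)
have KP : ((an_prec c).+1 <= K)%N.
  rewrite leqNgt; apply/negP => h; move: h2.
  rewrite (eqP (_ : (K - (an_prec c).+1 == 0)%N)) ?subn_eq0 ?(ltnW h) // mulr0.
  by rewrite ltNge mulr_ge0 ?normc_ge0.
move: h2; rewrite mul1r natrB // gvalD gvalN natrM => h2.
have k0 : 0 < K%:R :> R by rewrite ltr0n.
set g := gval R (ccen _) in h2 *; set P := (_.+1)%:R in h2 *.
have P0 : 0 <= P by rewrite ler0n.
have zr' : normc (r - gval R z) * K%:R < 1.
  by rewrite -normcN opprB -ltr_pdivlMr // mul1r.
have tri : normc (r - g) <= normc (r - gval R z) + normc (gval R z - g).
  by rewrite -[X in normc X](subrKA (gval R z)); apply: le_normcD.
have P1 : 1 <= P by rewrite ler1n.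
rewrite -(ltr_pM2r k0).
set e := normc (r - gval R z) in zr' tri; set f := normc (gval R z - g) in h2 tri.
set t := normc (r - g) in tri *.
have : t * P * K%:R <= (e * K%:R) * P + f * (K%:R * P).
  rewrite (_ : _ + _ = (e + f) * (P * K%:R)); last by ring.
  by rewrite -mulrA ler_wpM2r // mulr_ge0 // ltW.
have : (e * K%:R) * P < P by rewrite gtr_pMl //; lra.
lra.
Qed.

(** [a] lies strictly inside its disc; once [K] is large against [P / gap], shrinking the disc by
    [1 / K] still leaves room for approximations. This unknown gap is why a certificate contains the
    parameter [pkap]. *)
Lemma acheck_complete c (a : C) : presents c a ->
  exists K0 : nat, forall K, (K0 <= K)%N -> exists z, acheck (code_algnum c) z K != 0%N.
Proof.
move=> [p0 pa da _]; rewrite in_discE in da.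
set g := gval R _ in da; set P := (an_prec c).+1 in da.
have P0 : 0 < P%:R :> R by rewrite ltr0n.
set t := normc (a - g) in da.
pose gap := 1 - t * P%:R; have gap0 : 0 < gap by rewrite subr_gt0.
exists (Num.truncn (2 * P%:R / gap)).+1 => K hK.
have hK' : 2 * P%:R / gap < K%:R.
  by apply: lt_le_trans (truncnS_gt _) _; rewrite ler_nat.
have {}hK' : 2 * P%:R < K%:R * gap by rewrite -ltr_pdivrMr.
have gap1 : gap <= 1 by rewrite /gap lerBlDr lerDl mulr_ge0 ?normc_ge0 ?ltW.
have k0 : 0 < K%:R :> R.
  by rewrite -(pmulr_lgt0 _ gap0); apply: lt_trans hK'; rewrite mulr_gt0.
have PK : P%:R < K%:R :> R by have : K%:R * gap <= K%:R by [rewrite ler_piMr // ltW]; lra.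
have [B B0 hB] := root_near pa.
pose e0 : R := Num.min 1 (Num.min ((B * (K ^ code_algnum c)%:R)^-1) (gap / (2 * P%:R))).
have Kn0 : 0 < (K ^ code_algnum c)%:R :> R by rewrite natrX exprn_gt0.
have e00 : 0 < e0.
  by rewrite /e0 !lt_min ltr01 invr_gt0 mulr_gt0 // divr_gt0 // mulr_gt0.
have [z hz] := gval_dense a e00; exists z.
move: hz; rewrite /e0 !lt_min => /and3P[h1 h2 h3].
rewrite /acheck muln_eq0 negb_or !(gltE R) gval_one normc_one mul1r mulr1n cpolE qevalE hd_algnum.
apply/andP; split.
  rewrite -ltr_pdivlMr // mul1r; apply: le_lt_trans (hB _ (ltW h1)) _.
  by rewrite mulrC -ltr_pdivlMr // -invfM mulrC.
rewrite mul1r natrB; last by rewrite -(ler_nat R) ltW.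
rewrite gvalD gvalN -/g -/P natrM.
have tri : normc (gval R z - g) <= normc (gval R z - a) + t.
  by rewrite -[X in normc X](subrKA a); apply: le_normcD.
have h3' : normc (gval R z - a) * (2 * P%:R) < gap by rewrite -ltr_pdivlMr ?mulr_gt0.
have : normc (gval R z - g) * P%:R < 1 - gap / 2.
  have : normc (gval R z - g) * P%:R <= (normc (gval R z - a) + t) * P%:R.
    by rewrite ler_pM2r.
  by rewrite /gap in h3' *; lra.
set u := normc _ * _ => hu.
rewrite (_ : _ * (K%:R * P%:R) = K%:R * u); last by rewrite /u; ring.
have : K%:R * u < K%:R * (1 - gap / 2) by rewrite ltr_pM2l.
lra.
Qed.

End Evaluation.

(** * Uniqueness of a root in a small disc *)

Section Uniqueness.
Variable R : realType.
Import Normc.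
Local Notation C := R[i].

Lemma subX_near (z w : C) (B r : R) k : 1 <= B -> 0 <= r -> normc z <= B -> normc w <= B ->
  normc (w - z) <= r -> normc (w ^+ k - z ^+ k) <= k%:R * B ^+ k * r.
Proof.
move=> B1 r0 zB wB wz; elim: k => [|k IH]; first by rewrite subrr normc0 mulr0n !mul0r.
rewrite !exprS (_ : _ - _ = w * (w ^+ k - z ^+ k) + (w - z) * z ^+ k); last by ring.
apply: le_trans (le_normcD _ _) _; rewrite !normcM normc_exp.
have B0 : 0 <= B by lra.
have zk : normc z ^+ k <= B ^+ k by apply: lerXn2r; rewrite ?nnegrE ?normc_ge0.
apply: le_trans (_ : _ <= B * (k%:R * B ^+ k * r) + r * (B * B ^+ k)) _; last first.
  by rewrite -[k.+1]addn1 natrD; apply/eqP/eqP => //; rewrite le_eqVlt; apply/orP; left;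
    apply/eqP; ring.
apply: lerD; apply: ler_pM; rewrite ?normc_ge0 ?exprn_ge0 ?normc_ge0 //.
by apply: le_trans zk _; rewrite ler_peMl ?exprn_ge0.
Qed.

(** For [w != w'] the sum is the divided difference [(w^k - w'^k) / (w - w')]; at [w = w' = z] it
    becomes the derivative of [z^k]. *)
Lemma divided_difference_near (z w w' : C) (B r : R) k : 1 <= B -> 0 <= r ->
  normc z <= B -> normc w <= B -> normc w' <= B ->
  normc (w - z) <= r -> normc (w' - z) <= r ->
  normc (\sum_(i < k) w ^+ (k.-1 - i) * w' ^+ i - k%:R * z ^+ k.-1) <=
    (k ^ 2)%:R * B ^+ k * r.
Proof.
move=> B1 r0 zB wB wB' wz wz'; have B0 : 0 <= B by lra.
have -> : k%:R * z ^+ k.-1 = \sum_(i < k) z ^+ (k.-1 - i) * z ^+ i.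
  transitivity (\sum_(i < k) z ^+ k.-1); first by rewrite sumr_const card_ord mulr_natl.
  apply: eq_bigr => i _; rewrite -exprD subnK // -ltnS prednK //.
  exact: leq_ltn_trans (ltn_ord i).
rewrite -sumrB; apply: le_trans (le_normc_sum _ _ _) _.
apply: le_trans (_ : _ <= \sum_(i < k) k%:R * B ^+ k * r) _; last first.
  rewrite sumr_const card_ord -[X in X <= _]mulr_natl -mulnn natrM le_eqVlt.
  by apply/orP; left; apply/eqP; ring.
apply: ler_sum => i _; set j := (k.-1 - i)%N.
have ji : (j + i <= k)%N by have := ltn_ord i; rewrite /j; lia.
rewrite (_ : _ - _ = (w ^+ j - z ^+ j) * w' ^+ i + z ^+ j * (w' ^+ i - z ^+ i)); last by ring.
apply: le_trans (le_normcD _ _) _; rewrite !normcM !normc_exp.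
have e1 := subX_near j B1 r0 zB wB wz; have e2 := subX_near i B1 r0 zB wB' wz'.
have p1 : normc w' ^+ i <= B ^+ i by apply: lerXn2r; rewrite ?nnegrE ?normc_ge0.
have p2 : normc z ^+ j <= B ^+ j by apply: lerXn2r; rewrite ?nnegrE ?normc_ge0.
apply: le_trans (_ : _ <= (j%:R * B ^+ j * r) * B ^+ i + B ^+ j * (i%:R * B ^+ i * r)) _.
  by apply: lerD; apply: ler_pM; rewrite ?normc_ge0 ?exprn_ge0 ?normc_ge0.
rewrite (_ : _ + _ = (j + i)%:R * B ^+ (j + i) * r); last by rewrite natrD exprD; ring.
apply: ler_wpM2r => //; apply: ler_pM; rewrite ?exprn_ge0 ?ler_nat //.
by apply: ler_weXn2l.
Qed.

(* Injectivity of a polynomial on a small disc, from a lower bound of its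
   derivative at the centre. *)
Lemma simple_root_unique (s : seq int) (z w w' : C) (q rho P : nat) :
  (0 < P)%N -> (size s <= q)%N -> (forall c, c \in s -> `|c| <= q%:Z) ->
  normc z < rho%:R ->
  normc (w - z) * P%:R < 1 -> normc (w' - z) * P%:R < 1 ->
  root (ipoly R s) w -> root (ipoly R s) w' ->
  (cbnd q rho)%:R < normc (ipoly R s)^`().[z] * P%:R -> w' = w.
Proof.
move=> P0 sq cq zrho wz wz' rw rw' big; apply/eqP/negPn/negP => ww'.
have p0 : 0 < P%:R :> R by rewrite ltr0n.
pose r : R := P%:R^-1; have r0 : 0 <= r by rewrite invr_ge0 ltW.
have wr : normc (w - z) <= r by rewrite ltW // -[r]mul1r ltr_pdivlMr.
have wr' : normc (w' - z) <= r by rewrite ltW // -[r]mul1r ltr_pdivlMr.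
have r1 : r <= 1 by rewrite invf_le1 // ler1n.
pose B : R := (rho + 2)%:R.
have B1 : 1 <= B by rewrite ler1n addn2.
have zB : normc z <= B by rewrite /B natrD; lra.
have near x : normc (x - z) <= r -> normc x <= B.
  move=> xz; rewrite -[x](subrK z) /B natrD; have := le_normcD (x - z) z; lra.
have wB := near w wr; have wB' := near w' wr'.
have coefE k : (ipoly R s)`_k = (s`_k)%:~R by rewrite /ipoly coef_map coef_Poly.
have cf k : `|s`_k| <= q%:Z.
  have [ks|ks] := ltnP k (size s); first by apply: cq; rewrite mem_nth.
  by rewrite nth_default // normr0.
have sz : (size (ipoly R s) <= q)%N.
  by apply: leq_trans (size_poly _ _) _; apply: leq_trans (size_Poly _) _.
have B0 : 0 <= B by lra.
have evE x : (ipoly R s).[x] = \sum_(k < q) (s`_k)%:~R * x ^+ k.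
  rewrite (horner_coef_wide _ sz); by apply: eq_bigr => k _; rewrite coefE.
have dE : (ipoly R s)^`().[z] = \sum_(k < q) (s`_k)%:~R * (k%:R * z ^+ k.-1).
  have [q0|q0] := posnP q.
    have s0 : s = [::] by apply/nilP; rewrite /nilp -leqn0 -q0.
    by rewrite s0 ipoly_nil deriv0 horner0 q0 big_ord0.
  case: q q0 sz {sq cq cf evE big} => // q _ sz.
  rewrite big_ord_recl mul0r mulr0 add0r.
  have szd' : (size (ipoly R s)^`() <= q)%N.
    have [->|n0] := eqVneq (ipoly R s) 0; first by rewrite deriv0 size_poly0.
    by rewrite -ltnS; apply: leq_trans (lt_size_deriv n0) sz.
  rewrite (horner_coef_wide _ szd'); apply: eq_bigr => k _.
  by rewrite coef_deriv coefE -[X in X * _ = _]mulr_natr mulrA.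
(* The divided difference of the polynomial vanishes at two distinct roots. *)
have zero : \sum_(k < q) (s`_k)%:~R * (\sum_(i < k) w ^+ (k.-1 - i) * w' ^+ i) = 0.
  have d : w - w' != 0 by rewrite subr_eq0 eq_sym.
  apply: (mulfI d); rewrite mulr0 mulr_sumr.
  transitivity (\sum_(k < q) ((s`_k)%:~R * w ^+ k - (s`_k)%:~R * w' ^+ k)).
    apply: eq_bigr => k _; rewrite mulrCA -mulrBr; congr (_ * _).
    case: (nat_of_ord k) => [|k']; first by rewrite big_ord0 mulr0 !expr0 subrr.
    by rewrite subrXX; congr (_ * _); apply: eq_bigr => i _; rewrite subSS.
  by rewrite sumrB -!evE (rootP rw) (rootP rw') subrr.
move: big; apply/negP; rewrite -leNgt -ler_pdivlMr // -/r.
rewrite -[X in normc X]subr0 -[X in _ - X]zero dE -sumrB.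
apply: le_trans (le_normc_sum _ _ _) _.
(* Origin of [q^4] in [cbnd]: [q] terms, coefficients at most [q], and [q^2] from each divided
   difference. *)
apply: le_trans (_ : _ <= \sum_(k < q) q%:R * ((q ^ 2)%:R * B ^+ q * r)) _; last first.
  rewrite sumr_const card_ord -[X in X <= _]mulr_natl /cbnd natrM natrX -/B !natrX;
    rewrite le_eqVlt.
  by apply/orP; left; apply/eqP; ring.
apply: ler_sum => k _; rewrite -mulrBr normcM normc_int.
apply: ler_pM; rewrite ?normc_ge0 ?ler0z //.
  by rewrite -[q%:R]/(q%:Z%:~R) ler_int.
rewrite -normcN opprB.
apply: le_trans (divided_difference_near k B1 r0 zB wB wB' wr wr') _.
have kq : (k <= q)%N by rewrite ltnW.
apply: ler_wpM2r => //; apply: ler_pM; rewrite ?ler0n ?exprn_ge0 ?ler_nat ?leq_sqr //.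
by apply: ler_weXn2l.
Qed.

End Uniqueness.

Lemma sqr_half_le1 (F : realFieldType) (u : F) : 2 * u ^+ 2 <= 1 -> u <= 1.
Proof. by move=> h; rewrite leNgt; apply/negP => ?; nra. Qed.

Section HomEval.
Variable K : fieldType.

Definition homK (l1 l2 : K) (s : seq int) :=
  foldl (fun p (c : int) => ((p.1 + c%:~R * p.2) * l2, p.2 * l1)) (0, 1) s.

Lemma homKE (l1 l2 : K) s : l2 != 0 ->
  (homK l1 l2 s).1 = l2 ^+ size s * (map_poly intr (Poly s)).[l1 / l2].
Proof.
move=> l20; rewrite /homK.
have h (p : K * K) : (foldl (fun p (c : int) => ((p.1 + c%:~R * p.2) * l2, p.2 * l1)) p s).1 =
    l2 ^+ size s * (p.1 + p.2 * (map_poly intr (Poly s)).[l1 / l2]).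
  elim: s p => [|c s IH] p /=; first by rewrite rmorph0 horner0 mulr0 addr0 mul1r.
  rewrite IH /= cons_poly_def rmorphD rmorphM /= map_polyX map_polyC /=.
  by rewrite hornerD hornerM hornerX hornerC exprS; field.
by rewrite h /= add0r mul1r.
Qed.

End HomEval.

Lemma ipoly_qval (R : realType) s (x : Qbar R) :
  (ipoly R s).[qval x] = qval (map_poly intr (Poly s)).[x].
Proof.
rewrite -horner_map /ipoly; congr (_.[_]).
by apply/polyP => k; rewrite !coef_map [RHS]rmorph_int.
Qed.

(** * Existence of presentations that pass the tests *)

Section Presentation.
Variable R : realType.
Import Normc.

(** What a certificate should contain. The root is within [1 / sqrt 2] of the radius from the
    centre, so that the disc test survives approximation errors. *)
Definition presentation (x : Qbar R) (c : algnum) (rho : nat) :=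
  [/\ (ipoly R (an_poly c)).[qval x] = 0,
      2 * (normc (qval x - gval R (ccen (code_algnum c))) * (an_prec c).+1%:R) ^+ 2 <= 1,
      glt gone (cbnd (cpol (code_algnum c)) rho)
        (qder (cpol (code_algnum c)) (ccen (code_algnum c))) (an_prec c).+1 != 0%N &
      glt (ccen (code_algnum c)) 1 gone rho != 0%N].

Lemma int_relation (x : Qbar R) : exists2 p : {poly int}, p != 0 &
  root (map_poly intr p : {poly R[i]}) (qval x).
Proof.
case: x => x /= /asboolP[p p0 px].
have [q [a a0 pE]] := rat_poly_scale p; exists q.
  by apply: contraNneq p0 => q0; rewrite pE q0 rmorph0 scaler0.
move: px; rewrite pE map_polyZ rootZ ?fmorph_eq0 ?invr_eq0 ?intr_eq0 //.
rewrite -map_poly_comp (eq_map_poly (g := intr)) // => m /=.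
by rewrite ratr_int.
Qed.

(** In a relation of least degree the root is simple, since the derivative would be a shorter
    relation. *)
Lemma simple_relation (x : Qbar R) : exists p : {poly int},
  root (map_poly intr p : {poly R[i]}) (qval x) /\
  (map_poly intr p : {poly R[i]})^`().[qval x] != 0.
Proof.
pose P n := `[< exists p : {poly int}, [/\ size p = n, p != 0 &
  root (map_poly intr p : {poly R[i]}) (qval x)] >].
have ex : exists n, P n.
  by have [p p0 px] := int_relation x; exists (size p); apply/asboolP; exists p.
case: (ex_minnP ex) => n /asboolP[p [sp p0 px]] nmin; exists p; split=> //.
apply/negP => /eqP dx.
have : p^`() != 0.
  have p1 : (1 < size p)%N.
    rewrite ltnNge; apply/negP => /size1_polyC pc; move: px p0.
    rewrite pc map_polyC /= rootC intr_eq0 polyC_eq0 => ->. by [].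
  apply/eqP => /(congr1 (fun r : {poly int} => r`_(size p).-2)) /eqP.
  rewrite coef_deriv coef0 mulrn_eq0 /= (_ : (size p).-2.+1 = (size p).-1); last by lia.
  by rewrite -lead_coefE lead_coef_eq0 (negPf p0).
move=> d0; have := nmin (size p^`()); rewrite /P.
have -> : `[< exists q : {poly int}, [/\ size q = size p^`(), q != 0 &
  root (map_poly intr q : {poly R[i]}) (qval x)] >] = true.
  apply/asboolP; exists p^`(); split=> //.
  by rewrite rootE -deriv_map dx.
by move=> /(_ isT); rewrite -sp leqNgt lt_size_deriv.
Qed.

(** With [d] the modulus of the derivative at the root and [B] a Lipschitz constant nearby, a
    precision above [(2 B + 2 cbnd) / d] makes the derivative at the centre large enough. There is
    no circularity: [cbnd] depends on the polynomial and on [rho] only. *)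
Lemma presentation_exists (x : Qbar R) : exists c rho, presentation x c rho.
Proof.
have [p [px dx]] := simple_relation x.
pose s := polyseq p.
have sE : ipoly R s = map_poly intr p by rewrite /ipoly polyseqK.
rewrite -sE in px dx.
pose q := cpoly s; pose d := normc (ipoly R s)^`().[qval x].
have d0 : 0 < d by rewrite lt_neqAle normc_ge0 eq_sym andbT; apply: contraNneq dx => /eq0_normc->.
have := root_near (p := (ipoly R s)^`() - ((ipoly R s)^`().[qval x])%:P) (a := qval x).
rewrite rootE hornerD hornerN hornerC subrr eqxx => /(_ isT)[B B0 hB].
pose rho := (Num.truncn (normc (qval x) + 1)).+1.
have hrho : normc (qval x) + 1 < rho%:R by exact: truncnS_gt.
pose prec := Num.truncn (2 * B / d + 2 * (cbnd q rho)%:R / d).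
have hprec : 2 * B / d + 2 * (cbnd q rho)%:R / d < prec.+1%:R by exact: truncnS_gt.
have [re [im h]] := nearest_center (qval x) prec.
pose c := AlgNum s re im prec.
exists c, rho; have P0 : 0 < prec.+1%:R :> R by rewrite ltr0n.
have P1 : 1 <= prec.+1%:R :> R by rewrite ler1n.
have gE : gval R (ccen (code_algnum c)) = Complex re%:~R im%:~R / prec.+1%:R.
  by rewrite ccenE gval_center.
set g := gval R _ in gE.
rewrite -gE in h; set e := normc _ in h; have e0 : 0 <= e by apply: normc_ge0.
have h1 : e * prec.+1%:R <= 1.
  exact: sqr_half_le1.
have e1 : e <= 1 by apply: le_trans h1; rewrite ler_peMr.
have xg : normc (g - qval x) = e by rewrite -normcN opprB.
split=> //.
- exact/rootP.
- rewrite (gltE R) gval_one normc_one mul1r cpolE qderE -/g -/s -/q.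
  have := hB g; rewrite xg => /(_ e1); rewrite hornerD hornerN hornerC => hd.
  have : d <= normc (ipoly R s)^`().[g] + B * e.
    apply: le_trans (_ : _ <= normc (ipoly R s)^`().[g] + normc ((ipoly R s)^`().[g] -
      (ipoly R s)^`().[qval x])) _; last by rewrite lerD2l.
    rewrite -[in X in _ <= _ + X]normcN opprB.
    by rewrite /d -{1}[(ipoly R s)^`().[qval x]](addrNK (ipoly R s)^`().[g]) addrC le_normcD.
  set D := normc (ipoly R s)^`().[g] => hD.
  have h2 : 2 * B + 2 * (cbnd q rho)%:R < d * prec.+1%:R.
    move: hprec; rewrite -mulrDl ltr_pdivrMr // [_ * d]mulrC; exact.
  have h3 : d * prec.+1%:R <= D * prec.+1%:R + B * (e * prec.+1%:R).
    by rewrite mulrA -mulrDl ler_pM2r.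
  have h4 : B * (e * prec.+1%:R) <= B by rewrite ler_piMr // ltW.
  have c0 : 0 <= (cbnd q rho)%:R :> R by [].
  by move: h2 h3 h4 c0 B0; clear; lra.
rewrite (gltE R) gval_one normc_one mul1r mulr1 -/g.
by rewrite -[g](subrK (qval x)); have := le_normcD (g - qval x) (qval x); rewrite xg; lra.
Qed.

End Presentation.

Lemma mul5_neq0 k1 k2 k3 k4 k5 : ((k1 * k2 * k3 * k4 * k5)%N != 0%N) =
  [&& k1 != 0%N, k2 != 0%N, k3 != 0%N, k4 != 0%N & k5 != 0%N].
Proof. by rewrite !muln_eq0 !negb_or -!andbA. Qed.

Section Estimates.
Variable F : realFieldType.
Implicit Types x y z t e l : F.

Lemma sqr_half_lt x : 2 * x ^+ 2 <= 1 -> x <= 71 / 100.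
Proof. by move=> h; rewrite leNgt; apply/negP => ?; nra. Qed.

(** The ratio [3 / 4] in the disc test leaves room for errors on both sides: it is above
    [71 / 100 > 1 / sqrt 2], which a [presentation] guarantees, and below 1, which [presents]
    requires. *)
Lemma margin_lt x y z t e l : x <= y + z -> y <= 71 / 100 * l ->
  10 * (3 * e + 4 * z) <= l -> l <= t + e -> 0 < l -> 0 <= e -> 4 * x < t * 3.
Proof. lra. Qed.

Lemma margin_gt x y z t e l : 4 * x < t * 3 -> y <= x + z ->
  10 * (3 * e + 4 * z) <= l -> t <= l + e -> 0 < l -> 0 <= e -> y < l.
Proof. lra. Qed.

Lemma scaled_bound x y z e k m : 0 <= k -> k <= m -> 0 <= z -> 0 <= e ->
  x <= y + z * e -> x * k <= y * k + m * z * e.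
Proof.
move=> k0 km z0 e0 h; apply: le_trans (ler_wpM2r k0 h) _.
rewrite mulrDl lerD2l mulrC mulrA; apply: ler_wpM2r => //.
exact: ler_wpM2r.
Qed.

End Estimates.

(** * Correctness of the verification of a presentation *)

Section PCheck.
Variables (R : realType) (T : finType) (w : T -> Qbar R) (t0 : T).
Hypothesis w0 : w t0 = 1.
Variables (Y Z K S : nat).
Hypotheses (YP : (2 * #|T| <= Y)%N) (ZP : (Y ^ (3 * #|T|) <= Z)%N) (K0 : (0 < K)%N).
Hypotheses (SY : (10 * (Y.+1 * Y.+1) <= S)%N) (KS : (4 * Z ^ (8 * S) <= K)%N).
Import Normc.
Local Notation good := (good w Y Z K).
Variables (l1 l2 : Qbar R) (L : nat).
Hypotheses (gl1 : good 5 l1 (hd L)) (gl2 : good 5 l2 (tl L)).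

Let gM s t x y u z : good s x u -> good t y z -> good (s + t).+1 (x * y) (gmul u z).
Proof. by move=> gx gy; have := goodM w0 YP ZP K0 gx gy. Qed.
Let gD s t x y u z : good s x u -> good t y z -> good (s + t).+1 (x + y) (gadd u z).
Proof. by move=> gx gy; have := goodD t0 YP ZP K0 gx gy. Qed.
Let gI m : `|m| <= Y%:Z -> good 1 m%:~R (gint (code_int m)).
Proof. by move=> h; have := good_int w t0 Z K YP h. Qed.
Let gL s t x z : (s <= t)%N -> good s x z -> good t x z.
Proof. by move=> st h; have := good_le t0 YP ZP K0 st h. Qed.

(** After [k] Horner steps the accumulator has size [10 (k + 1)^2] and the running power [1 + 6 k];
    this quadratic growth explains the square of [Y + 2] in [pS]. *)
Lemma good_hom s : (forall c, c \in s -> `|c| <= Y%:Z) ->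
  good (10 * ((size s).+1 * (size s).+1)) (homK l1 l2 s).1 (hom (cpoly s) L).
Proof.
rewrite /homK /hom ldec_cpoly => sY.
have h k p st : good (10 * (k.+1 * k.+1)) p.1 (hd st) -> good (1 + 6 * k) p.2 (tl st) ->
    good (10 * ((k + size s).+1 * (k + size s).+1))
      (foldl (fun p (c : int) => ((p.1 + c%:~R * p.2) * l2, p.2 * l1)) p s).1
      (hd (foldl (homstep L) st (map code_int s))).
  elim: s sY k p st => [|c s IH] sY k p st gH gw /=; first by rewrite addn0.
  rewrite addnS -addSn; apply: IH.
  - by move=> c' h; apply: sY; rewrite inE h orbT.
  - rewrite /homstep hd_pr /=.
    have cY : `|c| <= Y%:Z by apply: sY; rewrite inE eqxx.
    by apply: gL (gM (gD gH (gM (gI cY) gw)) gl2); nia.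
  by rewrite /homstep tl_pr /=; apply: gL (gM gw gl1); lia.
have Y0 : (1 <= Y)%N by apply: ltnW (Y_gt1 t0 YP).
have := h 0%N (0, 1) (pr (gint 0) gone); rewrite hd_pr tl_pr add0n; apply.
  by apply: (gL (isT : 1 <= 10)%N); apply: (@gI 0).
by apply: (@gI 1); rewrite normr1 lez_nat.
Qed.

Let K6 : (4 * Z ^ (6 * S) <= K)%N.
Proof.
apply: leq_trans KS; rewrite leq_mul2l /= leq_pexp2l ?leq_mul2r ?orbT //.
by apply: leq_trans (Z_ge8 t0 YP ZP).
Qed.

Hypothesis l20 : l2 != 0.

Lemma hom_root s : (forall c, c \in s -> `|c| <= Y%:Z) -> (size s <= Y)%N ->
  (ztest (hom (cpoly s) L) (pT Z S) != 0%N) = root (ipoly R s) (qval (l1 / l2)).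
Proof.
move=> sY szY; rewrite (ztestP w0 YP ZP K0 (good_hom sY) _ K6); last first.
  by apply: leq_trans SY; rewrite leq_mul2l leq_mul.
rewrite homKE // mulf_eq0 expf_eq0 (negPf l20) andbF orFb.
rewrite [RHS]rootE ipoly_qval.
by rewrite fmorph_eq0.
Qed.

(** The error bound of [good] at size 5, that of numerator and denominator of a candidate. *)
Let eta : R := Z%:R ^+ 20 / K%:R.

(** [|l2| >= Z^(- 10)] by [cx_lower], whereas [K >= Z^80] makes [eta] at most [Z^(- 60)]. In the
    weight, [1 + 2 Y] comes from the centre, of modulus at most [2 Y], and the factor [Y] bounds the
    inverse radius. *)
Lemma margin : 10 * ((3 + 4 * Y%:R * (1 + 2 * Y%:R)) * eta) <= normc (qval l2).
Proof.
have [s2 c2 _] := gl2.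
have := cx_lower w0 YP ZP (qval : {rmorphism _ -> _}) s2 c2 l20.
have z8 := Zr_ge8 R t0 YP ZP; have k0 := Kr_gt0 R K0.
have Zk k : 0 < Z%:R ^+ k :> R by rewrite exprn_gt0 //; lra.
rewrite -[(2 * 5)%N]/10%N mulrC -ler_pdivrMr // div1r; apply: le_trans.
rewrite (_ : 10 * _ = (3 + 4 * Y%:R * (1 + 2 * Y%:R)) * 10 * Z%:R ^+ 20 / K%:R);
  last by rewrite /eta; ring.
rewrite ler_pdivrMr // ler_pdivlMl //.
have YZ : (Y <= Z)%N.
  apply: leq_trans ZP; rewrite -{1}[Y]expn1 leq_pexp2l ?(ltnW (Y_gt1 t0 YP)) //.
  by rewrite muln_gt0 (n_gt0 t0).
have Y2 := Y_gt1 t0 YP; have Z8 := Z_ge8 t0 YP ZP.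
have Kb : (Z ^ 80 <= K)%N.
  apply: leq_trans KS; apply: leq_trans (_ : Z ^ (8 * S) <= _)%N; last by rewrite leq_pmull.
  rewrite leq_pexp2l //; first by lia.
  have : (10 <= S)%N by apply: leq_trans SY; rewrite leq_pmulr // muln_gt0.
  by lia.
apply: le_trans (_ : _ <= (Z ^ 80)%:R) _; last by rewrite ler_nat.
have -> : Z%:R ^+ 10 * ((3 + 4 * Y%:R * (1 + 2 * Y%:R)) * 10 * Z%:R ^+ 20) =
    (Z ^ 30 * ((3 + 4 * Y * (1 + 2 * Y)) * 10))%:R :> R.
  rewrite !(natrM, natrD, natrX) (_ : 30%N = (10 + 20)%N) // exprD; ring.
rewrite ler_nat (_ : 80%N = (30 + 50)%N) // expnD leq_mul2l; apply/orP; right.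
apply: leq_trans (_ : Z ^ 5 <= _)%N; last by rewrite leq_pexp2l //; lia.
have h1 : (150 <= Z ^ 3)%N by apply: leq_trans (_ : 8 ^ 3 <= _)%N => //; rewrite leq_exp2r.
have h2 : (Y ^ 2 <= Z ^ 2)%N by rewrite leq_exp2r.
rewrite (_ : 5%N = (3 + 2)%N) // expnD; apply: leq_trans (leq_mul h1 h2).
by rewrite -mulnn; move: Y2; clear; nia.
Qed.

Section Code.
Variable cc : algnum.
Local Notation c := (code_algnum cc).
Local Notation g := (gval R (ccen c)).
Local Notation P := (an_prec cc).+1.
Hypothesis cY : (c <= Y)%N.

Lemma poly_bounds : [/\ (size (an_poly cc) <= Y)%N,
  (forall m, m \in an_poly cc -> `|m| <= Y%:Z) & (P <= Y)%N].
Proof.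
split; last exact: leq_trans (prec_lt cc) cY.
  by apply: leq_trans cY; apply: leq_trans (cpoly_le cc); apply: cpoly_size.
move=> m /cpoly_coef h; apply: le_trans h _; rewrite lez_nat.
exact: leq_trans (cpoly_le cc) cY.
Qed.

Lemma center_bound : normc g <= 2 * Y%:R.
Proof.
rewrite ccenE gval_center normcM normcV normc_nat.
have P1 : 1 <= P%:R :> R by rewrite ler1n.
have cb (m : int) : (code_int m < c)%N -> `|m%:~R| <= Y%:R :> R.
  move=> mc; rewrite -intr_norm -[Y%:R]/(Y%:Z%:~R) ler_int.
  by apply: le_trans (code_int_abs m) _; rewrite lez_nat (leq_trans (ltnW mc)).
have hre : (code_int (an_re cc) < c)%N.
  by apply: mem_ldec; rewrite /code_algnum CodeSeq.codeK !inE eqxx orbT.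
have him : (code_int (an_im cc) < c)%N.
  by apply: mem_ldec; rewrite /code_algnum CodeSeq.codeK !inE eqxx !orbT.
apply: le_trans (_ : _ <= normc (Complex (an_re cc)%:~R (an_im cc)%:~R : R[i])) _.
  by rewrite ler_piMr ?normc_ge0 // invf_le1 //; lra.
have -> : Complex (an_re cc)%:~R (an_im cc)%:~R =
   Complex (an_re cc)%:~R 0 + Complex 0 (an_im cc)%:~R :> R[i].
  by apply/eqP; rewrite eq_complex /= addr0 add0r !eqxx.
apply: le_trans (le_normcD _ _) _; rewrite /= !expr0n /= addr0 add0r !sqrtr_sqr.
by have := cb _ hre; have := cb _ him; lra.
Qed.

Lemma p3_estimate :
  let u := gval R (gsub (hd L) (gmul (ccen c) (tl L))) in
  let d := normc (qval l1 - g * qval l2) in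
  [/\ normc u <= d + (1 + 2 * Y%:R) * eta, d <= normc u + (1 + 2 * Y%:R) * eta,
      normc (gval R (tl L)) <= normc (qval l2) + eta &
      normc (qval l2) <= normc (gval R (tl L)) + eta].
Proof.
move=> u d; have [_ _ h1] := gl1; have [_ _ h2] := gl2.
rewrite -[(4 * 5)%N]/20%N -/eta in h1 h2.
have uE : u - (qval l1 - g * qval l2) =
    (gval R (hd L) - qval l1) - g * (gval R (tl L) - qval l2).
  by rewrite /u gvalD gvalN gvalM; ring.
have gb := center_bound; have e0 : 0 <= eta by rewrite divr_ge0 ?exprn_ge0.
have ud : normc (u - (qval l1 - g * qval l2)) <= (1 + 2 * Y%:R) * eta.
  rewrite uE; apply: le_trans (le_normcD _ _) _; rewrite normcN normcM mulrDl mul1r.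
  apply: lerD => //; apply: ler_pM; rewrite ?normc_ge0 //.
have tri (x y : R[i]) (e : R) : normc (x - y) <= e -> normc x <= normc y + e.
  by move=> h; rewrite -[x](subrK y); have := le_normcD (x - y) y; lra.
have tri' (x y : R[i]) (e : R) : normc (x - y) <= e -> normc y <= normc x + e.
  by move=> h; apply: tri; rewrite -normcN opprB.
by split; [exact: tri ud|exact: tri' ud|exact: tri h2|exact: tri' h2].
Qed.

Lemma distE : normc (qval l1 - g * qval l2) = normc (qval (l1 / l2) - g) * normc (qval l2).
Proof.
rewrite -normcM mulrBl -rmorphM divfK //.
Qed.

Lemma pcheck_complete rho : presentation (l1 / l2) cc rho ->
  pcheck c rho L (pT Z S) != 0%N.
Proof.
move=> [h1 h2 h3 h4]; have [b1 b2 b3] := poly_bounds.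
rewrite /pcheck mul5_neq0 hd_algnum h3 h4 !andbT.
apply/and3P; split.
- rewrite /code_algnum !tl_code /= /cond.
  have : (0 < pr (code_int (an_im cc)) (CodeSeq.code (map code_int (an_poly cc))))%N.
    by apply: leq_ltn_trans (pr_gt _ _).
  by rewrite /pr; case: (_ * _)%N.
- rewrite cpolE hom_root; [exact/rootP|exact: b2|exact: b1].
rewrite (gltE R) natrM => {h1 h3 h4}.
have [e1 _ _ e4] := p3_estimate; rewrite distE in e1.
have m := margin.
have P1 : 1 <= P%:R :> R by rewrite ler1n.
have PY : P%:R <= Y%:R :> R by rewrite ler_nat.
have e0 : 0 <= eta by rewrite divr_ge0 ?exprn_ge0.
have Y0 : 0 <= 1 + 2 * Y%:R :> R by rewrite addr_ge0 // mulr_ge0.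
set u := normc (gval R (gsub _ _)) in e1 *; set l := normc (qval l2) in e1 e4 m.
set t := normc (gval R (tl L)) in e4 *.
set q := normc _ in h2 e1.
have q0 : 0 <= q by apply: normc_ge0.
have lp : 0 < l.
  by rewrite lt_neqAle normc_ge0 eq_sym andbT; apply: contraNneq l20 => /eq0_normc/eqP;
    rewrite fmorph_eq0.
have qP : q * P%:R <= 71 / 100.
  exact: sqr_half_lt.
have h5 : u * P%:R <= (q * P%:R) * l + (Y%:R * (1 + 2 * Y%:R)) * eta.
  rewrite [q * _ * l]mulrAC; apply: scaled_bound PY Y0 e0 e1; exact: ler0n.
have h6 : (q * P%:R) * l <= 71 / 100 * l by rewrite ler_pM2r.
rewrite [X in X < _](_ : _ = 4 * (u * P%:R)); last by ring.
have E : (3 + 4 * Y%:R * (1 + 2 * Y%:R)) * eta = 3 * eta + 4 * ((Y%:R * (1 + 2 * Y%:R)) * eta) by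
  ring.
rewrite E in m.
exact: margin_lt h5 h6 m e4 lp e0.
Qed.

Lemma pcheck_sound rho : pcheck c rho L (pT Z S) != 0%N -> presents cc (qval (l1 / l2)).
Proof.
have [b1 b2 b3] := poly_bounds.
rewrite /pcheck mul5_neq0 hd_algnum cpolE hom_root; [|exact: b2|exact: b1] => /and5P[_ rt h3 h4 h5].
have gd : normc (qval (l1 / l2) - g) * P%:R < 1.
  clear rt h4 h5.
  rewrite (gltE R) natrM in h3.
  have [_ e2 e3 _] := p3_estimate; rewrite distE in e2.
  have m := margin.
  have P1 : 1 <= P%:R :> R by rewrite ler1n.
  have PY : P%:R <= Y%:R :> R by rewrite ler_nat.
  have e0 : 0 <= eta by rewrite divr_ge0 ?exprn_ge0.
  have Y0 : 0 <= 1 + 2 * Y%:R :> R by rewrite addr_ge0 // mulr_ge0.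
  have lp : 0 < normc (qval l2).
    by rewrite lt_neqAle normc_ge0 eq_sym andbT; apply: contraNneq l20 => /eq0_normc/eqP;
      rewrite fmorph_eq0.
  rewrite -(ltr_pM2r lp) mul1r.
  set u := normc (gval R (gsub _ _)) in e2 h3 *; set l := normc (qval l2) in e2 e3 m lp *.
  set t := normc (gval R (tl L)) in e3 h3 *.
  set q := normc (_ - g) in e2 *.
  have h6 : q * l * P%:R <= u * P%:R + (Y%:R * (1 + 2 * Y%:R)) * eta.
    by apply: scaled_bound PY Y0 e0 e2; exact: ler0n.
  have {}h3 : 4 * (u * P%:R) < t * 3 by rewrite (_ : _ * _ = u * (4 * P%:R)) //; ring.
  have E : (3 + 4 * Y%:R * (1 + 2 * Y%:R)) * eta = 3 * eta + 4 * ((Y%:R * (1 + 2 * Y%:R)) * eta)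
    by ring.
  rewrite E in m; rewrite mulrAC.
  exact: margin_gt h3 h6 m e3 lp e0.
rewrite (gltE R) gval_one normc_one mul1r qderE in h4.
rewrite (gltE R) gval_one normc_one mul1r mulr1 in h5.
split=> //.
- apply: contraTneq h4; rewrite -/(ipoly R (an_poly cc)) => ->.
  by rewrite deriv0 horner0 normc_zero mul0r -leNgt.
- by rewrite in_discE.
move=> x rx; rewrite in_discE => dx.
apply: (simple_root_unique (z := g) (q := cpoly (an_poly cc)) (P := P)) h4 => //.
- exact: cpoly_size.
- exact: cpoly_coef.
Qed.

End Code.

End PCheck.

(** * The span attached to two presented numbers *)

Section Frame.
Variable R : realType.

Lemma presents_poly c (x : Qbar R) : presents c (qval x) ->
  let p := Poly (an_poly c) in
  [/\ p != 0, root (map_poly intr p) x, (forall k, `|p`_k| <= (code_algnum c)%:Z) &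
      (0 < (size p).-1 <= code_algnum c)%N].
Proof.
move=> [p0 px _ _] p.
have {}p0 : p != 0 by apply: contraNneq p0 => p0; rewrite -/p p0 rmorph0.
have {}px : root (map_poly intr p) x.
  by move: px; rewrite rootE -/(ipoly R (an_poly c)) ipoly_qval fmorph_eq0.
have sp : (size p <= code_algnum c)%N.
  by apply: leq_trans (size_Poly _) (leq_trans (cpoly_size _) (cpoly_le c)).
split=> // [k|].
  rewrite coef_Poly; have [ks|ks] := ltnP k (size (an_poly c)); last first.
    by rewrite nth_default.
  by apply: le_trans (cpoly_coef (mem_nth 0 ks)) _; rewrite lez_nat cpoly_le.
have p1 : map_poly intr p != 0 :> {poly Qbar R}.
  apply: contra_neq p0 => e; apply/polyP => k; rewrite coef0; apply/eqP.
  rewrite -(intr_eq0 R[i]) -(rmorph_int (qval : {rmorphism _ -> _})) -coef_map_id0 //.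
  by rewrite e coef0 rmorph0.
have := leq_trans (root_size_gt1 p1 px) (size_poly _ _); lia.
Qed.

Lemma monomial_frame ca cb (a b : Qbar R) : presents ca (qval a) -> presents cb (qval b) ->
  let X := (code_algnum ca + code_algnum cb)%N in
  exists (T : finType) (w : T -> Qbar R) (t0 : T), [/\ w t0 = 1, (#|T| <= X * X)%N &
    forall Y, (0 < Y)%N -> (X <= Y)%N -> cx w Y 1 a /\ cx w Y 1 b].
Proof.
move=> /presents_poly[p0 pa pE /andP[sp sp']] /presents_poly[q0 qb qE /andP[sq sq']] X.
exists (monomial_ix (Poly (an_poly ca)) (Poly (an_poly cb))), (monomial a b).
exists (Ordinal sp, Ordinal sq); split; first by rewrite /monomial /= !expr0 mulr1.
  by rewrite card_prod !card_ord leq_mul // ?(leq_trans sp') ?(leq_trans sq') // ?leq_addl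
    ?leq_addr.
move=> Y Y0 XY; split.
  apply: (cx_monomial_l _ _ (E := X)) => // k; apply: le_trans (pE k) _.
  by rewrite lez_nat leq_addr.
apply: (cx_monomial_r _ _ (E := X)) => // k; apply: le_trans (qE k) _.
by rewrite lez_nat leq_addl.
Qed.

End Frame.

Section Candidates.
Variable K : comNzRingType.
Implicit Type z : K.

(* The fractions [lam1 z k / lam2 z k], [k < 4], run over [Sset z]. *)
Definition lam1 z k := match k with 0 => z | 2 => z * (2 - z) | _ => z * z end.
Definition lam2 z k := match k with 0 | 1 | 2 => 1 | _ => 2 * z - 1 end.

End Candidates.

Lemma Sset_lam (R : realType) (a l : Qbar R) : Sset a l ->
  exists2 k, (k < 4)%N & lam2 a k != 0 /\ l = lam1 a k / lam2 a k.
Proof.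
by case=> [->|->|->|[h ->]]; [exists 0%N|exists 1%N|exists 2%N|exists 3%N];
  rewrite //= ?oner_eq0 ?divr1 ?expr2.
Qed.

Section Products.

Lemma nrec_prod_neq0 f m : (nrec 1 (fun k r => r * f k)%N m != 0%N) <->
  forall k, (k < m)%N -> f k != 0%N.
Proof.
elim: m => [|m IH] /=; first by split.
rewrite muln_eq0 negb_or; split=> [/andP[/IH h fm] k|h].
  by rewrite ltnS leq_eqVlt => /orP[/eqP->|/h].
by rewrite h // andbT; apply/IH => k km; apply: h; apply: ltnW.
Qed.

Lemma nthcE k c : nthc k c = nth 0%N (ldec c) k.
Proof.
rewrite /nthc; elim: k c => [|k IH] c; first by rewrite /= hd_ldec nth0.
by rewrite iterSr IH tl_ldec nth_behead.
Qed.

Lemma nthc_le k c : (nthc k c <= c)%N.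
Proof.
rewrite nthcE; have [kc|ck] := ltnP k (size (ldec c)); last by rewrite nth_default.
by apply/ltnW/mem_ldec/mem_nth.
Qed.

Lemma nrec_list (R : realType) (P g : nat -> nat) (x : nat -> R[i]) m :
  (forall k, (k < m)%N -> P k != 0%N -> exists2 c, code_algnum c = g k & presents c (x k)) ->
  exists s : seq (algnum * R[i]),
    [/\ nrec 0 (fun k r => cond (P k) (pr (g k) r) r) m = CodeSeq.code [seq code_algnum p.1 | p
      <- s],
        forall k c z, onth s k = Some (c, z) -> presents c z &
        forall z, z \in [seq p.2 | p <- s] <-> exists2 k, (k < m)%N & P k != 0%N /\ z = x k].
Proof.
elim: m => [|m IH] h; first by exists [::]; split=> // [[]//|z]; split=> // -[].
have [|s [e1 e2 e3]] := IH; first by move=> k km; apply: h; apply: ltnW.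
have [Pm|Pm] := eqVneq (P m) 0%N.
  exists s; split=> [||z] //; first by rewrite /= Pm.
  rewrite e3; split=> -[k km [Pk zE]]; exists k => //; first exact: ltnW.
  by move: km; rewrite ltnS leq_eqVlt => /orP[/eqP km|//]; rewrite km Pm in Pk.
have [c cE cx] := h m (ltnSn m) Pm; exists ((c, x m) :: s); split=> [||z].
- by rewrite /= -e1 cE; case: (P m) Pm.
- by move=> [|k] c' z; [move=> [<- <-]|exact: e2].
rewrite inE /=; split=> [/orP[/eqP->|/e3[k km [Pk zE]]]|[k]].
- by exists m.
- by exists k => //; apply: ltnW.
rewrite ltnS leq_eqVlt => /orP[/eqP->[_ ->]|km kE]; first by rewrite eqxx.
by apply/orP; right; apply/e3; exists k.
Qed.

End Products.

(** * Membership test for one candidate *)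

Section Valid.
Variables (R : realType) (Q : Q2closure) (i : {rmorphism Qbar R -> Q2bar Q}).
Variables (T : finType) (w : T -> Qbar R) (t0 : T) (w0 : w t0 = 1).
Variables (X Y Z M S K : nat).
Hypotheses (YP : (2 * #|T| <= Y)%N) (ZP : (Y ^ (3 * #|T|) <= Z)%N) (K0 : (0 < K)%N).
Hypotheses (Y4 : (4 <= Y)%N) (TX : (#|T| <= X)%N).
Local Notation good := (good w Y Z K).

Let gM s t x y u z : good s x u -> good t y z -> good (s + t).+1 (x * y) (gmul u z).
Proof. by move=> gx gy; have := goodM w0 YP ZP K0 gx gy. Qed.
Let gB s t x y u z : good s x u -> good t y z -> good (s + t).+1 (x - y) (gsub u z).
Proof. by move=> gx gy; have := goodB t0 YP ZP K0 gx gy. Qed.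
Let gL s t x z : (s <= t)%N -> good s x z -> good t x z.
Proof. by move=> st h; have := good_le t0 YP ZP K0 st h. Qed.

(** Origin of the size 5: [z (2 - z)] and [2 z - 1] are built from three atoms of size 1 by two
    operations. *)
Lemma good_lam a z k : good 1 a z -> good 5 (lam1 a k) (cl1 k z) /\ good 5 (lam2 a k) (cl2 k z).
Proof.
have g1 : good 1 1 gone.
  by apply: (@good_int R T w t0 Y Z K YP 1); rewrite normr1 lez_nat; apply: leq_trans Y4.
have g2 : good 1 2 gtwo.
  apply: (@good_int R T w t0 Y Z K YP 2); rewrite -[`|_|]/2%:Z lez_nat; exact: leq_trans Y4.
move=> ga; case: k => [|[|[|k]]]; split; rewrite /cl1 /cl2 /=.
- exact: gL ga.
- exact: gL g1.
- exact: gL (gM ga ga).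
- exact: gL g1.
- exact: gL (gM ga (gB g2 ga)).
- exact: gL g1.
- exact: gL (gM ga ga).
- exact: gL (gB (gM g2 ga) g1).
Qed.

Hypotheses (ME : (2 ^ (X * (12 * Z ^ 30 + 3))).+1 = M).
Hypotheses (MS : (35 * 23 ^ M <= S)%N) (KS : (4 * Z ^ (6 * S) <= K)%N).
Variables (a b l1 l2 : Qbar R) (za zb L : nat).
Hypotheses (ga : good 1 a za) (gb : good 1 b zb).
Hypotheses (gl1 : good 5 l1 (hd L)) (gl2 : good 5 l2 (tl L)).

Lemma tests_neq0 k1 k2 k3 k4 k5 : ((1 - k1) * (1 - k2) * (1 - k3) * k4 * k5 != 0)%N =
  [&& ~~ (k1 != 0%N), ~~ (k2 != 0%N), ~~ (k3 != 0%N), k4 != 0%N & k5 != 0%N].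
Proof.
have e m : (1 - m != 0)%N = ~~ (m != 0%N) by case: m.
by rewrite !muln_eq0 !negb_or !e -!andbA.
Qed.

Lemma mem_test :
  ((1 - ztest (hd L) (pT Z S)) * (1 - ztest (tl L) (pT Z S)) *
   (1 - ztest (gsub (hd L) (tl L)) (pT Z S)) *
   exorb L za M (pT Z S) * exorb L zb M (pT Z S) != 0)%N <->
  l2 != 0 /\ Tset2 (qval a) (qval b) (qval (l1 / l2)).
Proof.
have S35 : (35 <= S)%N by apply: leq_trans MS; rewrite leq_pmulr // expn_gt0.
have zt s x z (gx : good s x z) (s35 : (s <= 35)%N) :
    (ztest z (pT Z S) != 0%N) = (x == 0).
  exact: (ztestP w0 YP ZP K0 gx (leq_trans s35 S35) KS).
have orbitE : l2 != 0 -> l1 != 0 -> l1 != l2 -> forall x z, good 1 x z ->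
    exorb L z M (pT Z S) != 0%N <-> finite_orbit (l1 / l2) x.
  move=> l20 l10 l12 x z gx; rewrite (exorbP w0 YP ZP K0 gl1 gl2 gx Y4 MS KS l20).
  by rewrite (inT_orbit w0 YP ZP gl1 gl2 gx i TX ME l10 l20 l12).
clear S35 MS KS ME.
rewrite tests_neq0 (zt _ _ _ gl1 isT) (zt _ _ _ gl2 isT) (zt _ _ _ (gB gl1 gl2) isT).
rewrite subr_eq0 /Tset2.
have l0E : l2 != 0 -> (l1 / l2 != 0) = (l1 != 0).
  by move=> l20; rewrite mulf_eq0 invr_eq0 (negPf l20) orbF.
have l1E : l2 != 0 -> (l1 / l2 != 1) = (l1 != l2).
  by move=> l20; rewrite -(inj_eq (mulIf l20)) divfK // mul1r.
split=> [/and5P[l10 l20 l12]|[l20 [/Tset_qval[l10 l11 fa] /Tset_qval[_ _ fb]]]].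
  move=> /(orbitE l20 l10 l12 _ _ ga) fa /(orbitE l20 l10 l12 _ _ gb) fb.
  by split=> //; split; apply/Tset_qval; rewrite l0E // l1E.
rewrite l0E // in l10; rewrite l1E // in l11.
apply/and5P; split; [exact: l10|exact: l20|exact: l11| |].
  exact/(orbitE l20 l10 l11 _ _ ga).
exact/(orbitE l20 l10 l11 _ _ gb).
Qed.

End Valid.

Lemma sizes X cs kap n : (0 < X)%N -> (n <= X * X)%N ->
  let Y := pY X cs in let Z := pZ X Y in let M := pM X Z in let S := pS M Y in
  let K := pK Z S kap in
  [/\ (2 * n <= Y)%N, (Y ^ (3 * n) <= Z)%N, (0 < K)%N, (10 <= Y)%N & (35 * 23 ^ M <= S)%N] /\
  [/\ (4 * Z ^ (6 * S) <= K)%N, (10 * (Y.+1 * Y.+1) <= S)%N, (4 * Z ^ (8 * S) <= K)%N,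
      (X + cs <= Y)%N & (kap <= K)%N].
Proof.
move=> X0 nX Y Z M S K.
have Y10 : (10 <= Y)%N by rewrite /Y /pY leq_addl.
have YP : (2 * n <= Y)%N.
  apply: leq_trans (_ : 2 * (X * X) <= _)%N; first by rewrite leq_mul2l.
  by rewrite /Y /pY; lia.
have XY : (X + cs <= Y)%N by rewrite /Y /pY; lia.
have Y0 : (0 < Y)%N by apply: leq_trans Y10.
have ZP : (Y ^ (3 * n) <= Z)%N by rewrite leq_pexp2l // leq_mul2l.
have Z0 : (0 < Z)%N by rewrite expn_gt0 Y0.
have M1 : (1 <= 23 ^ M)%N by rewrite expn_gt0.
have KS : (4 * Z ^ (8 * S) <= K)%N by rewrite /K /pK leq_pmulr.
have KL : (kap <= K)%N.
  by rewrite /K /pK; apply: leq_trans (leqnSn _) _; rewrite leq_pmull // muln_gt0 expn_gt0 Z0.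
have K0 : (0 < K)%N by rewrite /K /pK !muln_gt0 expn_gt0 Z0.
clearbody Y; clearbody Z; clearbody K.
have MS : (35 * 23 ^ M <= S)%N.
  rewrite /S /pS; move: (23 ^ M)%N M1 => m m1; nia.
have SY : (10 * (Y.+1 * Y.+1) <= S)%N.
  rewrite /S /pS; move: (23 ^ M)%N M1 => m m1; nia.
split; split=> //; apply: leq_trans KS; rewrite leq_mul2l /= leq_pexp2l //.
by rewrite leq_mul2r orbT.
Qed.

(** * Soundness and existence of certificates *)

Section Certificate.
Variables (R : realType) (Q : Q2closure) (i : {rmorphism Qbar R -> Q2bar Q}).
Variables (a b : Qbar R) (ca cb : algnum).
Hypotheses (pa : presents ca (qval a)) (pb : presents cb (qval b)).
Local Notation na := (code_algnum ca).
Local Notation nb := (code_algnum cb).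
Local Notation X := (na + nb)%N.

Definition cand1 k := if (k < 4)%N then lam1 a k else lam1 b (k - 4).
Definition cand2 k := if (k < 4)%N then lam2 a k else lam2 b (k - 4).
Definition valid wt :=
  acheck na (pza wt) (cK wt X) != 0%N /\ acheck nb (pzb wt) (cK wt X) != 0%N.

(** Once the approximations of [a] and [b] are known to be within [1 / K], every later test is
    settled by the exact values; the centres in the certificate are exact data and need no such
    control. *)
Lemma candidates_sound wt : valid wt -> forall k,
  (inT k wt X != 0%N <-> cand2 k != 0 /\
     Tset2 (qval a) (qval b) (qval (cand1 k / cand2 k))) /\
  forall cc rho, cand2 k != 0 -> (code_algnum cc <= pcs wt)%N ->
    (presentation (cand1 k / cand2 k) cc rho ->
       pcheck (code_algnum cc) rho (candL wt k) (cT wt X) != 0%N) /\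
    (pcheck (code_algnum cc) rho (candL wt k) (cT wt X) != 0%N ->
       presents cc (qval (cand1 k / cand2 k))).
Proof.
move=> [ha hb] k.
have [T [w [t0 [w0 TX cab]]]] := monomial_frame pa pb.
have X0 : (0 < X)%N by rewrite addn_gt0 (leq_ltn_trans (leq0n _) (prec_lt ca)).
have [] := @sizes X (pcs wt) (pkap wt) _ X0 TX.
rewrite -/(cY wt X) -/(cZ wt X) -/(cM wt X) -/(cS wt X) -/(cK wt X).
move=> [YP ZP K0 Y10 MS] [K6 SY KS XY _].
have [cxa cxb] := cab (cY wt X) (leq_trans (isT : 1 <= 10)%N Y10) (leq_trans (leq_addr _ _) XY).
have ge x c z : presents c (qval x) -> cx w (cY wt X) 1 x -> acheck (code_algnum c) z (cK wt X)
  != 0%N ->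
    good w (cY wt X) (cZ wt X) (cK wt X) 1 x z.
  move=> px cxx h; split; [exact: isT|exact: cxx|].
  apply: le_trans (ltW (acheck_sound K0 px h)) _.
  rewrite -[X in X <= _]mul1r; apply: ler_wpM2r; first by rewrite invr_ge0 ler0n.
  exact: (expZ_ge1 R t0 YP ZP).
have {ha}ga := ge _ _ _ pa cxa ha; have {hb ge}gb := ge _ _ _ pb cxb hb.
have [gl1 gl2] : good w (cY wt X) (cZ wt X) (cK wt X) 5 (cand1 k) (hd (candL wt k)) /\
    good w (cY wt X) (cZ wt X) (cK wt X) 5 (cand2 k) (tl (candL wt k)).
  have Y4 := leq_trans (isT : 4 <= 10)%N Y10.
  rewrite /cand1 /cand2 /candL /ltb; case: (k < 4)%N; rewrite /cond hd_pr tl_pr.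
    exact: (good_lam w0 YP ZP K0 Y4 _ ga).
  exact: (good_lam w0 YP ZP K0 Y4 _ gb).
split.
  rewrite /inT -[cT wt X]/(pT (cZ wt X) (cS wt X)).
  have ME : (2 ^ (X * X * (12 * cZ wt X ^ 30 + 3))).+1 = cM wt X by rewrite /cM /pM.
  exact: (mem_test i w0 YP ZP K0 (leq_trans (isT : 4 <= 10)%N Y10) TX ME MS K6 ga gb gl1 gl2).
move=> cc rho l20 cs; have cY := leq_trans cs (leq_trans (leq_addl _ _) XY).
split=> [p|p].
  exact: (pcheck_complete w0 YP ZP K0 SY KS gl1 gl2 l20 cY p).
exact: (pcheck_sound w0 YP ZP K0 SY KS gl1 gl2 l20 cY p).
Qed.

Lemma mul3_neq0 k1 k2 k3 : (k1 * k2 * k3 != 0)%N = [&& k1 != 0%N, k2 != 0%N & k3 != 0%N].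
Proof. by rewrite !muln_eq0 !negb_or -andbA. Qed.

Lemma checkP wt : check wt na nb != 0%N <-> valid wt /\
  forall k, (k < 8)%N -> inT k wt X != 0%N ->
    pcheck (nthc k (pcs wt)) (nthc k (prho wt)) (candL wt k) (cT wt X) != 0%N.
Proof.
have ce k1 k2 : (cond k1 k2 1 != 0%N) <-> (k1 != 0%N -> k2 != 0%N).
  case: k1 => [|k1]; rewrite /cond; first by split.
  by split=> [h _|]; [exact: h|apply].
rewrite /check mul3_neq0; split=> [/and3P[h1 h2 /nrec_prod_neq0 h]|[[h1 h2] h]].
  split; first exact: (conj h1 h2).
  move=> k k8; exact (proj1 (ce (inT k wt X) (pcheck (nthc k (pcs wt)) (nthc k (prho wt)) (candL
    wt k) (cT wt X))) (h k k8)).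
apply/and3P; split; [exact: h1|exact: h2|].
apply/nrec_prod_neq0 => k k8; exact (proj2 (ce (inT k wt X) (pcheck (nthc k (pcs wt)) (nthc k
  (prho wt)) (candL wt k) (cT wt X))) (h k k8)).
Qed.

Hypothesis TS : Tset2 (qval a) (qval b) `<=` qval @` (Sset a `|` Sset b).

Lemma candidates_complete z : Tset2 (qval a) (qval b) z ->
  exists2 k, (k < 8)%N & cand2 k != 0 /\ z = qval (cand1 k / cand2 k).
Proof.
move=> /TS[l [/Sset_lam|/Sset_lam][k k4 [l20 ->]] <-].
  by exists k; [exact: leq_trans k4 _|rewrite /cand1 /cand2 k4].
by exists (4 + k)%N; rewrite ?ltn_add2l // /cand1 /cand2 ltnNge leq_addr /= addKn.
Qed.

Lemma check_sound wt : check wt na nb != 0%N -> exists s : seq (algnum * R[i]),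
  [/\ out wt na nb = CodeSeq.code [seq code_algnum p.1 | p <- s],
      forall k c z, onth s k = Some (c, z) -> presents c z &
      forall z, z \in [seq p.2 | p <- s] <-> Tset2 (qval a) (qval b) z].
Proof.
move=> /checkP[vw pw].
have [|s [e1 e2 e3]] := @nrec_list R (fun k => inT k wt X) (fun k => nthc k (pcs wt))
   (fun k => qval (cand1 k / cand2 k)) 8.
  move=> k k8 Tk; have [h1 h2] := candidates_sound vw k.
  have := pw k k8 Tk; have [l20 _] := (h1.1 Tk); move=> p.
  have [cc ccE] : exists cc, code_algnum cc = nthc k (pcs wt).
    apply: algnum_of_code; move: p; rewrite /pcheck mul5_neq0 => /and5P[p _ _ _ _].
    by move: p; case: (tl _).
  exists cc; [exact: ccE|rewrite -ccE in p].
  have cs : (code_algnum cc <= pcs wt)%N by rewrite ccE; exact: nthc_le.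
  by have [_ q] := h2 cc (nthc k (prho wt)) l20 cs; exact: q p.
exists s; split; [exact: e1|exact: e2|move=> z].
rewrite e3; split=> [[k _ [Tk ->]]|Tz].
  by have [[h _] _] := candidates_sound vw k; have [_] := h Tk.
have [k k8 [l20 zE]] := candidates_complete Tz; exists k; first exact: k8.
split; last exact: zE.
by have [[_ h] _] := candidates_sound vw k; apply: h; split; rewrite -?zE.
Qed.

(** The order of choices matters: [K] depends on the presentations [cs] and on [kap], but not on the
    approximations [za] and [zb], which can therefore be taken last, to the accuracy required by
    [K]. *)
Lemma certificate_exists : exists wt, check wt na nb != 0%N.
Proof.
have [cf hcf] := choice (fun k => presentation_exists (cand1 k / cand2 k)).
have [rf hrf] := choice hcf.
pose cs := CodeSeq.code (mkseq (fun k => code_algnum (cf k)) 8).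
pose rs := CodeSeq.code (mkseq rf 8).
have [Ka hKa] := acheck_complete pa; have [Kb hKb] := acheck_complete pb.
pose kap := maxn Ka Kb; pose Y := pY X cs; pose Z := pZ X Y.
pose K := pK Z (pS (pM X Z) Y) kap.
have kapK : (kap <= K)%N.
  have [T [w [t0 [w0 TX cab]]]] := monomial_frame pa pb.
  have X0 : (0 < X)%N by rewrite addn_gt0 (leq_ltn_trans (leq0n _) (prec_lt ca)).
  by have [_ []] := @sizes X cs kap _ X0 TX.
have [za hza] := hKa K (leq_trans (leq_maxl _ _) kapK).
have [zb hzb] := hKb K (leq_trans (leq_maxr _ _) kapK).
exists (pr za (pr zb (pr kap (pr cs rs)))); set wt := pr za _.
have csE : pcs wt = cs by rewrite /pcs !tl_pr hd_pr.
have rsE : prho wt = rs by rewrite /prho !tl_pr.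
have KE : cK wt X = K by rewrite /cK /cS /cM /cZ /cY csE /pkap !tl_pr hd_pr.
have vw : valid wt.
  by rewrite /valid KE /pza /pzb !tl_pr !hd_pr; split; [exact: hza|exact: hzb].
apply/checkP; split; first exact: vw.
move=> k k8 Tk; have [h1 h2] := candidates_sound vw k; have [l20 _] := h1.1 Tk.
have cE : nthc k (pcs wt) = code_algnum (cf k) by rewrite csE nthcE CodeSeq.codeK nth_mkseq.
have rE : nthc k (prho wt) = rf k by rewrite rsE nthcE CodeSeq.codeK nth_mkseq.
have le : (code_algnum (cf k) <= pcs wt)%N by rewrite -cE; exact: nthc_le.
have [q _] := h2 (cf k) (rf k) l20 le; rewrite cE rE; exact: q (hrf k).
Qed.

End Certificate.

(** The program is fixed before [a] and [b]; the embedding [i] enters only the proof of its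
    correctness. *)
Lemma Tset2_effectively_computable (R : realType) (L : Q2closure)
    (i : {rmorphism Qbar R -> Q2bar L}) :
  effectively_computable
    (fun a b => [/\ a != 0, a != 1, b != 0, b != 1 & Rset i a `&` Rset i b = set0])
    (fun a b => Tset2 (Qbar_val a) (Qbar_val b)).
Proof.
have [f hf] := search_program; exists f => a b ca cb [a0 a1 b0 b1 Rab] pa pb.
have TS : Tset2 (qval a) (qval b) `<=` qval @` (Sset a `|` Sset b).
  have [TM MS _] := first_part a0 a1 b0 b1 Rab.
  by move=> z /TM[l /MS ? <-]; exists l.
have [wt cw ev] := hf _ _ (certificate_exists i pa pb).
have [s [e1 e2 e3]] := check_sound i pa pb TS cw.
by exists s; split; [rewrite -e1; exact: ev|exact: e2|exact: e3].
Qed.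

Theorem proposition7 (R : realType) (L : Q2closure)
    (i : {rmorphism Qbar R -> Q2bar L}) :
  [/\ forall a b : Qbar R, a != 0 -> a != 1 -> b != 0 -> b != 1 ->
        Rset i a `&` Rset i b = set0 ->
        let M := (Sset a `&` Sset b) `|` (Sset a `&` Rset i b)
                   `|` (Rset i a `&` Sset b) in
        [/\ Tset2 (Qbar_val a) (Qbar_val b) `<=` @Qbar_val R @` M,
            M `<=` Sset a `|` Sset b &
            finite_set (Tset2 (Qbar_val a) (Qbar_val b))],
      effectively_computable
        (fun a b => [/\ a != 0, a != 1, b != 0, b != 1 &
                        Rset i a `&` Rset i b = set0])
        (fun a b => Tset2 (Qbar_val a) (Qbar_val b)) &
      forall a b : Qbar R, a != 0 -> a != 1 -> b != 0 -> b != 1 ->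
        [\/ rho i a <> rho i b,
            [/\ rho i a = rho i b,
                rho i a <> Some 0, rho i a <> Some 1, rho i a <> None &
                (v2 i (a - b)%R <= (1 / 2)%R%:E)%E],
            [/\ rho i a = rho i b, rho i b = Some 1,
                (0 < v2 i (a - 1)%R)%E, (v2 i (a - 1)%R <= 1)%E &
                v2 i (a - b) = v2 i (a - 1)] |
            [/\ rho i a = rho i b, rho i b = Some 0,
                (v2 i a <= 1)%E & v2 i (a - b) = v2 i a] \/
            [/\ rho i a = rho i b, rho i b = None,
                (- 1 <= v2 i a)%E & v2 i (a - b) = v2 i b]] ->
        Rset i a `&` Rset i b = set0].
Proof.
split; last exact: Rset_disjoint.
  exact: first_part.
exact: Tset2_effectively_computable.
Qed.
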